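(* Let $k\in\mathbf{N}$. Let $X$ be a $k$-simply connected graph with cocompact group of isometries. Then $X$ is LG-rigid if and only if there exists $R$ such that every $k$-simply connected graph which is $R$-locally $X$ is isometric to $X$.
   Context: A ''graph'' means a connected, locally finite graph without loops or multiple edges, equipped with the geodesic metric giving each edge length $1$; ''$x\in X$'' means that $x$ is a vertex of $X$; balls are closed balls. The isometry group is cocompact if it has finitely many orbits of vertices. A covering from a graph $X$ to a graph $Y$ is a graph covering map (a surjective graph morphism which, for every vertex $x$, maps the neighbors of $x$ bijectively onto the neighbors of its image); $Y$ is covered by $X$ if such a map $X\to Y$ exists. Given a graph $X$ and $R>0$, a graph $Y$ is $R$-locally $X$ if for every vertex $y\in Y$ there exists $x\in X$ such that the balls $B_X(x,R)$ and $B_Y(y,R)$, equipped with their intrinsic geodesic metrics, are isometric. $X$ is LG-rigid at scale $R$ if every graph which is $R$-locally $X$ is covered by $X$. $X$ is LG-rigid if it is LG-rigid at scale $R$ for some $R>0$. For a graph $X$ and $k\in\mathbf{N}$, $P_k(X)$ is the 2-dimensional CW-complex whose 1-skeleton is $X$ and whose 2-cells are $m$-gons, $0\le m\le k$, one attached along each simple loop $(x_0,\dots,x_m=x_0)$ of length $m$ in $X$ (up to cyclic permutations). $X$ is $k$-simply connected if $P_k(X)$ is simply connected. *)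

(* Defs.v *)
From HB Require Import structures.
From mathcomp Require Import all_boot all_order all_algebra.
From mathcomp Require Import all_classical all_reals all_analysis.

Set Implicit Arguments.
Unset Strict Implicit.
Unset Printing Implicit Defensive.

Import Order.TTheory GRing.Theory Num.Theory.
Import numFieldNormedType.Exports.

Local Open Scope classical_set_scope.
Local Open Scope ring_scope.

(** * Graphs and coverings *)

Record graph := Graph {
  vertex :> choiceType;
  adj : rel vertex;
  adj_sym : symmetric adj;
  adj_irr : irreflexive adj;
  vertex_inh : inhabited vertex;
  adj_connected : forall x y, exists2 w, path adj x w & last x w = y;
  adj_locally_finite : forall x, finite_set [set y | adj x y]
}.

Definition neighbors (X : graph) (x : X) : set X := [set y | adj x y].

Definition is_covering (X Y : graph) (f : X -> Y) : Prop :=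
  set_surj setT setT f /\
  forall x, set_bij (neighbors x) (neighbors (f x)) f.

Definition covers (X Y : graph) : Prop := exists f : X -> Y, is_covering f.

(** * Geometric realizations *)

(* [p] lies in the closed simplex spanned by the (distinct) vertices listed in
   [s], a point being given by its barycentric coordinates. *)
Definition in_simplex (R : realType) (W : choiceType) (s : seq W) (p : W -> R) :
    Prop :=
  [/\ forall w, 0 <= p w, forall w, w \notin s -> p w = 0
    & \sum_(w <- s) p w = 1].

(* The simplices of the complex are those listed in [K] together with their
   faces; faces need not be listed, since closed simplices contain them. *)
Record realization (R : realType) (W : choiceType) (K : set (seq W)) :=
  Realization {
    bary :> W -> R;
    baryP : exists2 s, K s & in_simplex s bary
  }.
Arguments realization R {W} K.

HB.instance Definition _ (R : realType) (W : choiceType) (K : set (seq W)) :=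
  gen_eqMixin (realization R K).
HB.instance Definition _ (R : realType) (W : choiceType) (K : set (seq W)) :=
  gen_choiceMixin (realization R K).

(* The weak (CW) topology: a set is open when its trace on every closed
   simplex is open for the Euclidean topology of that simplex. *)
Section WeakTopology.
Variables (R : realType) (W : choiceType) (K : set (seq W)).

Definition cw_open (U : set (realization R K)) : Prop :=
  forall (s : seq W) (p : realization R K),
    K s -> in_simplex s p -> U p ->
    exists2 e : R, 0 < e &
      forall q : realization R K, in_simplex s q ->
        (forall w, w \in s -> `|p w - q w| < e) -> U q.

Lemma cw_openT : cw_open setT.
Proof. by move=> s p _ _ _; exists 1. Qed.

Lemma cw_openI : setI_closed cw_open.
Proof.
move=> U V oU oV s p Ks sp [Up Vp].
have [e e0 He] := oU s p Ks sp Up; have [d d0 Hd] := oV s p Ks sp Vp.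
exists (Num.min e d); first by rewrite lt_min e0 d0.
move=> q sq pq; split; [apply: He | apply: Hd] => // w ws;
  by have := pq w ws; rewrite lt_min => /andP[].
Qed.

Lemma cw_open_bigU (I : Type) (f : I -> set (realization R K)) :
  (forall i, cw_open (f i)) -> cw_open (\bigcup_i f i).
Proof.
move=> of_ s p Ks sp [i _ fip].
have [e e0 He] := of_ i s p Ks sp fip.
by exists e => // q sq pq; exists i => //; exact: He.
Qed.

HB.instance Definition _ :=
  isOpenTopological.Build (realization R K) cw_openT cw_openI cw_open_bigU.
End WeakTopology.

(** * The metric graph *)

Definition graph_simplices (X : graph) : set (seq X) :=
  [set s | (exists x, s = [:: x]) \/ (exists x y, adj x y /\ s = [:: x; y])].
Arguments graph_simplices : clear implicits.

Definition point (R : realType) (X : graph) : Type :=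
  realization R (graph_simplices X).

Lemma vertex_pointP (R : realType) (X : graph) (x : X) :
  exists2 s, graph_simplices X s & in_simplex s (fun w => (w == x)%:R : R).
Proof.
exists [:: x]; first by left; exists x.
split=> [w|w|]; first exact: ler0n.
  by rewrite inE => /negbTE ->.
by rewrite big_seq1 eqxx.
Qed.

Definition vertex_point (R : realType) (X : graph) (x : X) : point R X :=
  Realization (vertex_pointP R x).

(* [pl_path A p q l]: there is a piecewise linear path of length [l] from [p]
   to [q] inside [A].  Each piece is a straight segment of a single edge
   [x y]; as edges have length 1 and the coordinate at [x] is affine along the
   edge, the segment from [p] to [q] has length [`|p x - q x|]. *)
Inductive pl_path (R : realType) (X : graph) (A : set (point R X)) :
    point R X -> point R X -> R -> Prop :=
| pl_path_nil (p : point R X) : A p -> pl_path A p p 0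
| pl_path_cons (p q r : point R X) (x y : X) (l : R) :
    adj x y -> in_simplex [:: x; y] p -> in_simplex [:: x; y] q ->
    (forall (t : R) (z : point R X), 0 <= t <= 1 ->
       (forall w, z w = (1 - t) * p w + t * q w) -> A z) ->
    pl_path A q r l ->
    pl_path A p r (`|p x - q x| + l).

(* The geodesic metric intrinsic to the subset [A] of the metric graph. *)
Definition geodist (R : realType) (X : graph) (A : set (point R X))
    (p q : point R X) : R :=
  inf [set l | pl_path A p q l].

Definition gball (R : realType) (X : graph) (x : X) (r : R) :
    set (point R X) :=
  [set p | geodist setT (vertex_point R x) p <= r].

(* Isometries between [A] and [B] with their intrinsic geodesic metrics. *)
Definition isometry (R : realType) (X Y : graph)
    (A : set (point R X)) (B : set (point R Y))
    (f : point R X -> point R Y) : Prop :=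
  set_bij A B f /\
  forall p q, A p -> A q -> geodist B (f p) (f q) = geodist A p q.

Definition isometric_sets (R : realType) (X Y : graph)
    (A : set (point R X)) (B : set (point R Y)) : Prop :=
  exists f, isometry A B f.

Definition isometric (R : realType) (X Y : graph) : Prop :=
  isometric_sets (@setT (point R X)) (@setT (point R Y)).

Definition cocompact_isometry_group (R : realType) (X : graph) : Prop :=
  exists s : seq X, forall x, exists2 y, y \in s &
    exists2 g : point R X -> point R X,
      isometry setT setT g & g (vertex_point R y) = vertex_point R x.

(** * Local-to-global rigidity *)

Definition locally_graph (R : realType) (r : R) (X Y : graph) : Prop :=
  forall y : Y, exists x : X, isometric_sets (gball x r) (gball y r).

Definition LG_rigid_at (R : realType) (r : R) (X : graph) : Prop :=
  forall Y : graph, locally_graph r X Y -> covers X Y.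

Definition LG_rigid (R : realType) (X : graph) : Prop :=
  exists2 r : R, 0 < r & LG_rigid_at r X.

(** * Simple connectedness *)

Definition path_connected (R : realType) (T : topologicalType) : Prop :=
  forall x y : T, exists g : R -> T,
    [/\ {within `[0, 1]%classic, continuous g}, g 0 = x & g 1 = y].

Definition null_homotopic (R : realType) (T : topologicalType) (g : R -> T) :
    Prop :=
  exists H : R * R -> T,
    [/\ {within `[0, 1]%classic `*` `[0, 1]%classic, continuous H},
        forall s, 0 <= s <= 1 -> H (s, 0) = g s,
        forall s, 0 <= s <= 1 -> H (s, 1) = g 0
      & forall t, 0 <= t <= 1 -> H (0, t) = g 0 /\ H (1, t) = g 0].

Definition simply_connected (R : realType) (T : topologicalType) : Prop :=
  path_connected R T /\
  forall g : R -> T, {within `[0, 1]%classic, continuous g} -> g 0 = g 1 ->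
    null_homotopic g.

(** * The polygonal complex *)

(* [c] lists the vertices x_0, ..., x_(m-1) of a simple loop of length at most
   [k], with x_m = x_0.  The graph having no loops or multiple edges, simple
   loops have at least three vertices; the back-and-forth walks of length 2
   and the constant walks of length 0 are not counted. *)
Definition simple_loop (X : graph) (k : nat) (c : seq X) : Prop :=
  (2 < size c <= k)%N /\ ucycle (@adj X) c.

Definition rotations (X : graph) (c : seq X) : set (seq X) :=
  [set d | exists i, d = rot i c].

(* The 2-cell attached along a simple loop is a polygon, cut into the triangles
   spanned by its centre and its sides.  The centre is labelled by the class of
   the loop up to cyclic permutation. *)
Definition polygonal_simplices (X : graph) (k : nat) :
    set (seq (X + set (seq X))%type) :=
  [set s | [\/ exists x : X, s = [:: inl x],
               exists x y : X, adj x y /\ s = [:: inl x; inl y]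
             | exists (c : seq X) (x : X), [/\ simple_loop k c, x \in c
                 & s = [:: inr (rotations c); inl x; inl (next c x)]]]].
Arguments polygonal_simplices : clear implicits.

Definition polygonal_complex (R : realType) (k : nat) (X : graph) :
    topologicalType :=
  realization R (polygonal_simplices X k).

Definition k_simply_connected (R : realType) (k : nat) (X : graph) : Prop :=
  simply_connected R (polygonal_complex R k X).

(* Main.v *)
(* Simple connectedness of the polygonal complex is made combinatorial: it holds exactly
   when every closed walk can be contracted by inserting and deleting back-and-forths
   and simple loops of length at most k.  One half is needed as "a covering of a
   k-simply connected graph along which short loops lift to loops is injective", the
   other as "a graph all of whose closed walks contract has a simply connected complex",
   which applies to the cover built from classes of walks.

   Let X be infinite.  An isometry between large balls maps some vertex to a vertex (a
   branching point, or the centre when X is a line), so being R-locally X means having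
   combinatorially the same balls as X.
   - If X is LG-rigid and Y is k-simply connected and R-locally X, then X covers Y.
     Counting closed walks of bounded length at a vertex where X has the most of them
     shows that short loops of Y lift to loops, so the covering is an isomorphism.
   - Conversely, closed walks of bounded length in X contract within a uniform radius by
     cocompactness, so those of a graph Y that is R-locally X contract too.  Hence the
     cover of Y by classes of walks has the same small balls as Y; it is k-simply
     connected, thus isometric to X, and X covers Y.

   If X is finite, a large ball is the whole graph, so Y is isometric to X.  Isometric
   graphs cover each other: an isometry respects vertices up to a correction that is
   needed only for lines and cycles, where a covering is written down directly. *)
From HB Require Import structures.
From mathcomp Require Import all_boot all_order all_algebra.
From mathcomp Require Import all_classical all_reals all_analysis.
From mathcomp Require Import zify ring lra.
Require Import Defs.
Set Implicit Arguments. Unset Strict Implicit. Unset Printing Implicit Defensive.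
Import Order.TTheory GRing.Theory Num.Theory.
Local Open Scope nat_scope.

(** * Walks *)

Section Walks.
Variable X : graph.
Implicit Types (x y z : X) (w d : seq X).

(** That closed walks of [X] contract is read off its own cover by classes of walks: monodromy makes
    this cover injective, so closed walks lift to closed walks, and upstairs they contract by
    construction.

    Maps into the complex are handled through barycentric coordinates. Local finiteness makes
    coordinatewise continuity sufficient for the weak topology, and homotopies are assembled from
    straight segments inside single simplices.

    Radii have the form [n + 1/2]. Such a ball contains every edge whose two ends are within [n] of
    the centre, so its intrinsic metric restricts to length along edges; it also contains the first
    half of every edge issuing from these vertices, so that their degrees can be seen.

    Counting works because a covering [X -> Y] injects the closed walks at [x] into those at its
    image, whose number is bounded by the maximal count in [X]. At a vertex attaining the maximum,
    every short closed walk below is therefore the image of a closed walk; cocompactness puts such a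
    vertex near any given one, which is where the constant in the radius comes from. *)

Lemma adj_neq x y : adj x y -> x != y.
Proof. by apply: contraTneq => ->; rewrite adj_irr. Qed.

Definition inv_walk x w : seq X := rev (belast x w).

Lemma path_inv_walk x w : path (@adj X) x w ->
  path (@adj X) (last x w) (inv_walk x w).
Proof.
rewrite /inv_walk rev_path => pw.
by rewrite (eq_path (e' := @adj X)) // => a b /=; rewrite adj_sym.
Qed.

Lemma last_inv_walk x w : last (last x w) (inv_walk x w) = x.
Proof. by case: w => //= y w; rewrite /inv_walk /= rev_cons last_rcons. Qed.

Lemma size_inv_walk x w : size (inv_walk x w) = size w.
Proof. by rewrite size_rev size_belast. Qed.

Lemma ex_walk_size x y :
  exists n, `[< exists w, [/\ path (@adj X) x w, last x w = y & size w = n] >].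
Proof.
by have [w pw lw] := adj_connected x y; exists (size w); apply/asboolP; exists w.
Qed.

Definition dist x y : nat := ex_minn (ex_walk_size x y).

Lemma distP x y :
  exists w, [/\ path (@adj X) x w, last x w = y & size w = dist x y].
Proof. by rewrite /dist; case: ex_minnP => n /asboolP. Qed.

Lemma dist_le_walk x w : path (@adj X) x w -> dist x (last x w) <= size w.
Proof.
by move=> pw; rewrite /dist; case: ex_minnP => n _; apply; apply/asboolP; exists w.
Qed.

Lemma distxx x : dist x x = 0.
Proof. by apply/eqP; rewrite -leqn0; exact: (@dist_le_walk x [::]). Qed.

Lemma dist0_eq x y : dist x y = 0 -> x = y.
Proof. by move=> d0; have [[|a w] []] := distP x y; rewrite d0. Qed.

Lemma dist_sym x y : dist x y = dist y x.
Proof.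
suff le a b : dist a b <= dist b a by apply/eqP; rewrite eqn_leq !le.
have [w [pw <- <-]] := distP b a.
have := dist_le_walk (path_inv_walk pw).
by rewrite last_inv_walk size_inv_walk.
Qed.

Lemma dist_triangle x y z : dist x z <= dist x y + dist y z.
Proof.
have [w [pw lw <-]] := distP x y; have [v [pv lv <-]] := distP y z.
have := @dist_le_walk x (w ++ v); rewrite cat_path pw lw pv size_cat last_cat lw lv.
by apply.
Qed.

Lemma dist_adj x y : adj x y -> dist x y <= 1.
Proof. by move=> xy; apply: (@dist_le_walk x [:: y]); rewrite /= xy. Qed.

Lemma dist_adj_le x y z : adj y z -> dist x z <= (dist x y).+1.
Proof.
move=> yz; rewrite (leq_trans (dist_triangle x y z)) // -addn1 leq_add2l.
exact: dist_adj.
Qed.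

Lemma dist_pred x z n : dist x z = n.+1 -> exists2 y, adj y z & dist x y = n.
Proof.
move=> dn; have [w] := distP x z; rewrite dn.
case/lastP: w => [[]//|w a]; rewrite rcons_path last_rcons size_rcons.
move=> [/andP[pw wa] az [sw]]; subst a; exists (last x w) => //.
apply/eqP; rewrite eqn_leq -{1}sw dist_le_walk //= -ltnS -dn.
exact: dist_adj_le.
Qed.

Lemma walk_in_ball x w n : path (@adj X) x w -> size w <= n ->
  all (fun y => dist x y <= n) w.
Proof.
move=> pw sn; apply/allP => y /splitPr yw; case: yw pw sn => w1 w2.
rewrite -cat_rcons cat_path size_cat => /andP[p1 _] sn.
have := dist_le_walk p1; rewrite last_rcons => h.
by rewrite (leq_trans h) // (leq_trans _ sn) // leq_addr.
Qed.

Lemma ex_nbrs x : exists s : seq X, forall y, (y \in s) = adj x y.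
Proof.
have [s sE] := (finite_seqP _).1 (adj_locally_finite x).
exists s => y; have /= sEy := congr1 (@^~ y) sE.
by apply/idP/idP => [ys|xy]; [rewrite sEy|rewrite -sEy].
Qed.

Lemma ex_walks L x : exists ws : seq (seq X),
  forall w, path (@adj X) x w -> size w <= L -> w \in ws.
Proof.
elim: L x => [|L IH] x.
  by exists [:: [::]] => -[|a w] //= _; rewrite leqn0.
have /choice[nx nxP] := ex_nbrs; have /choice[f fP] := IH.
exists ([::] :: flatten [seq [seq y :: w | w <- f y] | y <- nx x]).
move=> [|a w] //= /andP[xa pw] sw; rewrite inE /=.
apply/flatten_mapP; exists a; first by rewrite nxP.
by apply: map_f; exact: fP.
Qed.

Lemma ex_ball n x : exists s : seq X, forall y, dist x y <= n -> y \in s.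
Proof.
have [ws wsP] := ex_walks n x; exists [seq last x w | w <- ws] => y dy.
have [w [pw lw sw]] := distP x y; rewrite -lw.
by apply: (map_f (last x)); apply: wsP => //; rewrite sw.
Qed.

End Walks.

(** * Homotopy of walks *)

Section Homotopy.
Variables (k : nat) (X : graph).
Implicit Types (x y z : X) (w d : seq X) (P Q : pred X).

(* The loop [a :: d] is a back-and-forth of an edge or a simple loop of length
   at most [k]. *)
Definition elementary_loop x d : Prop :=
  [/\ path (@adj X) x d, last x d = x, uniq d & size d <= maxn 2 k].

(** Walks omit their starting vertex. [P] confines the homotopy: insertions take place among
    vertices satisfying [P], so that a contraction inside a ball can be carried over by a map
    controlled on that ball only. *)
Inductive walk_homo P x : seq X -> seq X -> Prop :=
| walk_homo_refl w : walk_homo P x w w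
| walk_homo_ins w1 d w2 : elementary_loop (last x w1) d -> all P (w1 ++ d ++ w2) ->
    walk_homo P x (w1 ++ w2) (w1 ++ d ++ w2)
| walk_homo_sym w w' : walk_homo P x w w' -> walk_homo P x w' w
| walk_homo_trans w1 w2 w3 : walk_homo P x w1 w2 -> walk_homo P x w2 w3 -> walk_homo P x w1 w3.

Lemma walk_homo_last P x w w' : walk_homo P x w w' -> last x w = last x w'.
Proof.
elim=> // [w1 d w2 [_ ld _ _] _|w1 w2 w3 _ -> _ ->//].
by rewrite !last_cat ld.
Qed.

Lemma walk_homo_path P x w w' : walk_homo P x w w' ->
  path (@adj X) x w = path (@adj X) x w'.
Proof.
elim=> // [w1 d w2 [pd ld _ _] _|w1 w2 w3 _ -> _ ->//].
by rewrite !cat_path pd ld.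
Qed.

Lemma sub_homo P Q x w w' : {subset P <= Q} -> walk_homo P x w w' -> walk_homo Q x w w'.
Proof.
move=> PQ; elim=> {w w'} [w|w1 d w2 ed aP|w w' _ h|w1 w2 w3 _ h1 _ h2].
- exact: walk_homo_refl.
- by apply: walk_homo_ins => //; apply: sub_all aP.
- exact: walk_homo_sym.
- exact: walk_homo_trans h1 h2.
Qed.

Lemma walk_homo_catr x w w' v : walk_homo predT x w w' -> walk_homo predT x (w ++ v) (w' ++ v).
Proof.
elim=> {w w'} [w|w1 d w2 ed aP|w w' _ h|w1 w2 w3 _ h1 _ h2].
- exact: walk_homo_refl.
- by rewrite -!catA; apply: walk_homo_ins => //; apply/allP.
- exact: walk_homo_sym.
- exact: walk_homo_trans h1 h2.
Qed.

Lemma walk_homo_catl x u w w' : walk_homo predT (last x u) w w' ->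
  walk_homo predT x (u ++ w) (u ++ w').
Proof.
elim=> {w w'} [w|w1 d w2 ed aP|w w' _ h|w1 w2 w3 _ h1 _ h2].
- exact: walk_homo_refl.
- rewrite (catA u w1) (catA u w1); apply: walk_homo_ins; last exact/allP.
  by rewrite last_cat.
- exact: walk_homo_sym.
- exact: walk_homo_trans h1 h2.
Qed.

Lemma elementary_backtrack x y : adj x y -> elementary_loop x [:: y; x].
Proof.
move=> xy; split=> //=; first by rewrite xy adj_sym xy.
  by rewrite inE eq_sym adj_neq.
by rewrite leq_maxl.
Qed.

Lemma walk_homo_inv x w : path (@adj X) x w -> walk_homo predT x (w ++ inv_walk x w) [::].
Proof.
elim: w x => [|y w IH] x /=; first by move=> _; exact: walk_homo_refl.
move=> /andP[xy pw]; rewrite /inv_walk /= rev_cons -cats1.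
apply: (@walk_homo_trans _ _ _ [:: y; x]).
  rewrite catA; apply: (@walk_homo_catl x [:: y] _ [:: x]).
  exact: (@walk_homo_catr _ _ [::] [:: x] (IH _ pw)).
apply: walk_homo_sym; apply: (@walk_homo_ins _ x [::] [:: y; x] [::]); last exact/allP.
exact: elementary_backtrack.
Qed.

Lemma inv_walkK x w : inv_walk (last x w) (inv_walk x w) = w.
Proof.
case/lastP: w => // w a; rewrite last_rcons /inv_walk belast_rcons /=.
by rewrite rev_cons belast_rcons rev_cons revK.
Qed.

Lemma walk_homo_invl x w : path (@adj X) x w ->
  walk_homo predT (last x w) (inv_walk x w ++ w) [::].
Proof.
by move=> pw; have := walk_homo_inv (path_inv_walk pw); rewrite inv_walkK.
Qed.

Lemma walk_homo_cancel x p v : path (@adj X) x p ->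
  walk_homo predT x (p ++ v) p -> walk_homo predT (last x p) v [::].
Proof.
move=> pp h; have hi := walk_homo_invl pp.
have h1 : walk_homo predT (last x p) ((inv_walk x p ++ p) ++ v) v.
  exact: (walk_homo_catr (w' := [::]) _ hi).
have h2 : walk_homo predT (last x p) (inv_walk x p ++ p ++ v) (inv_walk x p ++ p).
  by apply: walk_homo_catl; rewrite last_inv_walk.
rewrite catA in h2.
exact: walk_homo_trans (walk_homo_sym h1) (walk_homo_trans h2 hi).
Qed.

(** A homotopy consists of finitely many insertions, so it visits a bounded region. With finitely
    many short closed walks up to automorphism, this yields the uniform radius. *)
Lemma walk_homo_bound P x w w' : walk_homo P x w w' ->
  exists N, walk_homo (fun y => dist x y <= N) x w w'.
Proof.
have mono N M v v' : N <= M -> walk_homo (fun y => dist x y <= N) x v v' ->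
    walk_homo (fun y => dist x y <= M) x v v'.
  by move=> NM; apply: sub_homo => y yN; apply: leq_trans NM.
elim=> {w w'} [w|w1 d w2 ed aP|w w' _ [N h]|w1 w2 w3 _ [N1 h1] _ [N2 h2]].
- by exists 0; exact: walk_homo_refl.
- exists (\max_(y <- w1 ++ d ++ w2) dist x y); apply: walk_homo_ins => //.
  by apply/allP => y yw /=; exact: leq_bigmax_seq.
- by exists N; exact: walk_homo_sym.
- exists (maxn N1 N2); apply: (@walk_homo_trans _ _ _ w2).
    by apply: mono h1; rewrite leq_maxl.
  by apply: mono h2; rewrite leq_maxr.
Qed.

End Homotopy.

(** Injectivity on [P] keeps the inserted loops simple. The map [g] will be an isomorphism between
    balls, or a covering already shown to be injective. *)
Lemma walk_homo_map k (X Y : graph) (P : pred X) (g : X -> Y) x w w' :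
  P x -> {in P &, injective g} ->
  {in P &, forall a b, adj a b -> adj (g a) (g b)} ->
  walk_homo k P x w w' -> walk_homo k predT (g x) (map g w) (map g w').
Proof.
move=> Px gI gA; elim=> {w w'} [w|w1 d w2|w w' _ h|w1 w2 w3 _ h1 _ h2].
- exact: walk_homo_refl.
- move=> [pd ld ud sd]; rewrite !all_cat => /and3P[P1 Pd P2].
  rewrite !map_cat; apply: walk_homo_ins; last exact/allP.
  have Pl : P (last x w1).
    by case/lastP: w1 P1 {pd ld} => // v a; rewrite all_rcons last_rcons => /andP[].
  have mp a v : P a -> all P v -> path (@adj X) a v -> path (@adj Y) (g a) (map g v).
    elim: v a => //= b v IH a Pa /andP[Pb Pv] /andP[ab pv].
    by rewrite gA // IH.
  rewrite last_map; split; last by rewrite size_map.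
  + exact: mp.
  + by rewrite last_map ld.
  + by rewrite map_inj_in_uniq // => a b /(allP Pd) Pa /(allP Pd) Pb; exact: gI.
- exact: walk_homo_sym.
- exact: walk_homo_trans h1 h2.
Qed.

(** * Universal cover *)

Definition locally_bijective (Z Y : graph) (f : Z -> Y) : Prop :=
  forall z, set_bij (neighbors z) (neighbors (f z)) f.

(** * Lifting walks and homotopies along a covering *)

Section Lifts.
Variables (Z Y : graph) (f : Z -> Y).
Hypothesis fP : locally_bijective f.

Lemma lb_adj z z' : adj z z' -> adj (f z) (f z').
Proof. by have [h _ _] := fP z; exact: h. Qed.

Lemma lb_inj z z1 z2 : adj z z1 -> adj z z2 -> f z1 = f z2 -> z1 = z2.
Proof. move=> h1 h2 e; have [_ h _] := fP z; apply: h => //; exact/mem_set. Qed.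

Definition nb z y : Z := xget z [set z' | adj z z' /\ f z' = y]%classic.

Lemma nbP z y : adj (f z) y -> adj z (nb z y) /\ f (nb z y) = y.
Proof.
move=> zy; have [_ _ /(_ y zy)[z' zz' <-]] := fP z.
by apply: (xgetPex z (P := [set z1 | adj z z1 /\ f z1 = f z']%classic)); exists z'.
Qed.

Lemma nbK z z' : adj z z' -> nb z (f z') = z'.
Proof. by move=> zz'; have [h1 h2] := nbP (lb_adj zz'); exact: (lb_inj h1 zz' h2). Qed.

Fixpoint lift z (w : seq Y) : seq Z :=
  if w is y :: w' then nb z y :: lift (nb z y) w' else [::].

Lemma lift_path z w : path (@adj Y) (f z) w ->
  path (@adj Z) z (lift z w) /\ map f (lift z w) = w.
Proof.
elim: w z => //= y w IH z /andP[/nbP[zn fn] pw].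
by have [] := IH (nb z y); rewrite ?fn // zn => -> ->.
Qed.

Lemma lift_map z v : path (@adj Z) z v -> lift z (map f v) = v.
Proof. by elim: v z => //= a v IH z /andP[/nbK -> /IH ->]. Qed.

Lemma lift_cat z w1 w2 :
  lift z (w1 ++ w2) = lift z w1 ++ lift (last z (lift z w1)) w2.
Proof. by elim: w1 z => //= y w1 IH z; rewrite IH. Qed.

Lemma size_lift z w : size (lift z w) = size w.
Proof. by elim: w z => //= y w IH z; rewrite IH. Qed.

Lemma path_map_lb z v : path (@adj Z) z v -> path (@adj Y) (f z) (map f v).
Proof. by elim: v z => //= a v IH z /andP[/lb_adj -> /IH ->]. Qed.

Lemma f_last_lift z w : path (@adj Y) (f z) w ->
  f (last z (lift z w)) = last (f z) w.
Proof. by move=> /lift_path[_ fw]; rewrite -{2}fw last_map. Qed.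

Variable k : nat.

Definition lifts_loops : Prop :=
  forall z d, elementary_loop k (f z) d -> last z (lift z d) = z.

Hypothesis fK : lifts_loops.

Lemma lift_elementary z d : elementary_loop k (f z) d ->
  elementary_loop k z (lift z d).
Proof.
move=> ed; have [pd ld ud sd] := ed; have [pl fl] := lift_path pd.
split=> //; [exact: fK|by rewrite -fl in ud; exact: map_uniq ud|].
by rewrite size_lift.
Qed.

Lemma lift_homo z w w' : walk_homo k predT (f z) w w' -> path (@adj Y) (f z) w ->
  walk_homo k predT z (lift z w) (lift z w').
Proof.
elim=> {w w'} [w|w1 d w2 ed aP|w w' hw h|w1 w2 w3 hw1 h1 hw2 h2] pw.
- exact: walk_homo_refl.
- move: pw; rewrite cat_path => /andP[p1 p2].
  have e1 : elementary_loop k (f (last z (lift z w1))) d by rewrite f_last_lift.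
  rewrite !lift_cat (fK e1); apply: walk_homo_ins; last exact/allP.
  exact: lift_elementary.
- by apply: walk_homo_sym; apply: h; rewrite (walk_homo_path hw).
- by apply: walk_homo_trans (h1 pw) (h2 _); rewrite -(walk_homo_path hw1).
Qed.

Lemma lift_null z w : walk_homo k predT (f z) w [::] -> path (@adj Y) (f z) w ->
  last z (lift z w) = z.
Proof. by move=> hw pw; rewrite (walk_homo_last (lift_homo hw pw)). Qed.

End Lifts.

Definition simply_loop_connected k (Z : graph) : Prop :=
  forall (z : Z) w, path (@adj Z) z w -> last z w = z -> walk_homo k predT z w [::].

(** * The cover by classes of walks *)

Section UniversalCover.
Variables (k : nat) (Y : graph) (y0 : Y).

Let cls w : set (seq Y) :=
  [set w' | path (@adj Y) y0 w' /\ walk_homo k predT y0 w w']%classic.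

(** [xget] depends only on the set [cls w], so homotopic walks get the same representative. The
    fixed points of [rep] then model the quotient by homotopy as a subtype of walks. *)
Definition rep w : seq Y := xget [::] (cls w).

Lemma repP w : path (@adj Y) y0 w ->
  path (@adj Y) y0 (rep w) /\ walk_homo k predT y0 w (rep w).
Proof.
by move=> pw; apply: (xgetPex _ (P := cls w)); exists w; split=> //; exact: walk_homo_refl.
Qed.

Lemma rep_eq w w' : walk_homo k predT y0 w w' -> rep w = rep w'.
Proof.
move=> h; rewrite /rep; congr (xget _ _); apply/seteqP; split=> v /= [pv hv].
  by split=> //; apply: walk_homo_trans hv; exact: walk_homo_sym.
by split=> //; apply: walk_homo_trans hv.
Qed.

Definition ucover_vertex := {w : seq Y | path (@adj Y) y0 w && (rep w == w)}.

HB.instance Definition _ := Choice.on ucover_vertex.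

Implicit Types u : ucover_vertex.

Definition uproj u : Y := last y0 (val u).

Lemma upath u : path (@adj Y) y0 (val u).
Proof. by case/andP: (valP u). Qed.

Lemma urep u : rep (val u) = val u.
Proof. by case/andP: (valP u) => _ /eqP. Qed.

Lemma rep_in w : path (@adj Y) y0 w ->
  path (@adj Y) y0 (rep w) && (rep (rep w) == rep w).
Proof. by move=> /repP[-> /rep_eq <-] /=. Qed.

Definition ubase : ucover_vertex :=
  exist _ (rep [::]) (rep_in (w := [::]) isT).

Definition uclass w : ucover_vertex := insubd ubase (rep w).

Lemma val_uclass w : path (@adj Y) y0 w -> val (uclass w) = rep w.
Proof. by move=> pw; rewrite val_insubd rep_in. Qed.

Lemma uclass_val u : uclass (val u) = u.
Proof. by apply: val_inj; rewrite val_uclass ?urep // upath. Qed.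

Lemma uclass_eq w w' : walk_homo k predT y0 w w' -> uclass w = uclass w'.
Proof. by move=> h; rewrite /uclass (rep_eq h). Qed.

Lemma uclass_homo w w' : path (@adj Y) y0 w -> path (@adj Y) y0 w' ->
  uclass w = uclass w' -> walk_homo k predT y0 w w'.
Proof.
move=> pw pw' /(congr1 val); rewrite !val_uclass // => e.
have [_ h] := repP pw; have [_ h'] := repP pw'.
by apply: walk_homo_trans h _; rewrite e; exact: walk_homo_sym.
Qed.

Lemma uproj_uclass w : path (@adj Y) y0 w -> uproj (uclass w) = last y0 w.
Proof.
by move=> pw; rewrite /uproj val_uclass //; have [_ /walk_homo_last ->] := repP pw.
Qed.

Lemma path_rcons_uproj u y : adj (uproj u) y -> path (@adj Y) y0 (rcons (val u) y).
Proof. by rewrite rcons_path upath. Qed.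

Definition uadj u u' : bool :=
  `[< exists2 y, adj (uproj u) y & uclass (rcons (val u) y) = u' >].

Lemma uadj_uclass w y : path (@adj Y) y0 w -> adj (last y0 w) y ->
  uadj (uclass w) (uclass (rcons w y)).
Proof.
move=> pw wy; apply/asboolP; exists y; first by rewrite uproj_uclass.
apply: uclass_eq; rewrite -!cats1 val_uclass //; apply: walk_homo_catr.
by apply: walk_homo_sym; have [] := repP pw.
Qed.

(** Appending [y] and then the previous end is inserting a back-and-forth, which does not change the
    class. *)
Lemma uadj_sym : symmetric uadj.
Proof.
suff h u u' : uadj u u' -> uadj u' u by move=> u u'; apply/idP/idP; exact: h.
move=> /asboolP[y uy <-]; set w := rcons _ y.
have pw : path (@adj Y) y0 w by exact: path_rcons_uproj.
have lw : last y0 w = y by rewrite last_rcons.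
have := @uadj_uclass w (uproj u) pw; rewrite lw adj_sym => /(_ uy).
suff -> : uclass (rcons w (uproj u)) = u by [].
rewrite -[RHS]uclass_val; apply: uclass_eq; apply: walk_homo_sym.
have -> : rcons w (uproj u) = val u ++ [:: y; uproj u] ++ [::].
  by rewrite cats0 /w -!cats1 -catA.
rewrite -[X in walk_homo _ _ _ X]cats0.
by apply: walk_homo_ins; [exact: elementary_backtrack|exact/allP].
Qed.

Lemma uproj_adj u u' : uadj u u' -> adj (uproj u) (uproj u').
Proof.
by move=> /asboolP[y uy <-]; rewrite uproj_uclass ?path_rcons_uproj // last_rcons.
Qed.

Lemma uadj_irr : irreflexive uadj.
Proof. by move=> u; apply/negP => /uproj_adj; rewrite adj_irr. Qed.

Lemma uwalk u v : path (@adj Y) (uproj u) v ->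
  exists2 p, path uadj u p & last u p = uclass (val u ++ v).
Proof.
move=> pv; have : path (@adj Y) y0 (val u ++ v) by rewrite cat_path upath.
elim/last_ind: v {pv} => [_|v y IH]; first by exists [::]; rewrite // cats0 uclass_val.
rewrite -rcons_cat rcons_path => /andP[pv vy]; have [p pp lp] := IH pv.
exists (rcons p (uclass (rcons (val u ++ v) y))); last by rewrite last_rcons.
by rewrite rcons_path pp lp; apply: uadj_uclass.
Qed.

Lemma uconnected u u' : exists2 p, path uadj u p & last u p = u'.
Proof.
have pu := path_inv_walk (upath u).
have [|p pp lp] := @uwalk u (inv_walk y0 (val u) ++ val u').
  by rewrite cat_path pu last_inv_walk upath.
exists p => //; rewrite lp -[RHS]uclass_val; apply: uclass_eq; rewrite catA.
exact: (walk_homo_catr (w' := [::]) _ (walk_homo_inv _ (upath u))).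
Qed.

Lemma ulocally_finite u : finite_set [set u' | uadj u u']%classic.
Proof.
apply: (@sub_finite_set _ _
  ((fun y => uclass (rcons (val u) y)) @` [set y | adj (uproj u) y])%classic).
  by move=> u' /asboolP[y uy <-]; exists y.
by apply: finite_image; exact: adj_locally_finite.
Qed.

Definition ucover : graph :=
  Graph uadj_sym uadj_irr (inhabits ubase) uconnected ulocally_finite.

Lemma uproj_lb : @locally_bijective ucover Y uproj.
Proof.
move=> u; split.
- by move=> u' /uproj_adj.
- move=> u1 u2; rewrite !inE => /asboolP[y1 a1 <-] /asboolP[y2 a2 <-].
  by rewrite !uproj_uclass ?path_rcons_uproj // !last_rcons => ->.
- move=> y uy; exists (uclass (rcons (val u) y)).
    by apply/asboolP; exists y.
  by rewrite uproj_uclass ?path_rcons_uproj // last_rcons.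
Qed.

Lemma last_lift_uproj (u : ucover) v : path (@adj Y) (uproj u) v ->
  last u (lift (uproj : ucover -> Y) u v) = uclass (val u ++ v).
Proof.
elim/last_ind: v => [_|v y IH] /=; first by rewrite cats0 uclass_val.
rewrite rcons_path => /andP[pv vy]; rewrite -cats1 lift_cat last_cat IH //=.
rewrite catA cats1; have puv : path (@adj Y) y0 (val u ++ v) by rewrite cat_path upath.
rewrite -(@nbK _ _ _ uproj_lb (uclass (val u ++ v)) (uclass (rcons (val u ++ v) y))).
  by rewrite uproj_uclass ?last_rcons // rcons_path puv last_cat.
by apply: uadj_uclass; rewrite // last_cat.
Qed.

(** The lift of [v] from the class of [w] ends at the class of [w ++ v], and appending an elementary
    loop to [w] does not change its class. *)
Lemma uproj_lifts_loops : lifts_loops (uproj : ucover -> Y) k.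
Proof.
move=> u d ed; have [pd ld _ _] := ed; rewrite last_lift_uproj //.
rewrite -[RHS]uclass_val; apply: uclass_eq; apply: walk_homo_sym.
rewrite -{1}[val u]cats0 -[X in walk_homo _ _ _ _ (_ ++ X)]cats0.
by apply: walk_homo_ins => //; exact/allP.
Qed.

Lemma uproj_surj y : exists u, uproj u = y.
Proof.
have [w pw <-] := adj_connected y0 y; exists (uclass w).
by rewrite uproj_uclass.
Qed.

(** If [v] is closed at [u], then [val u] followed by the projection of [v] is homotopic to [val u].
    Lifting this homotopy from the base point gives [p ++ v] homotopic to [p], where [p] leads to
    [u], and [p] cancels. *)
Lemma ucover_simply_loop_connected : simply_loop_connected k ucover.
Proof.
move=> u v pv lv; have pfv := path_map_lb uproj_lb pv.
have base0 : uproj ubase = y0.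
  by rewrite /uproj /=; have [_ /walk_homo_last <-] := @repP [::] isT.
have pu : path (@adj Y) (uproj ubase) (val u) by rewrite base0 upath.
have bE w : path (@adj Y) y0 w ->
    last ubase (lift (uproj : ucover -> Y) ubase w) = uclass w.
  move=> pw; rewrite last_lift_uproj ?base0 //; apply: uclass_eq.
  by apply: (walk_homo_catr (w' := [::])); apply: walk_homo_sym; have [] := @repP [::] isT.
have hY : walk_homo k predT y0 (val u ++ map uproj v) (val u).
  apply: uclass_homo; rewrite ?upath //; first by rewrite cat_path upath.
  by rewrite uclass_val -last_lift_uproj // (lift_map uproj_lb pv) lv.
have := @lift_homo ucover Y _ uproj_lb _ uproj_lifts_loops ubase (val u ++ map uproj v)
  (val u).
rewrite base0 lift_cat bE ?upath // uclass_val (lift_map uproj_lb pv).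
rewrite cat_path upath => /(_ hY pfv) hU.
set p := lift (uproj : ucover -> Y) ubase (val u) in hU.
have pp : path (@adj ucover) ubase p by have [] := lift_path uproj_lb pu.
have lp : last ubase p = u by rewrite /p bE ?upath // uclass_val.
by have := walk_homo_cancel pp hU; rewrite lp.
Qed.

End UniversalCover.

Import numFieldNormedType.Exports.
Local Open Scope classical_set_scope.
Local Open Scope ring_scope.

(** * Continuity into realizations *)

Lemma cvg_in_within (T U : Type) (F : set_system T) (G : set_system U)
    (f : T -> U) (D : set U) : Filter F ->
  (forall t, D (f t)) -> f @ F --> G -> f @ F --> within D G.
Proof.
move=> FF fD cf V WV; apply: (@filterS _ F _ _ _ _ (cf _ WV)) => t /= h.
exact: h (fD t).
Qed.

Section Clamp.
Variable R : realType.

(** The retraction of the line onto [[0, 1]]. Absolute values make its continuity immediate, and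
    composing with it extends maps from the interval or the square to maps continuous everywhere. *)
Definition clamp (t : R) : R := (`|t| - `|t - 1| + 1) / 2.

Lemma clamp_continuous : continuous clamp.
Proof.
move=> t; rewrite /clamp; apply: cvgM; last exact: cvg_cst.
apply: cvgD; last exact: cvg_cst.
apply: cvgB; first exact: norm_continuous.
apply: (@cvg_comp _ _ _ (fun x : R => x - 1) Num.norm _ (nbhs (t - 1))).
  by apply: cvgB; [exact: cvg_id|exact: cvg_cst].
exact: norm_continuous.
Qed.

Lemma clamp_le0 t : t <= 0 -> clamp t = 0.
Proof. by move=> t0; rewrite /clamp !ler0_norm; lra. Qed.

Lemma clamp_ge1 t : 1 <= t -> clamp t = 1.
Proof. by move=> t0; rewrite /clamp !ger0_norm; lra. Qed.

Lemma clamp_id t : 0 <= t <= 1 -> clamp t = t.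
Proof.
by move=> /andP[t0 t1]; rewrite /clamp ger0_norm // ler0_norm; lra.
Qed.

Lemma clamp0 : clamp 0 = 0. Proof. exact: clamp_le0. Qed.

Lemma clamp1 : clamp 1 = 1. Proof. exact: clamp_ge1. Qed.

Lemma clamp_itv t : 0 <= clamp t <= 1.
Proof.
have [t0|t0] := leP t 0; first by rewrite clamp_le0 // lexx ler01.
have [t1|t1] := leP t 1; first by rewrite clamp_id (ltW t0) t1.
by rewrite clamp_ge1 ?lexx ?ler01 // ltW.
Qed.

Lemma within_clamp (T : topologicalType) (f : R -> T) :
  {within `[0, 1], continuous f} -> continuous (f \o clamp).
Proof.
move=> /subspace_continuousP cf t.
apply: (@cvg_comp _ _ _ clamp f _ (within `[0, 1] (nbhs (clamp t)))).
  apply: cvg_in_within; last exact: clamp_continuous.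
  by move=> s; rewrite /= in_itv /= clamp_itv.
by apply: cf; rewrite /= in_itv /= clamp_itv.
Qed.

Lemma within_clamp2 (T : topologicalType) (f : R * R -> T) :
  {within `[0, 1] `*` `[0, 1], continuous f} ->
  continuous (fun z : R * R => f (clamp z.1, clamp z.2)).
Proof.
move=> /subspace_continuousP cf z.
apply: (@cvg_comp _ _ _ (fun z : R * R => (clamp z.1, clamp z.2)) f _
  (within (`[0, 1] `*` `[0, 1]) (nbhs (clamp z.1, clamp z.2)))).
  apply: cvg_in_within.
    by move=> s; split; rewrite /= in_itv /= clamp_itv.
  have h1 : clamp s.1 @[s --> nbhs z] --> nbhs (clamp z.1).
    by apply: (@cvg_comp _ _ _ fst clamp _ (nbhs z.1));
      [exact: cvg_fst|exact: clamp_continuous].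
  have h2 : clamp s.2 @[s --> nbhs z] --> nbhs (clamp z.2).
    by apply: (@cvg_comp _ _ _ snd clamp _ (nbhs z.2));
      [exact: cvg_snd|exact: clamp_continuous].
  exact: (cvg_pair h1 h2).
by apply: cf; split; rewrite /= in_itv /= clamp_itv.
Qed.

End Clamp.

Lemma near_all_seq (T : Type) (F : set_system T) (A : eqType) (l : seq A)
    (P : A -> T -> Prop) : Filter F ->
  (forall a, a \in l -> \forall t \near F, P a t) ->
  \forall t \near F, forall a, a \in l -> P a t.
Proof.
move=> FF; elim: l => [|a l IH] h; first exact: nearW.
have ha := h a (mem_head _ _).
have {IH}hl := IH (fun b bl => h b (mem_behead (s := a :: l) bl)).
by apply: filterS2 ha hl => t ta tl b; rewrite inE => /predU1P[->//|]; exact: tl.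
Qed.

Section Realization.
Variables (R : realType) (W : choiceType) (K : set (seq W)).
Implicit Types (p q : W -> R) (s : seq W).

Hypothesis K_uniq : forall s, K s -> uniq s.
Hypothesis K_locally_finite : forall w, finite_set [set s | K s /\ w \in s].

Lemma in_simplex_ex s p : in_simplex s p -> exists2 w, w \in s & 0 < p w.
Proof.
move=> [p0 _ p1]; apply: contrapT => h; suff : \sum_(w <- s) p w = 0.
  by rewrite p1 => /eqP; rewrite oner_eq0.
rewrite big_seq big1 // => w ws; apply/eqP/negPn/negP => pw.
by apply: h; exists w; rewrite // lt_neqAle eq_sym pw p0.
Qed.

Lemma in_simplex_supp s p w : in_simplex s p -> 0 < p w -> w \in s.
Proof. by move=> [_ h _]; apply: contraTT => /h ->; rewrite ltxx. Qed.

Lemma in_simplexW s s' p : K s -> K s' -> in_simplex s p ->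
  (forall w, w \notin s' -> p w = 0) -> in_simplex s' p.
Proof.
move=> /K_uniq us /K_uniq us' [p0 hs p1] hs'; split=> //; rewrite -p1.
have E t : \sum_(w <- t) p w = \sum_(w <- [seq w <- t | p w != 0]) p w.
  by rewrite big_filter; apply/esym/big_rmcond => w /negPn/eqP.
rewrite E [RHS]E; apply: perm_big; apply: uniq_perm; rewrite ?filter_uniq // => w.
rewrite !mem_filter; case: eqP => //= pw.
have -> : w \in s' by apply/negPn/negP => /hs'.
by apply/esym/negPn/negP => /hs.
Qed.

Lemma in_simplex_convex s p q (t : R) : 0 <= t <= 1 ->
  in_simplex s p -> in_simplex s q ->
  in_simplex s (fun w => (1 - t) * p w + t * q w).
Proof.
move=> /andP[t0 t1] [p0 ps p1] [q0 qs q1]; split=> [w|w ws|].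
- by rewrite addr_ge0 // mulr_ge0 // subr_ge0.
- by rewrite ps // qs // !mulr0 addr0.
- by rewrite big_split -!mulr_sumr p1 q1 /= !mulr1 subrK.
Qed.

Definition delta (v : W) : W -> R := fun w => (w == v)%:R.

Lemma in_simplex_delta s v : uniq s -> v \in s -> in_simplex s (delta v).
Proof.
move=> us vs; split=> [w|w ws|]; first exact: ler0n.
  by rewrite /delta; case: eqP ws => // ->; rewrite vs.
rewrite (bigD1_seq v) //= /delta eqxx big1 ?addr0 // => w /negbTE -> //.
Qed.

Lemma bary_continuous w : continuous (fun p : realization R K => p w).
Proof.
move=> p A /nbhs_ballP[e /= e0 eA].
pose U := [set q : realization R K | `|p w - q w| < e].
suff oU : open U.
  apply: (@filterS _ (nbhs p) _ U) => [q Uq|]; first by apply: eA.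
  by apply: open_nbhs_nbhs; split=> //; rewrite /U /= subrr normr0.
move=> s q Ks sq Uq; have [ws|ws] := boolP (w \in s).
  exists (e - `|p w - q w|); first by rewrite subr_gt0.
  move=> q' sq' /(_ w ws) h; rewrite /U /= (_ : p w - q' w = (p w - q w) + (q w - q' w)).
    by rewrite (le_lt_trans (ler_normD _ _)) // -ltrBrDl.
  by rewrite addrA subrK.
exists 1 => // q' [_ sq' _] _; case: sq => _ sq _.
by move: Uq; rewrite /U /= sq // sq'.
Qed.

(** Only the finitely many simplices through a vertex [w0] of the support of [h t0] matter, since
    the coordinate at [w0] stays positive nearby; on each of them weak openness is Euclidean
    openness. *)
Lemma realization_continuous_at (T : topologicalType) (h : T -> realization R K) t0 :
  (forall w, {for t0, continuous (fun t => h t w)}) -> {for t0, continuous h}.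
Proof.
move=> ch U; rewrite nbhsE => -[V [oV Vt0] VU].
apply: (@filterS _ (nbhs (t0 : T)) _ (fun t => V (h t))) => [t /VU //|].
have [s0 Ks0 sh0] := baryP (h t0); have [w0 w0s w0p] := in_simplex_ex sh0.
have [l lE] := (finite_seqP _).1 (K_locally_finite w0).
have pos w : 0 < h t0 w -> \forall t \near t0, 0 < h t w.
  move=> hw; have := @cvgr_gt R T (nbhs t0) _ (fun t => h t w) _ (ch w) 0 hw.
  by apply.
have cl w e : 0 < e -> \forall t \near t0, `|h t0 w - h t w| < e.
  by move=> e0; have /cvgrPdist_lt/(_ e e0) := ch w.
have hl : \forall t \near t0, forall s, s \in l -> in_simplex s (h t) -> V (h t).
  apply: near_all_seq => s sl; have [Ks w0s'] : K s /\ w0 \in s.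
    by move: (congr1 (@^~ s) lE) => /= ->.
  (* A simplex that misses a vertex of the support of [h t0] contains no nearby value; any other one
     contains [h t0] itself. *)
  have [[w [ws wp]]|nw] := pselect (exists w, w \notin s /\ 0 < h t0 w).
    apply: filterS (pos w wp) => t tw st.
    by have := in_simplex_supp st tw; rewrite (negbTE ws).
  have sh : in_simplex s (h t0).
    apply: (in_simplexW Ks0) => // w ws; apply/eqP/negPn/negP => hw.
    apply: nw; exists w; split=> //; rewrite lt_neqAle eq_sym hw.
    by case: sh0 => ->.
  have [e e0 He] := oV s (h t0) Ks sh Vt0.
  have hn : \forall t \near t0, forall w, w \in s -> `|h t0 w - h t w| < e.
    by apply: near_all_seq => w _; exact: cl.
  by apply: filterS hn => t ht st; apply: He.
apply: filterS2 hl (pos w0 w0p) => t tl tw.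
have [s Ks st] := baryP (h t); apply: (tl s) => //.
have : [set s | K s /\ w0 \in s] s by split=> //; exact: in_simplex_supp tw.
by rewrite lE.
Qed.

Lemma realization_continuous (T : topologicalType) (h : T -> realization R K) :
  (forall w, continuous (fun t => h t w)) -> continuous h.
Proof. by move=> ch t0; apply: realization_continuous_at => w; exact: ch. Qed.

Lemma realization_ext (p q : realization R K) : (forall w, p w = q w) -> p = q.
Proof.
case: p q => [p Hp] [q Hq] /= /funext pq; subst q.
by rewrite (Prop_irrelevance Hp Hq).
Qed.

End Realization.

Opaque clamp.

Section RealContinuity.
Variables (R : realType) (T : topologicalType).
Implicit Types f g : T -> R.

Lemma contD f g : continuous f -> continuous g -> continuous (fun t => f t + g t).
Proof. by move=> cf cg t; apply: cvgD; [exact: cf|exact: cg]. Qed.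

Lemma contB f g : continuous f -> continuous g -> continuous (fun t => f t - g t).
Proof. by move=> cf cg t; apply: cvgB; [exact: cf|exact: cg]. Qed.

Lemma contM f g : continuous f -> continuous g -> continuous (fun t => f t * g t).
Proof. by move=> cf cg t; apply: cvgM; [exact: cf|exact: cg]. Qed.

Lemma cont_cst (c : R) : continuous (fun _ : T => c).
Proof. by move=> t; exact: cvg_cst. Qed.

Lemma cont_comp (U V : topologicalType) (g : U -> V) (f : T -> U) :
  continuous g -> continuous f -> continuous (fun t => g (f t)).
Proof. by move=> cg cf t; apply: (@continuous_comp _ _ _ f g); [exact: cf|exact: cg]. Qed.

Lemma cont_clamp f : continuous f -> continuous (fun t => clamp (f t)).
Proof. by move=> cf; apply: (cont_comp (@clamp_continuous R)). Qed.

End RealContinuity.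

Lemma cont_fst (T U : topologicalType) : continuous (fun z : T * U => z.1).
Proof. by move=> z; exact: cvg_fst. Qed.

Lemma cont_snd (T U : topologicalType) : continuous (fun z : T * U => z.2).
Proof. by move=> z; exact: cvg_snd. Qed.

Lemma cont_id (T : topologicalType) : continuous (fun t : T => t).
Proof. by move=> t; exact: cvg_id. Qed.

Lemma cont_pair (T U V : topologicalType) (f : T -> U) (g : T -> V) :
  continuous f -> continuous g -> continuous (fun t => (f t, g t)).
Proof. by move=> cf cg t; exact: (cvg_pair (cf t) (cg t)). Qed.

Ltac cont := lazymatch goal with
  | |- forall x, continuous_at x (fun t => clamp (@?f t)) => apply: cont_clamp; cont
  | |- forall x, continuous_at x (fun t => @?f t - @?g t) => apply: contB; cont
  | |- forall x, continuous_at x (fun t => @?f t + @?g t) => apply: contD; cont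
  | |- forall x, continuous_at x (fun t => @?f t * @?g t) => apply: contM; cont
  | |- forall x, continuous_at x (fun t => (@?f t, @?g t)) => apply: cont_pair; cont
  | |- _ => first [ assumption | exact: cont_cst | exact: cont_fst | exact: cont_snd
                  | exact: cont_id | exact: mulrl_continuous | idtac ]
  end.

(** * Polygonal paths and homotopies in barycentric coordinates *)

Section Raw.
Variables (R : realType) (W : choiceType) (K : set (seq W)).
Implicit Types (p q a b : W -> R) (l : seq (W -> R)) (h : R -> W -> R).

(* Points of the complex and maps into it are handled through their barycentric
   coordinates; [rhom] is homotopy relative to 0 and 1 of paths given this way. *)
Definition valid p := exists2 s, K s & in_simplex s p.

Definition rcont h := forall w, continuous (fun t => h t w).

Definition rhom h h' := exists H : R -> R -> W -> R,
  [/\ forall w, continuous (fun z : R * R => H z.1 z.2 w),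
      forall s t, valid (H s t),
      forall s, H s 0 = h s /\ H s 1 = h' s
    & forall t, H 0 t = h 0 /\ H 1 t = h 1].

Lemma rhom_cont h h' : rhom h h' -> rcont h'.
Proof.
move=> [H [cH _ H01 _]] w; rewrite (_ : (fun t => h' t w) = fun t => H t 1 w).
  apply: (@cont_comp _ _ _ (fun z : R * R => H z.1 z.2 w) (fun t : R => (t, 1 : R))).
    exact: cH.
  by cont.
by apply/funext => t; have [_ ->] := H01 t.
Qed.

Lemma rhom_ends h h' : rhom h h' -> h 0 = h' 0 /\ h 1 = h' 1.
Proof.
by move=> [H [_ _ H01 Hs]]; have [_ <-] := H01 0; have [_ <-] := H01 1;
  have [-> ->] := Hs 1.
Qed.

Lemma rhom_sym h h' : rhom h h' -> rhom h' h.
Proof.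
move=> rh; have [e0 e1] := rhom_ends rh; case: rh => [H [cH vH H01 Hs]].
exists (fun s t => H s (1 - t)); split=> //.
- move=> w; apply: (@cont_comp _ _ _ (fun z : R * R => H z.1 z.2 w)
    (fun z : R * R => (z.1, 1 - z.2))); first exact: cH.
  by cont.
- by move=> s; rewrite subr0 subrr; have [] := H01 s.
- by move=> t; rewrite -e0 -e1.
Qed.

Lemma rhom_trans h1 h2 h3 : rhom h1 h2 -> rhom h2 h3 -> rhom h1 h3.
Proof.
move=> r12 r23; have c2 := rhom_cont r12; have [e0 e1] := rhom_ends r12.
case: r12 => [H [cH vH H01 Hs]]; case: r23 => [G [cG vG G01 Gs]].
have sq (F : R -> R -> W -> R) (f : R * R -> R) w :
    (forall w, continuous (fun z : R * R => F z.1 z.2 w)) -> continuous f ->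
    continuous (fun z : R * R => F z.1 (f z) w).
  move=> cF cf; apply: (@cont_comp _ _ _ (fun z : R * R => F z.1 z.2 w)
    (fun z : R * R => (z.1, f z))); first exact: cF.
  by cont.
(* In the first half of the time the [G] term equals [h2 s], in the second half the [H] term does.
   The formula is thus the concatenation, with continuity visible without pasting. *)
exists (fun s t w => H s (clamp (2 * t)) w + G s (clamp (2 * t - 1)) w - h2 s w); split.
- move=> w; apply: contB; first apply: contD.
  + by apply: sq => //; cont.
  + by apply: sq => //; cont.
  + by apply: (@cont_comp _ _ _ (fun s => h2 s w) (fun z : R * R => z.1)); [exact: c2|cont].
- move=> s t; have [t2|t2] := leP t (1 / 2).
    rewrite (_ : (fun w => _) = H s (clamp (2 * t))) //; apply/funext => w.
    rewrite (@clamp_le0 _ (2 * t - 1)); last by lra.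
    by have [-> _] := G01 s; rewrite addrK.
  rewrite (_ : (fun w => _) = G s (clamp (2 * t - 1))) //; apply/funext => w.
  rewrite (@clamp_ge1 _ (2 * t)); last by lra.
  by have [_ ->] := H01 s; rewrite addrAC subrr add0r.
- move=> s; have [h0 h1'] := H01 s; have [g0 g1] := G01 s; split; apply/funext => w.
    rewrite mulr0 clamp0 (@clamp_le0 _ (0 - 1)); last by lra.
    by rewrite h0 g0 addrK.
  rewrite (@clamp_ge1 _ (2 * 1)); last by lra.
  rewrite (@clamp_ge1 _ (2 * 1 - 1)); last by lra.
  by rewrite h1' g1 addrAC subrr add0r.
- move=> t; split; apply/funext => w.
    by have [-> _] := Hs (clamp (2 * t)); have [-> _] := Gs (clamp (2 * t - 1));
      rewrite e0 addrK.
  by have [_ ->] := Hs (clamp (2 * t)); have [_ ->] := Gs (clamp (2 * t - 1));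
    rewrite e1 addrK.
Qed.

Lemma rhom_line h h' : rcont h -> rcont h' ->
  (forall s, exists2 c, K c & in_simplex c (h s) /\ in_simplex c (h' s)) ->
  h 0 = h' 0 -> h 1 = h' 1 -> rhom h h'.
Proof.
move=> ch ch' hh e0 e1.
have cc (f : R -> W -> R) w : rcont f -> continuous (fun z : R * R => f z.1 w).
  by move=> cf; apply: (@cont_comp _ _ _ (fun s => f s w) (fun z : R * R => z.1));
    [exact: cf|cont].
exists (fun s t w => (1 - clamp t) * h s w + clamp t * h' s w); split.
- by move=> w; cont; exact: cc.
- move=> s t; have [c Kc [hc hc']] := hh s; exists c => //.
  exact: in_simplex_convex (clamp_itv t) hc hc'.
- move=> s; split; apply/funext => w.
    by rewrite clamp0 subr0 mul1r mul0r addr0.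
  by rewrite clamp1 subrr mul1r mul0r add0r.
- by move=> t; rewrite -e0 -e1; split; apply/funext => w; rewrite -mulrDl subrK mul1r.
Qed.

Lemma rhom_reparam h (f : R -> R) : rcont h -> (forall s, valid (h s)) ->
  continuous f -> f 0 = 0 -> f 1 = 1 -> rhom h (h \o f).
Proof.
move=> ch vh cf f0 f1.
exists (fun s t => h ((1 - clamp t) * s + clamp t * f s)); split=> //.
- move=> w; apply: (@cont_comp _ _ _ (fun s => h s w)
    (fun z : R * R => (1 - clamp z.2) * z.1 + clamp z.2 * f z.1)); first exact: ch.
  by cont; apply: cont_comp => //; cont.
- move=> s; rewrite clamp0 clamp1 /=; split; congr (h _); ring.
- by move=> t; rewrite f0 f1; split; congr (h _); ring.
Qed.

(** The polygonal path through [a :: l] at one segment per unit of time, at rest before time 0 and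
    after [size l]. The correction term turns [b] into the segment from [a] to [b] and vanishes from
    time 1 on. *)
Fixpoint pl a l (u : R) : W -> R :=
  if l is b :: l' then fun w => pl b l' (u - 1) w + (1 - clamp u) * (a w - b w)
  else a.

Lemma pl_le0 a l u : u <= 0 -> pl a l u = a.
Proof.
elim: l a u => //= b l IH a u u0; rewrite IH; last by lra.
by apply/funext => w; rewrite clamp_le0 // subr0 mul1r addrC subrK.
Qed.

Lemma pl_cons_ge1 a b l u : 1 <= u -> pl a (b :: l) u = pl b l (u - 1).
Proof. by move=> u1; apply/funext => w /=; rewrite clamp_ge1 // subrr mul0r addr0. Qed.

Lemma pl_cons_le1 a b l u : u <= 1 ->
  pl a (b :: l) u = fun w => (1 - clamp u) * a w + clamp u * b w.
Proof.
move=> u1; apply/funext => w /=; rewrite pl_le0; last by lra.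
ring.
Qed.

Lemma pl_last a l u : (size l)%:R <= u -> pl a l u = last a l.
Proof.
elim: l a u => //= b l IH a u su.
have s0 : 0 <= (size l)%:R :> R by exact: ler0n.
have su' : (size l)%:R + 1 <= u by rewrite -natr1 in su.
have -> : (fun w => pl b l (u - 1) w + (1 - clamp u) * (a w - b w)) = pl a (b :: l) u by [].
by rewrite pl_cons_ge1 ?IH //; lra.
Qed.

Lemma pl_nth a l u j : (j < size l)%N -> j%:R <= u -> u <= j.+1%:R ->
  pl a l u = fun w => (1 - (u - j%:R)) * nth a (a :: l) j w + (u - j%:R) * nth a l j w.
Proof.
elim: l a u j => //= b l IH a u [|j] jl ju uj.
  have -> : (fun w => pl b l (u - 1) w + (1 - clamp u) * (a w - b w)) = pl a (b :: l) u by [].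
  by rewrite pl_cons_le1 // clamp_id ?subr0 ?ju.
rewrite -natr1 in ju; rewrite -!natr1 in uj.
have j0 : 0 <= j%:R :> R by exact: ler0n.
have -> : (fun w => pl b l (u - 1) w + (1 - clamp u) * (a w - b w)) = pl a (b :: l) u by [].
rewrite pl_cons_ge1; last by lra.
rewrite (IH _ _ j) //; last 2 first.
- by lra.
- by rewrite -natr1; lra.
rewrite -natr1 (_ : u - (j%:R + 1) = u - 1 - j%:R); last by ring.
rewrite (set_nth_default a) /=; last by rewrite /= ltnW.
by rewrite (set_nth_default a b jl).
Qed.

Lemma pl_cont (T : topologicalType) a l (f : T -> R) w :
  continuous f -> continuous (fun t => pl a l (f t) w).
Proof.
elim: l a f => /= [|b l IH] a f cf; first exact: cont_cst.
apply: contD; first by apply: (IH b (fun t => f t - 1)); cont.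
by cont.
Qed.

Definition com2 a b := exists2 c, K c & in_simplex c a /\ in_simplex c b.
Definition com4 a b a' b' := exists2 c, K c &
  [/\ in_simplex c a, in_simplex c b, in_simplex c a' & in_simplex c b'].

(** A ladder between two polygonal paths: each square of consecutive nodes lies in one simplex, so
    the straight-line homotopy stays in the complex. *)
Fixpoint link a a' (P : seq ((W -> R) * (W -> R))) : Prop :=
  if P is (b, b') :: P' then com4 a b a' b' /\ link b b' P' else com2 a a'.

Lemma link_pl a a' P u : link a a' P ->
  exists2 c, K c & in_simplex c (pl a (unzip1 P) u) /\ in_simplex c (pl a' (unzip2 P) u).
Proof.
elim: P a a' u => [|[b b'] P IH] a a' u; first by [].
move=> [[c Kc [ca cb ca' cb']] lP]; rewrite [unzip1 _]/= [unzip2 _]/=.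
have [u1|/ltW u1] := leP u 1; last by rewrite !pl_cons_ge1 //; exact: IH.
exists c => //; rewrite !pl_cons_le1 //.
by split; apply: in_simplex_convex => //; exact: clamp_itv.
Qed.

End Raw.

(** * Simple connectedness from loops *)

Section NodeHomotopy.
Variables (R : realType) (W : choiceType) (K : set (seq W)).
Implicit Types (a b : W -> R) (l u v : seq (W -> R)).
Local Notation node := (W -> R).

Fixpoint vl a l : Prop :=
  if l is b :: l' then com2 K a b /\ vl b l' else com2 K a a.

Lemma com2r a b : com2 K a b -> com2 K b b.
Proof. by move=> [c Kc [_ cb]]; exists c. Qed.

Lemma com4_diag a b : com2 K a b -> com4 K a b a b.
Proof. by move=> [c Kc [ca cb]]; exists c. Qed.

Lemma vl_cat a u v : vl a u -> vl (last a u) v -> vl a (u ++ v).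
Proof. by elim: u a => //= b u IH a [ab bu] uv; split=> //; exact: IH. Qed.

Definition diag l := [seq (b, b) | b <- l].

Lemma unzip1_diag l : unzip1 (diag l) = l.
Proof. by rewrite /unzip1 -map_comp map_id. Qed.

Lemma unzip2_diag l : unzip2 (diag l) = l.
Proof. by rewrite /unzip2 -map_comp map_id. Qed.

Lemma link_diag a l : vl a l -> link K a a (diag l).
Proof. by elim: l a => //= b l IH a [/com4_diag ab /IH]. Qed.

Lemma link_cat a a' (P Q : seq (node * node)) : link K a a' P ->
  link K (last a (unzip1 P)) (last a' (unzip2 P)) Q -> link K a a' (P ++ Q).
Proof.
by elim: P a a' => //= -[b b'] P IH a a' [ab bP] PQ; split=> //; exact: IH.
Qed.

(** Node lists of different lengths are compared at a common speed [N], large enough for both paths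
    to reach their end and rest there. Asking this for all large [N] makes the relation
    transitive. *)
Definition EQ a l l' : Prop := exists N0, forall N, (N0 <= N)%N ->
  rhom K (fun s => pl a l (N%:R * s)) (fun s => pl a l' (N%:R * s)).

Lemma EQ_sym a l l' : EQ a l l' -> EQ a l' l.
Proof. by move=> [N0 h]; exists N0 => N /h; exact: rhom_sym. Qed.

Lemma EQ_trans a l1 l2 l3 : EQ a l1 l2 -> EQ a l2 l3 -> EQ a l1 l3.
Proof.
move=> [N1 h1] [N2 h2]; exists (maxn N1 N2) => N; rewrite geq_max => /andP[n1 n2].
exact: rhom_trans (h1 _ n1) (h2 _ n2).
Qed.

Lemma EQ_link a (P : seq (node * node)) : link K a a P ->
  last a (unzip1 P) = last a (unzip2 P) -> EQ a (unzip1 P) (unzip2 P).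
Proof.
move=> lP lE; exists (size P) => N sN; apply: rhom_line.
- by move=> w; apply: (@pl_cont _ _ _ _ _ (fun s : R => N%:R * s)); cont.
- by move=> w; apply: (@pl_cont _ _ _ _ _ (fun s : R => N%:R * s)); cont.
- by move=> s; exact: link_pl.
- by rewrite mulr0 !pl_le0.
- by rewrite mulr1 !pl_last ?size_map ?ler_nat.
Qed.

Lemma EQ_refl a l : vl a l -> EQ a l l.
Proof.
by move=> /link_diag h; have := EQ_link h; rewrite unzip1_diag unzip2_diag; apply.
Qed.

Lemma pl_rcons_last a u (t : R) : pl a (rcons u (last a u)) t = pl a u t.
Proof.
elim: u a t => [|b u IH] a t; apply/funext => w /=; first by rewrite subrr mulr0 addr0.
by rewrite IH.
Qed.

(** A ladder replaces the repetition [b, b, c] by [b, c, c]. The repetition thus moves to the end of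
    the list, where it disappears because the path rests there anyway. *)
Lemma EQ_stutter a u v : vl a u -> vl (last a u) v ->
  EQ a (u ++ last a u :: v) (u ++ v).
Proof.
elim: v u => [|c v IH] u au uv.
  have [N0 h] := EQ_refl au; exists N0 => N /h; rewrite cats0 cats1.
  congr rhom; apply/funext => s; exact/esym/pl_rcons_last.
set b := last a u in uv *; have /= [bc cv] := uv; have [d Kd [db dc]] := bc.
have h1 : EQ a (u ++ b :: c :: v) (u ++ c :: c :: v).
  have := @EQ_link a (diag u ++ (b, c) :: (c, c) :: diag v).
  rewrite /unzip1 /unzip2 !map_cat /= -/(unzip1 _) -/(unzip2 _).
  rewrite -/(unzip1 (diag v)) -/(unzip2 (diag v)) !unzip1_diag !unzip2_diag.
  apply; last by rewrite !last_cat.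
  apply: link_cat; first exact: link_diag.
  rewrite unzip1_diag unzip2_diag -/b /=.
  by split; [exists d|split; [exists d|exact: link_diag]].
apply: EQ_trans h1 _; have := IH (rcons u c).
rewrite last_rcons -!cats1 -!catA /=; apply => //.
by apply: vl_cat => //=; split=> //; exact: com2r bc.
Qed.

Definition wcom x y := exists2 c, K c & x \in c /\ y \in c.
Definition wcom4 x y x' y' :=
  exists2 c, K c & [/\ x \in c, y \in c, x' \in c & y' \in c].

Fixpoint wl x (m : seq W) : Prop :=
  if m is y :: m' then wcom x y /\ wl y m' else wcom x x.

Fixpoint wlink x x' (P : seq (W * W)) : Prop :=
  if P is (y, y') :: P' then wcom4 x y x' y' /\ wlink y y' P' else wcom x x'.

Hypothesis K_uniq : forall s, K s -> uniq s.
Local Notation dl := (@delta R W).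

Lemma wcom_com2 x y : wcom x y -> com2 K (dl x) (dl y).
Proof.
by move=> [c Kc [cx cy]]; exists c => //; split; apply: in_simplex_delta => //; exact: K_uniq.
Qed.

Lemma wcom4_com4 x y x' y' : wcom4 x y x' y' -> com4 K (dl x) (dl y) (dl x') (dl y').
Proof.
by move=> [c Kc [? ? ? ?]]; exists c => //; split; apply: in_simplex_delta => //;
  exact: K_uniq.
Qed.

Lemma wcoml x y : wcom x y -> wcom x x.
Proof. by move=> [c Kc [h _]]; exists c. Qed.

Lemma wcomr x y : wcom x y -> wcom y y.
Proof. by move=> [c Kc [_ h]]; exists c. Qed.

Lemma wcomC x y : wcom x y -> wcom y x.
Proof. by move=> [c Kc [h h']]; exists c. Qed.

Lemma wl_vl x m : wl x m -> vl (dl x) (map dl m).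
Proof. by elim: m x => [|y m IH] x /=; [exact: wcom_com2|move=> [/wcom_com2 ? /IH]]. Qed.

Lemma wl_cat x m1 m2 : wl x m1 -> wl (last x m1) m2 -> wl x (m1 ++ m2).
Proof. by elim: m1 x => //= b u IH a [ab bu] uv; split=> //; exact: IH. Qed.

Lemma wlink_wl x x' P : wlink x x' P -> wl x (unzip1 P) /\ wl x' (unzip2 P).
Proof.
elim: P x x' => /= [|[y y'] P IH] x x'; first by move=> h; split;
  [exact: wcoml h|exact: wcomr h].
by move=> [[c Kc [cx cy cx' cy']] /IH[h1 h2]]; split; split=> //; exists c.
Qed.

Definition dl2 (z : W * W) : node * node := (dl z.1, dl z.2).

Lemma wlink_link x x' P : wlink x x' P -> link K (dl x) (dl x') (map dl2 P).
Proof.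
by elim: P x x' => [|[y y'] P IH] x x' /=; [exact: wcom_com2|move=> [/wcom4_com4 ? /IH]].
Qed.

(* Homotopy of label words in every context: the prefix may start at a point
   [a] which is not a vertex. *)
Definition Eq x m m' : Prop := [/\ wl x m, wl x m', last x m = last x m' &
  forall a u v, vl a u -> last a u = dl x -> vl (dl (last x m)) v ->
    EQ a (u ++ map dl m ++ v) (u ++ map dl m' ++ v)].

Lemma Eq_refl x m : wl x m -> Eq x m m.
Proof.
move=> xm; split=> // a u v au ux mv; apply: EQ_refl; apply: vl_cat => //.
by rewrite ux; apply: vl_cat; [exact: wl_vl|rewrite last_map].
Qed.

Lemma Eq_sym x m m' : Eq x m m' -> Eq x m' m.
Proof.
by move=> [xm xm' ml h]; split=> // a u v au ux mv; apply: EQ_sym; apply: h; rewrite // ml.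
Qed.

Lemma Eq_trans x m1 m2 m3 : Eq x m1 m2 -> Eq x m2 m3 -> Eq x m1 m3.
Proof.
move=> [w1 w2 l12 h12] [_ w3 l23 h23]; split=> //; first by rewrite l12.
move=> a u v au ux mv; apply: EQ_trans (h12 _ _ _ au ux mv) _; apply: h23 => //.
by rewrite -l12.
Qed.

Lemma Eq_cat x m1 m m' m2 : wl x m1 -> Eq (last x m1) m m' ->
  wl (last (last x m1) m) m2 -> Eq x (m1 ++ m ++ m2) (m1 ++ m' ++ m2).
Proof.
move=> x1 [wm wm' lE h] w2; split.
- by apply: wl_cat => //; apply: wl_cat.
- by apply: wl_cat => //; apply: wl_cat; rewrite -?lE.
- by rewrite !last_cat lE.
- move=> a u v au ux mv.
  have := h a (u ++ map dl m1) (map dl m2 ++ v).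
  rewrite -!catA !map_cat -!catA; apply.
  + by apply: vl_cat => //; rewrite ux; exact: wl_vl.
  + by rewrite last_cat ux last_map.
  + apply: vl_cat; first exact: wl_vl.
    by move: mv; rewrite !last_cat last_map.
Qed.

Lemma Eq_stutter x : wcom x x -> Eq x [:: x] [::].
Proof.
move=> xx; split=> //= a u v au ux mv; have := EQ_stutter (v := v) au.
by rewrite ux; apply.
Qed.

Lemma Eq_wlink x P : wlink x x P -> last x (unzip1 P) = last x (unzip2 P) ->
  Eq x (unzip1 P) (unzip2 P).
Proof.
move=> xP lE; have [w1 w2] := wlink_wl xP; split=> // a u v au ux mv.
have E1 : unzip1 (map dl2 P) = map dl (unzip1 P) by rewrite /unzip1 -!map_comp.
have E2 : unzip2 (map dl2 P) = map dl (unzip2 P) by rewrite /unzip2 -!map_comp.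
have c1 Q Q' : unzip1 (Q ++ Q') = unzip1 Q ++ unzip1 Q' :> seq node by exact: map_cat.
have c2 Q Q' : unzip2 (Q ++ Q') = unzip2 Q ++ unzip2 Q' :> seq node by exact: map_cat.
have := @EQ_link a (diag u ++ map dl2 P ++ diag v).
rewrite !c1 !c2 !unzip1_diag !unzip2_diag E1 E2; apply; last first.
  by rewrite !last_cat ux !last_map lE.
apply: link_cat; first exact: link_diag.
rewrite unzip1_diag unzip2_diag ux; apply: link_cat; first exact: wlink_link.
by rewrite E1 E2 !last_map -lE; exact: link_diag.
Qed.

Lemma Eq_last x m : wl x m -> Eq x m (rcons m (last x m)).
Proof.
move=> xm; apply: Eq_sym; rewrite -[X in Eq _ _ X]cats0 -cats1.
have xl : wcom (last x m) (last x m).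
  by elim: m x xm => //= y m IH x [_]; exact: IH.
have := @Eq_cat x m [:: last x m] [::] [::] xm (Eq_stutter xl).
by rewrite /= !cats0; apply.
Qed.

End NodeHomotopy.

(** * Label words in the polygonal complex *)

Section Polygonal.
Variables (k : nat) (Z : graph).
Local Notation W := (Z + set (seq Z))%type.
Local Notation K := (polygonal_simplices Z k).
Implicit Types (x y : Z) (c d p : seq Z).

Lemma simple_loop_cycle c : simple_loop k c -> cycle (@adj Z) c /\ uniq c.
Proof. by case=> _ /andP[]. Qed.

Lemma simple_loop_adj c x : simple_loop k c -> x \in c -> adj x (next c x).
Proof. by move=> /simple_loop_cycle[cc uc] xc; exact: next_cycle. Qed.

Lemma polygonal_uniq s : K s -> uniq s.
Proof.
case=> [[x ->]|[x [y [xy ->]]]|[c [x [lc xc ->]]]] //=; rewrite !inE andbT /=.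
  by rewrite (inj_eq inl_inj) adj_neq.
by rewrite (inj_eq inl_inj) (adj_neq (simple_loop_adj lc xc)).
Qed.

Lemma rotations_mem c c' : rotations c = rotations c' -> c =i c'.
Proof.
move=> e x; have : rotations c c by exists 0%N; rewrite rot0.
by rewrite e => -[i ->]; rewrite mem_rot.
Qed.

Lemma rotations_next c c' : uniq c -> rotations c = rotations c' -> next c =1 next c'.
Proof.
move=> uc e x; have : rotations c' c' by exists 0%N; rewrite rot0.
by rewrite -e => -[i ->]; rewrite next_rot.
Qed.

Lemma loop_in_ball c x : cycle (@adj Z) c -> x \in c ->
  all (fun y => (dist x y <= size c)%N) c.
Proof.
move=> cc xc; have [i q cE] := rot_to xc.
have cr : cycle (@adj Z) (x :: q) by rewrite -cE rot_cycle.
move: cr => /=; rewrite rcons_path => /andP[pq _].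
apply/allP => y; rewrite -(mem_rot i) -(size_rot i) cE inE => /predU1P[->|yq].
  by rewrite distxx.
exact: (allP (walk_in_ball pq (leqnSn _))).
Qed.

Lemma ex_seqs (A : choiceType) (l : seq A) n :
  finite_set [set s : seq A | (size s <= n)%N /\ {subset s <= l}].
Proof.
elim: n => [|n IH].
  by apply: (@sub_finite_set _ _ [set [::]]) => // -[|a s] [].
pose B := [set s : seq A | (size s <= n)%N /\ {subset s <= l}].
apply: (@sub_finite_set _ _ ([set [::]] `|` (fun z => z.1 :: z.2) @` ([set` l] `*` B))).
  move=> [|a s] [/= ss sl]; [by left|right; exists (a, s) => //; split=> //=].
    exact: sl (mem_head _ _).
  by split=> // b bs; apply: sl; rewrite inE bs orbT.
rewrite finite_setU; split => //; apply: finite_image; apply: finite_setX => //.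
Qed.

Lemma loops_finite x : finite_set [set c | simple_loop k c /\ x \in c].
Proof.
have [l lP] := ex_ball k x.
apply: sub_finite_set (ex_seqs l k) => c [[/andP[_ ck] /andP[cc _]] xc]; split=> // y yc.
apply: lP; apply: (leq_trans _ ck).
exact: (allP (loop_in_ball cc xc)).
Qed.

Lemma loops_class_finite (C : set (seq Z)) :
  finite_set [set c | simple_loop k c /\ rotations c = C].
Proof.
have [[c0 [lc0 cC]]|h] := pselect (exists c0, simple_loop k c0 /\ rotations c0 = C);
  last first.
  by apply: (@sub_finite_set _ _ set0) => // c hc; apply: h; exists c.
apply: sub_finite_set (ex_seqs c0 k) => c [[/andP[_ ck] _] e]; split=> // y.
by rewrite (rotations_mem (c := c) (c' := c0)) // e cC.
Qed.

(** Loops through a vertex stay in its ball of radius [k], and the class labelling a centre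
    determines the vertex set of its loops. *)
Lemma polygonal_locally_finite w : finite_set [set s | K s /\ w \in s].
Proof.
pose tri (z : seq Z * Z) : seq W := [:: inr (rotations z.1); inl z.2; inl (next z.1 z.2)].
case: w => [x|C].
  have [nx nxP] := ex_nbrs x.
  pose L := [set c | simple_loop k c /\ x \in c].
  pose E1 : set (seq W) := [set [:: inl x; inl y] | y in [set` nx]].
  pose E2 : set (seq W) := [set [:: inl y; inl x] | y in [set` nx]].
  pose E3 : set (seq W) := \bigcup_(c in L) [set tri (c, y) | y in [set` c]].
  apply: (@sub_finite_set _ _ ([set [:: inl x]] `|` (E1 `|` (E2 `|` E3)))).
    move=> s [[[y ->]|[y [z [yz ->]]]|[c [y [lc yc ->]]]]].
    + by rewrite inE => /eqP[->]; left.
    + rewrite !inE => /orP[] /eqP[xE]; subst x; right; [left|right; left].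
        by exists z; rewrite //= nxP.
      by exists y; rewrite //= nxP adj_sym.
    + rewrite !inE /= => /orP[] /eqP[xE]; subst x; right; right; right; exists c.
      * by split.
      * by exists y.
      * by split=> //; rewrite mem_next.
      * by exists y.
  rewrite !finite_setU; split=> //; split; first exact: finite_image.
  split; first exact: finite_image.
  apply: bigcup_finite; first exact: loops_finite.
  by move=> c _; exact: finite_image.
apply: (@sub_finite_set _ _ (\bigcup_(c in [set c | simple_loop k c /\ rotations c = C])
   [set tri (c, y) | y in [set` c]])).
  move=> s [[[y ->]|[y [z [yz ->]]]|[c [y [lc yc ->]]]]]; rewrite !inE //.
  by rewrite !orbF => /eqP[->]; exists c => //; exists y.
apply: bigcup_finite; first exact: loops_class_finite.
by move=> c _; exact: finite_image.
Qed.

Local Notation wcom := (wcom K).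
Local Notation wl := (wl K).

Lemma wcom_inl x y : wcom (inl x) (inl y) -> x = y \/ adj x y.
Proof.
case=> s [[z ->]|[z [t [zt ->]]]|[c [z [lc zc ->]]]]; rewrite !inE /=.
- by case=> /eqP[->] /eqP[->]; left.
- by case=> /orP[] /eqP[->] /orP[] /eqP[->]; [left|right|right; rewrite adj_sym|left].
- have zn := simple_loop_adj lc zc.
  by case=> /orP[] /eqP[->] /orP[] /eqP[->]; [left|right|right; rewrite adj_sym|left].
Qed.

Lemma wcom_center x C : wcom (inl x) (inr C) ->
  exists c, [/\ simple_loop k c, x \in c & rotations c = C].
Proof.
case=> s [[z ->]|[z [t [zt ->]]]|[c [z [lc zc ->]]]]; rewrite !inE /=; try by case.
by rewrite !orbF => -[/orP[] /eqP[->] /eqP[->]]; exists c; rewrite ?mem_next.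
Qed.

Lemma wcom_centers C C' : wcom (inr C) (inr C') -> C = C'.
Proof.
case=> s [[z ->]|[z [t [zt ->]]]|[c [z [lc zc ->]]]]; rewrite !inE /=; try by case.
by rewrite !orbF => -[/eqP[->] /eqP[->]].
Qed.

Lemma wcomx x : wcom (inl x) (inl x).
Proof. by exists [:: inl x]; rewrite ?inE //; constructor 1; exists x. Qed.

Lemma adj_wcom x y : adj x y -> wcom (inl x) (inl y).
Proof.
by move=> xy; exists [:: inl x; inl y]; rewrite ?inE ?eqxx ?orbT //; constructor 2;
  exists x, y.
Qed.

Lemma path_wl x p : path (@adj Z) x p -> wl (inl x) (map inl p).
Proof. by elim: p x => [|y p IH] x /=;
  [move=> _; exact: wcomx|move=> /andP[/adj_wcom ? /IH]]. Qed.

Lemma fpath_loop c x p : simple_loop k c -> x \in c -> fpath (next c) x p ->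
  path (@adj Z) x p /\ last x p \in c.
Proof.
move=> lc; elim: p x => //= y p IH x xc /andP[/eqP xy py]; subst y.
have [||-> ->] := IH (next c x); rewrite ?mem_next // andbT; split=> //.
exact: simple_loop_adj.
Qed.

Lemma loop_arc c x y : uniq c -> x \in c -> y \in c ->
  exists2 p, fpath (next c) x p & last x p = y.
Proof.
move=> uc xc yc; have [i q cE] := rot_to xc.
have uq : uniq (x :: q) by rewrite -cE rot_uniq.
have nE : next (x :: q) =1 next c by move=> a; rewrite -cE next_rot.
have : fcycle (next c) (x :: q).
  rewrite -(eq_cycle (e := frel (next (x :: q)))); first exact: cycle_next.
  by move=> a b; exact: (congr1 (fun z => z == b) (nE a)).
rewrite /= rcons_path => /andP[pq _].
have yq : y \in x :: q by rewrite -cE mem_rot.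
move: pq; case/splitPl: yq => p1 p2 l1.
by rewrite cat_path => /andP[pq _]; exists p1.
Qed.

Variable R : realType.
Local Notation Eq := (Eq R K).
Let Ku := polygonal_uniq.

(** The fan of triangles along the arc is a ladder between the arc, with its last vertex doubled,
    and a word repeating the centre; the repetitions are then removed. *)
Lemma Eq_loop_arc c x p : simple_loop k c -> x \in c -> fpath (next c) x p ->
  p != [::] -> Eq (inl x) (map inl p) [:: inr (rotations c); inl (last x p)].
Proof.
move=> lc xc fp pn; set C : W := inr _; set t : W := inl _.
have tri z : z \in c -> K [:: C; inl z; inl (next c z)].
  by move=> zc; constructor 3; exists c, z.
have [pp tc] := fpath_loop lc xc fp.
(* Initially both sides of the ladder are at [x], but after the first rung the second side is at the
   centre; the induction has to allow both. *)
have wlk e : (e = inl x \/ e = C) -> wlink K (inl x) e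
    (zip (rcons (map inl p) t) (rcons (nseq (size p) C) t)).
  rewrite {}/t; elim: p x xc fp {pn pp tc} e => [|y p IH] x xc fp e eE /=.
    have xe : wcom (inl x) (inl x) by exact: wcomx.
    split=> //; exists [:: C; inl x; inl (next c x)]; first exact: tri.
    by case: eE => ->; rewrite !inE !eqxx ?orbT.
  move: fp => /= /andP[/eqP yE fp]; subst y; split; last first.
    by apply: IH => //; [rewrite mem_next|right].
  exists [:: C; inl x; inl (next c x)]; first exact: tri.
  by case: eE => ->; rewrite !inE !eqxx ?orbT.
have lE : last (inl x : W) (map inl p) = t by rewrite (last_map (inl : Z -> W)).
have h1 := Eq_last R Ku (path_wl pp); rewrite lE in h1.
have sz : size (rcons (map (inl : Z -> W) p) t) = size (rcons (nseq (size p) C) t).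
  by rewrite !size_rcons size_map size_nseq.
have h2 := Eq_wlink R Ku (wlk (inl x) (or_introl erefl)).
rewrite unzip1_zip ?unzip2_zip ?sz // !last_rcons in h2.
apply: Eq_trans h1 (Eq_trans (h2 erefl) _) => {h2}.
have CC : wcom C C by exists [:: C; inl x; inl (next c x)]; [exact: tri|rewrite inE eqxx].
have Ct : wcom C t by exists [:: C; t; inl (next c (last x p))];
  [exact: tri|rewrite !inE !eqxx orbT].
have xC : wcom (inl x) C by exists [:: C; inl x; inl (next c x)];
  [exact: tri|rewrite !inE !eqxx orbT].
have CE n : Eq (inl x) (nseq n.+1 C ++ [:: t]) [:: C; t].
  elim: n => [|n IH]; first by apply: Eq_refl => //=; do !split => //; exact: wcomx.
  apply: Eq_trans _ IH; apply: (@Eq_cat _ _ _ Ku (inl x) [:: C]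
    [:: C] [::] (nseq n C ++ [:: t])).
  - by [].
  - exact: Eq_stutter.
  - by elim: n => [|n IH] /=; split=> //; exact: wcomx.
have -> : size p = (size p).-1.+1 by move: pn; rewrite -size_eq0; case: (size p).
by rewrite -cats1; exact: CE.
Qed.

(** A back-and-forth folds along its edge. A simple loop is an arc from [a] to [a], hence a detour
    through the centre, which folds back onto [a]. *)
Lemma Eq_elementary a d : elementary_loop k a d -> Eq (inl a) (map inl d) [::].
Proof.
move=> [pd ld ud sd]; have aa := wcomx a.
have Eaa : Eq (inl a) [:: inl a; inl a] [::].
  apply: (@Eq_trans _ _ _ _ _ [:: inl a]); last exact: Eq_stutter.
  by apply: (@Eq_cat _ _ _ Ku (inl a) [::] [:: inl a] [::] [:: inl a]) => //;
    exact: Eq_stutter.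
case: d pd ld ud sd => [|y [|z [|t d]]].
- by move=> *; apply: Eq_refl.
- by move=> /= + ya; rewrite ya adj_irr.
- move=> /= /and3P[ay _ _] za _ _; subst z; apply: Eq_trans _ Eaa.
  apply: (@Eq_wlink R W K Ku _ [:: (inl y, inl a); (inl a, inl a)]) => //=.
  have K2 : K [:: inl a; inl y] by constructor 2; exists a, y.
  by do !split => //; exists [:: inl a; inl y]; rewrite // !inE !eqxx ?orbT.
- set c := [:: y, z, t & d] => pd ld ud sd.
  have sc : (2 < size c <= k)%N by move: sd; rewrite leq_max.
  have ac : a \in c by rewrite -ld; exact: (mem_last y [:: z, t & d]).
  have lc : simple_loop k c.
    split=> //; rewrite /ucycle ud andbT /c /cycle rcons_path.
    by move: pd => /= /andP[ay ->]; move: ld => /= ->.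
  have fc : fpath (next c) a c.
    have := cycle_next ud; rewrite {2}/c /cycle rcons_path => /andP[h1 h2].
    by rewrite {2}/c -ld /=; apply/andP; split.
  have := Eq_loop_arc lc ac fc isT; rewrite ld => /Eq_trans; apply.
  apply: Eq_trans _ Eaa.
  apply: (@Eq_wlink R W K Ku _ [:: (inr (rotations c), inl a); (inl a, inl a)]) => //=.
  have K3 : K [:: inr (rotations c); inl a; inl (next c a)] by constructor 3; exists c, a.
  by do !split => //; exists [:: inr (rotations c); inl a; inl (next c a)];
    rewrite // !inE !eqxx ?orbT.
Qed.

Lemma Eq_walk_homo P x w w' : walk_homo k P x w w' -> path (@adj Z) x w ->
  Eq (inl x) (map inl w) (map inl w').
Proof.
elim=> {w w'} [w|w1 d w2 ed _|w w' hw h|w1 w2 w3 hw1 h1 _ h2] pw.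
- exact/Eq_refl/path_wl.
- move: pw; rewrite cat_path => /andP[p1 p2]; rewrite !map_cat; apply: Eq_sym.
  have [_ ld _ _] := ed.
  apply: (@Eq_cat _ _ _ Ku (inl x) (map inl w1) (map inl d) [::] (map inl w2)).
  + exact: path_wl.
  + by rewrite (last_map (inl : Z -> W)); exact: Eq_elementary.
  + by rewrite !(last_map (inl : Z -> W)) ld; exact: path_wl.
- by apply/Eq_sym/h; rewrite (walk_homo_path hw).
- by apply: Eq_trans (h1 pw) (h2 _); rewrite -(walk_homo_path hw1).
Qed.

(** Repeated centres are merged, since two centres share no simplex unless they are equal; a centre
    between two vertices is replaced by the arc of its loop from one to the other. *)
Lemma Eq_no_centers x x' m : wl (inl x) m -> last (inl x) m = inl x' ->
  exists p, [/\ path (@adj Z) x p, last x p = x' & Eq (inl x) m (map inl p)].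
Proof.
have [n] := ubnP (size m); elim: n m x => // n IH [|w m] x sm.
  by move=> /= _ [<-]; exists [::]; split=> //; apply: Eq_refl => //=; exact: wcomx.
move=> /= [xw wm] lm; case: w sm xw wm lm => [y|C] sm xw wm lm.
  have [p [pp lp Ep]] := IH m y sm wm lm.
  have [e|xy] := wcom_inl xw.
    subst y; exists p; split=> //; apply: Eq_trans _ Ep.
    apply: (@Eq_cat _ _ _ Ku (inl x) [::] [:: inl x] [::] m);
      [exact: wcomx|exact/Eq_stutter/wcomx|exact: wm].
  exists (y :: p); split; rewrite //= ?xy //.
  have w0 : wl (last (inl y) m) [::] by rewrite lm; exact: wcomx.
  have := @Eq_cat _ _ _ Ku (inl x) [:: inl y] m (map inl p) [::] (conj xw (wcomr xw)) Ep w0.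
  by rewrite !cats0.
case: m sm wm lm => // -[y|C'] m sm [Cw wm] lm; last first.
  have e := wcom_centers Cw; subst C'.
  have [p [pp lp Ep]] := IH (inr C :: m) x sm (conj xw wm) lm.
  exists p; split=> //; apply: Eq_trans _ Ep.
  apply: (@Eq_cat _ _ _ Ku (inl x) [:: inr C] [:: inr C] [::] m) => //.
  exact: Eq_stutter.
have {}lm : last (inl y) m = inl x' := lm.
have [q [pq lq Eq']] := IH m y (ltnW sm) wm lm.
have [c [lc xc cC]] := wcom_center xw; have [c' [lc' yc' c'C]] := wcom_center (wcomC Cw).
have yc : y \in c by rewrite (rotations_mem (c' := c')) // cC.
have [_ uc] := simple_loop_cycle lc; have [p fp lp] := loop_arc uc xc yc.
have [pp _] := fpath_loop lc xc fp.
suff h : Eq (inl x) [:: inr C; inl y] (map inl p).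
  exists (p ++ q); split; rewrite ?cat_path ?pp ?lp ?last_cat ?lp //.
  rewrite map_cat.
  have h1 := @Eq_cat _ _ _ Ku (inl x) [::] _ _ m (wcomx x) h wm.
  apply: Eq_trans h1 _ => /=.
  have := @Eq_cat _ _ _ Ku (inl x) (map inl p) m (map inl q) [::] (path_wl pp).
  by rewrite !cats0 (last_map (inl : Z -> W)) lp lm; apply=> //=; exact: wcomx.
(* The arc is empty when the word returns to [x]; the detour then folds inside a simplex containing
   [x] and the centre. *)
case: (eqVneq p [::]) => [p0|pn]; last first.
  by apply: Eq_sym; rewrite -cC -lp; exact: Eq_loop_arc.
subst p; move: lp => /= xy; subst y.
apply: (@Eq_trans _ _ _ _ _ [:: inl x; inl x]).
  apply: (@Eq_wlink R W K Ku _ [:: (inr C, inl x); (inl x, inl x)]) => //=.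
  case: (xw) => s Ks [xs Cs]; split; first by exists s.
  by split; [exists s|exact: wcomx].
apply: (@Eq_trans _ _ _ _ _ [:: inl x]); last exact/Eq_stutter/wcomx.
by apply: (@Eq_cat _ _ _ Ku (inl x) [::] [:: inl x] [::] [:: inl x]) => /=;
  [exact: wcomx|exact/Eq_stutter/wcomx|split; exact: wcomx].
Qed.

End Polygonal.

(** * A Lebesgue number for open stars *)

Section Lebesgue.
Variables (R : realType) (W : choiceType) (K : set (seq W)).

(** The sets [0 < p w] are open because coordinates are continuous, and they cover since some
    coordinate of each point is positive; compactness of the square gives a common size. The
    vertices [w] serve as discrete labels of small cells. *)
Lemma open_star_lebesgue (g : R * R -> realization R K) : continuous g ->
  exists2 d : R, 0 < d & forall z : R * R, 0 <= z.1 <= 1 -> 0 <= z.2 <= 1 ->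
    exists w, forall z' : R * R, `|z.1 - z'.1| < d -> `|z.2 - z'.2| < d -> 0 < g z' w.
Proof.
move=> cg; pose P (d : R) (z : R * R) := exists w, forall z' : R * R,
  `|z.1 - z'.1| < d -> `|z.2 - z'.2| < d -> 0 < g z' w.
have cpt : compact (`[0 : R, 1] `*` `[0 : R, 1]).
  by apply: compact_setX; exact: segment_compact.
have /compact_near_coveringP/(_ R (0^'+) P) := cpt.
have hP (x : R * R) : (`[0 : R, 1] `*` `[0 : R, 1]) x ->
    \forall x' \near x & i \near 0^'+, P i x'.
  move=> _; have [s Ks sx] := baryP (g x); have [w ws wp] := in_simplex_ex sx.
  have cw : continuous (fun z => g z w).
    by apply: (@cont_comp _ _ _ (fun p : realization R K => p w) g); [exact: bary_continuous|].
  have : \forall z \near x, 0 < g z w by exact: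
    (@cvgr_gt R _ (nbhs x) _ (fun z => g z w) _ (cw x) 0 wp).
  move=> /nbhs_ballP[e /= e0 eP].
  have e20 : 0 < e / 2 by lra.
  exists (ball x (e / 2), [set d | d < e / 2]) => /=.
    split; first exact: nbhsx_ballx.
    exact: nbhs_right_lt.
  move=> [z d] [/= [zx1 zx2] de]; exists w => z' z1 z2; apply: eP.
  have {}zx1 : `|x.1 - z.1| < e / 2 := zx1.
  have {}zx2 : `|x.2 - z.2| < e / 2 := zx2.
  have {}de : d < e / 2 := de.
  split.
    rewrite /ball /= (_ : x.1 - z'.1 = (x.1 - z.1) + (z.1 - z'.1)); last by ring.
    by rewrite (le_lt_trans (ler_normD _ _)) //; lra.
  rewrite /ball /= (_ : x.2 - z'.2 = (x.2 - z.2) + (z.2 - z'.2)); last by ring.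
  by rewrite (le_lt_trans (ler_normD _ _)) //; lra.
move=> /(_ _ hP) h.
have h0 : \forall d \near (0 : R)^'+, 0 < d by exact: nbhs_right_gt.
have h1 : \forall d \near (0 : R)^'+, (`[0, 1] `*` `[0, 1]) `<=` P d /\ 0 < d.
  by apply: filterS2 h h0 => d.
have [d dP] := @filter_ex _ _ (at_right_proper_filter (0 : R)) _ h1.
exists d; first by case: dP.
move=> z z1 z2.
have hz : (`[0 : R, 1] `*` `[0 : R, 1]) z by split; rewrite /= in_itv.
by case: dP => dP _; exact: dP hz.
Qed.

End Lebesgue.

Section Assemble.
Variables (R : realType) (W : choiceType) (K : set (seq W)).
Hypothesis K_uniq : forall s, K s -> uniq s.
Hypothesis K_locally_finite : forall w, finite_set [set s | K s /\ w \in s].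

Lemma realize (T : topologicalType) (h : T -> W -> R) :
  (forall w, continuous (fun t => h t w)) -> (forall t, valid K (h t)) ->
  exists2 g : T -> realization R K, continuous g & forall t w, g t w = h t w.
Proof.
move=> ch vh; exists (fun t => Realization (vh t)) => //.
exact: realization_continuous.
Qed.

Lemma vl_pl_valid (a : W -> R) l u : vl K a l -> valid K (pl a l u).
Proof.
move=> al; have [c Kc] := link_pl u (link_diag al).
by rewrite unzip1_diag => -[h _]; exists c.
Qed.

Lemma rhom_null_homotopic (g : R -> realization R K) :
  rhom K (fun s => g (clamp s)) (fun _ => g 0) -> g 0 = g 1 -> null_homotopic g.
Proof.
move=> [H [cH vH H01 Hs]] g01.
have [G cG GE] := realize (h := fun z : R * R => H z.1 z.2) cH (fun z => vH z.1 z.2).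
exists G; split.
- exact: continuous_subspaceT.
- move=> s s01; apply: realization_ext => w; rewrite GE /=.
  by have [-> _] := H01 s; rewrite clamp_id.
- by move=> s _; apply: realization_ext => w; rewrite GE /=; have [_ ->] := H01 s.
- move=> t _; have [h0 h1] := Hs t.
  split; apply: realization_ext => w; rewrite GE /= ?h0 ?h1 ?clamp0 //.
  by rewrite clamp1 g01.
Qed.

Lemma wl_nth d x (m : seq W) : wcom K x x ->
  (forall j, (j < size m)%N -> wcom K (nth d (x :: m) j) (nth d m j)) -> wl K x m.
Proof.
elim: m x => //= y m IH x xx h; have xy := h 0%N isT; split=> //.
by apply: IH => [|j jm]; [exact: wcomr xy|exact: (h j.+1)].
Qed.

End Assemble.

Lemma nat_floor (R : realType) (u : R) : 0 <= u ->
  exists j, j%:R <= u /\ u <= j.+1%:R.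
Proof.
move=> u0; exists (Num.trunc u); have /andP[h1 h2] := truncn_itv u0.
by split=> //; exact: ltW.
Qed.

(** * From contractible closed walks to a simply connected complex *)

Section SimplyConnected.
Variables (R : realType) (k : nat) (Z : graph).
Local Notation W := (Z + set (seq Z))%type.
Local Notation K := (polygonal_simplices Z k).
Local Notation dl := (@delta R W).
Let Ku : forall s, K s -> uniq s := @polygonal_uniq k Z.
Let Kf := @polygonal_locally_finite k Z.

Lemma polygonal_vertex s : K s -> exists x, inl x \in s.
Proof.
case=> [[x ->]|[x [y [_ ->]]]|[c [x [_ _ ->]]]]; exists x; rewrite !inE ?eqxx ?orbT //.
Qed.

Lemma polygonal_path_connected : path_connected R (polygonal_complex R k Z).
Proof.
move=> p q; have [s Ks sp] := baryP p; have [t Kt tq] := baryP q.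
have [x xs] := polygonal_vertex Ks; have [y yt] := polygonal_vertex Kt.
have [w pw lw] := adj_connected x y.
pose l := dl (inl x) :: map dl (map inl w) ++ [:: (q : W -> R)].
have vlp : vl K p l.
  split; first by exists s => //; split=> //; exact: in_simplex_delta (Ku Ks) xs.
  apply: vl_cat; first by apply: (wl_vl R Ku); exact: path_wl.
  rewrite last_map (last_map (inl : Z -> W)) lw.
  split; last by exists t.
  by exists t => //; split=> //; exact: in_simplex_delta (Ku Kt) yt.
have [||g cg gE] := @realize R W K Ku Kf R (fun s => pl p l ((size l)%:R * s)).
- by move=> w'; apply: (@pl_cont _ _ _ _ _ (fun s : R => (size l)%:R * s)); cont.
- by move=> s'; exact: vl_pl_valid.
exists g; split; first exact: continuous_subspaceT.
  by apply: realization_ext => w'; rewrite gE mulr0 pl_le0.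
by apply: realization_ext => w'; rewrite gE mulr1 pl_last // /l /= last_cat.
Qed.

(** The label word is traded for an edge walk, which contracts. What remains goes from [a] to [x0]
    and back, and is pulled onto [a] inside their common simplex. *)
Lemma EQ_loop (a : W -> R) x0 m : valid K a -> com2 K a (dl (inl x0)) ->
  wl K (inl x0) m -> last (inl x0) m = inl x0 -> simply_loop_connected k Z ->
  exists N0, forall N, (N0 <= N)%N ->
    rhom K (fun s => pl a (dl (inl x0) :: rcons (map dl m) a) (N%:R * s)) (fun _ => a).
Proof.
move=> va ax wm lm slc; have [p [pp lp Ep]] := Eq_no_centers R wm lm.
have Ep' := Eq_walk_homo R (slc _ _ pp lp) pp.
have [_ _ _ h] := Eq_trans Ep Ep'.
have [sa Ksa sa_a] := va.
have xa : com2 K (dl (inl x0)) a by case: ax => c Kc [c1 c2]; exists c.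
have h1 : EQ K a (dl (inl x0) :: rcons (map dl m) a) [:: dl (inl x0); a].
  have := h a [:: dl (inl x0)] [:: a]; rewrite cats1 /=; apply=> //.
    by split=> //; exact: com2r ax.
  by rewrite lm; split=> //; exists sa.
have h2 : EQ K a [:: dl (inl x0); a] [:: a; a].
  apply: (@EQ_link _ _ _ a [:: (dl (inl x0), a); (a, a)]) => //=.
  case: ax => c Kc [c1 c2]; split; first by exists c.
  by split; [exists c|exists sa].
have [N0 hN] := EQ_trans h1 h2; exists N0 => N /hN.
congr rhom; apply/funext => s.
have [u1|u1] := leP (N%:R * s) 1.
  by rewrite pl_cons_le1 //; apply/funext => w; ring.
rewrite pl_cons_ge1 ?(ltW u1) //; have [u2|u2] := leP (N%:R * s - 1) 1.
  by rewrite pl_cons_le1 //; apply/funext => w; ring.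
by rewrite pl_cons_ge1 ?(ltW u2).
Qed.

Lemma polygonal_null_homotopic (g : R -> polygonal_complex R k Z) :
  simply_loop_connected k Z ->
  {within `[0, 1], continuous g} -> g 0 = g 1 -> null_homotopic g.
Proof.
move=> slc cg g01; apply: (rhom_null_homotopic Ku Kf) => //.
have cgc := within_clamp cg; set a : W -> R := g 0.
pose h s : W -> R := g (clamp s).
have ch : rcont h.
  move=> w; have cb : continuous (fun p : realization R K => p w) by exact: bary_continuous.
  exact: (@cont_comp R (realization R K) R _ _ cb cgc).
have vh s : valid K (h s) by exact: baryP.
have h_le0 s : s <= 0 -> h s = a by move=> s0; rewrite /h clamp_le0.
have h_ge1 s : 1 <= s -> h s = a by move=> s1; rewrite /h clamp_ge1 // -g01.
have [d d0 dP] : exists2 d : R, 0 < d & forall s : R, 0 <= s <= 1 ->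
    exists w, forall s', `|s - s'| < d -> 0 < h s' w.
  have [|d d0 dP] := @open_star_lebesgue R W K (fun z => g (clamp z.1)).
    exact: (@cont_comp (R * R)%type R (realization R K) _ _ cgc (@cont_fst R R)).
  exists d => // s s01; have [|w hw] := dP (s, 0) s01; first by rewrite lexx ler01.
  by exists w => s' ss'; apply: (hw (s', 0)) => //=; rewrite subrr normr0.
have [N N0 Nd] : exists2 N, (0 < N)%N & N%:R^-1 < d :> R.
  exists (Num.trunc d^-1).+1 => //; rewrite invf_plt ?posrE ?ltr0n //.
  have d1 : 0 <= d^-1 by rewrite invr_ge0 ltW.
  by have /andP[] := truncn_itv d1.
have Np : 0 < N%:R :> R by rewrite ltr0n.
have /choice[v vP] : forall j, exists w, (j <= N)%N ->
    forall s', `|j%:R / N%:R - s'| < d -> 0 < h s' w.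
  move=> j; have [jN|jN] := leqP j N.
    have [|w hw] := dP (j%:R / N%:R); last by exists w.
    by rewrite divr_ge0 ?ler0n //= ler_pdivrMr // mul1r ler_nat.
  by have [s Ks sa] := baryP (g 0); have [x _] := polygonal_vertex Ks; exists (inl x).
have [s0 Ks0 sa] := baryP (g 0); rewrite -/a in sa.
have [x0 x0s] := polygonal_vertex Ks0.
have va : valid K a by exists s0.
have dx0 : in_simplex s0 (dl (inl x0)) := in_simplex_delta R (Ku Ks0) x0s.
pose lab j := if (j <= N)%N then v j else inl x0.
(* [v j] serves a whole [d]-neighbourhood of [j / N], and [1 / N < d]: it is in the support of the
   loop between the two neighbouring sample points. *)
have vj j s : (j <= N)%N -> `|N%:R * s - j%:R| <= 1 -> 0 < h s (v j).
  move=> jN hj; apply: vP => //; rewrite (_ : _ - s = (j%:R - N%:R * s) / N%:R).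
    rewrite normrM normfV (ger0_norm (ltW Np)) distrC.
    by apply: le_lt_trans Nd; rewrite ler_pdivrMr // mulVf ?gt_eqF.
  by field; rewrite gt_eqF.
have v0s : v 0%N \in s0.
  apply: (in_simplex_supp sa); rewrite -(h_le0 0 (lexx 0)); apply: vj => //.
  by rewrite mulr0 subrr normr0 ler01.
have vNs : v N \in s0.
  apply: (in_simplex_supp sa); rewrite -(h_ge1 1 (lexx 1)); apply: vj => //.
  by rewrite mulr1 subrr normr0 ler01.
have cv j : (j < N)%N -> wcom K (v j) (v j.+1).
  move=> jN; have [s Ks hs] := vh (j%:R / N%:R).
  have E : N%:R * (j%:R / N%:R) = j%:R :> R by rewrite mulrCA divff ?mulr1 // gt_eqF.
  exists s => //; split; apply: (in_simplex_supp hs); apply: vj; rewrite ?(ltnW jN) // E.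
    by rewrite subrr normr0 ler01.
  by rewrite -natr1 opprD addrA subrr sub0r normrN normr1.
(* The word is [v 0, ..., v N] followed by [inl x0], the value of [lab] beyond [N], so that it
   closes up at a vertex of the simplex of [a]. *)
pose m := mkseq lab N.+2.
have szm : size m = N.+2 by rewrite size_mkseq.
have wm : wl K (inl x0) m.
  apply: (@wl_nth _ _ (inl x0)); first by exists s0.
  rewrite szm => -[|j] jm; first by rewrite nth_mkseq //= /lab /=; exists s0.
  have -> : nth (inl x0) (inl x0 :: m) j.+1 = nth (inl x0) m j by [].
  rewrite !nth_mkseq //; last exact: ltnW.
  rewrite /lab; have [jN|jN] := leqP j.+1 N; first by rewrite (ltnW jN); exact: cv.
  have -> : j = N by apply/eqP; rewrite eqn_leq; apply/andP; split; [exact: jm|exact: jN].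
  by rewrite leqnn; exists s0.
have lm : last (inl x0) m = inl x0.
  rewrite (last_nth (inl x0)) szm.
  have -> : nth (inl x0) (inl x0 :: m) N.+2 = nth (inl x0) m N.+1 by [].
  by rewrite nth_mkseq // /lab ltnn.
pose l := dl (inl x0) :: rcons (map dl m) a.
have szl : size l = N.+4.
  by rewrite -[LHS]/(size (rcons (map dl m) a)).+1 size_rcons size_map szm.
have ax : com2 K a (dl (inl x0)) by exists s0.
have vl_l : vl K a l.
  split=> //; rewrite -cats1; apply: vl_cat; first by have := wl_vl R Ku wm.
  by rewrite last_map lm; split; exists s0.
have [N1 hN1] := EQ_loop va ax wm lm slc.
have M0 : 0 < (N.+4)%:R :> R by rewrite ltr0n.
have M4 : (N.+4)%:R = N%:R + 4 :> R by rewrite -[N.+4]addn4 natrD.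
(* The loop waits at [a] for the first two and the last two of [N + 4] units of time, while the
   polygon goes from [a] through [x0] to [v 0], and at the end from [v N] through [x0] back to
   [a]. *)
pose rho (s : R) : R := clamp (((N.+4)%:R * s - 2) / N%:R).
have rho0 : rho 0 = 0.
  by rewrite /rho mulr0; apply: clamp_le0; rewrite ler_pdivrMr // mul0r; lra.
have rho1 : rho 1 = 1.
  by rewrite /rho mulr1; apply: clamp_ge1; rewrite ler_pdivlMr // M4; lra.
have r1 : rhom K h (h \o rho).
  apply: rhom_reparam => //.
  - by rewrite /rho; cont.
have nthl j : nth a l j.+1 = if (j < N.+2)%N then dl (lab j) else a.
  rewrite -[LHS]/(nth a (rcons (map dl m) a) j) nth_rcons size_map szm; case: ltnP => jN.
    by rewrite (nth_map (inl x0)) ?szm // nth_mkseq.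
  by case: eqP.
(* At every time the two paths share a simplex: [s0] while the loop waits, and otherwise any simplex
   carrying the loop, as it contains both labels of the current segment. *)
have r2 : rhom K (h \o rho) (fun s => pl a l ((N.+4)%:R * s)).
  apply: rhom_line.
  - by move=> w; apply: (@cont_comp _ _ _ (fun s => h s w) rho); [exact: ch|rewrite /rho;
    cont].
  - by move=> w; apply: (@pl_cont _ _ _ _ _ (fun s : R => (N.+4)%:R * s)); cont.
  - move=> s; have -> : (h \o rho) s = h (rho s) by [].
    rewrite /rho; set u := (N.+4)%:R * s.
    have [u0|u0] := leP u 0.
      rewrite pl_le0 // h_le0; first by exists s0.
      by rewrite clamp_le0 // ler_pdivrMr // mul0r; lra.
    have [uM|uM] := leP (N.+4)%:R u.
      rewrite pl_last ?szl // h_ge1; last by rewrite clamp_ge1 // ler_pdivlMr // mul1r; lra.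
      by exists s0 => //; rewrite /l /= last_rcons.
    have [j [ju uj]] := nat_floor (ltW u0).
    have jM : (j < size l)%N by rewrite szl -(ltr_nat R) (le_lt_trans ju).
    have cvx t b b' : in_simplex t b -> in_simplex t b' ->
        in_simplex t (fun w => (1 - (u - j%:R)) * b w + (u - j%:R) * b' w).
      by move=> tb tb'; apply: in_simplex_convex => //; rewrite -natr1 in uj; lra.
    rewrite (pl_nth _ jM) //; case: j ju uj jM cvx => [|[|j]] ju uj jM cvx.
    + exists s0 => //; rewrite h_le0; first by split=> //; exact: cvx.
      by rewrite clamp_le0 // ler_pdivrMr // mul0r; lra.
    + exists s0 => //; rewrite h_le0; last by rewrite clamp_le0 // ler_pdivrMr // mul0r; lra.
      split=> //; apply: cvx => //.
      by rewrite nthl /= /lab /=; exact: in_simplex_delta (Ku Ks0) v0s.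
    + have ju' : j%:R + 2 <= u by rewrite -addn2 natrD in ju.
      have uj' : u <= j%:R + 3 by rewrite -addn3 natrD in uj.
      have -> : nth a (a :: l) j.+2 = nth a l j.+1 by [].
      rewrite !nthl; rewrite szl in jM.
      have [jN|Nj] := ltnP j N.
        have E : N%:R * ((u - 2) / N%:R) = u - 2 by rewrite mulrCA divff ?mulr1 // gt_eqF.
        have jN' : j%:R + 1 <= N%:R :> R by rewrite natr1 ler_nat.
        have j0 : 0 <= j%:R :> R by rewrite ler0n.
        have [t Kt ht] := vh (clamp ((u - 2) / N%:R)).
        have cE : clamp ((u - 2) / N%:R) = (u - 2) / N%:R.
          rewrite clamp_id // divr_ge0 //=; try lra.
          by rewrite ler_pdivrMr // mul1r; lra.
        have e1 : (j < N.+2)%N by rewrite ltnS leqW // ltnW.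
        have e2 : (j.+1 < N.+2)%N by rewrite !ltnS ltnW.
        exists t => //; split=> //; rewrite e1 e2 /lab (ltnW jN) jN.
        have vt i : (i <= N)%N -> `|u - 2 - i%:R| <= 1 -> v i \in t.
          by move=> iN hi; apply: (in_simplex_supp ht); apply: vj; rewrite // cE E.
        apply: cvx; apply: in_simplex_delta; try exact: Ku.
          by apply: vt; rewrite ?(ltnW jN) // ger0_norm; lra.
        by apply: vt; rewrite // -natr1 ler0_norm; lra.
      have jN2 : (j <= N.+1)%N by rewrite -ltnS -ltnS.
      have Nj' : N%:R <= j%:R :> R by rewrite ler_nat.
      exists s0 => //; rewrite h_ge1; last by rewrite clamp_ge1 // ler_pdivlMr // mul1r; lra.
      split=> //; apply: cvx.
        rewrite ltnS jN2 /lab; case: leqP => // jN3.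
        have -> : j = N by apply/eqP; rewrite eqn_leq jN3.
        exact: in_simplex_delta (Ku Ks0) vNs.
      case: ltnP => // _; rewrite /lab ltnNge Nj /=; exact: dx0.
  - have -> : (h \o rho) 0 = h (rho 0) by [].
    by rewrite rho0 mulr0 pl_le0 // h_le0.
  - have -> : (h \o rho) 1 = h (rho 1) by [].
    by rewrite rho1 mulr1 pl_last ?szl // h_ge1 // /l /= last_rcons.
(* [EQ_loop] speaks of large speeds only, so the polygon is first sped up to [N']. *)
pose N' := maxn N1 N.+4.
have MN' : (N.+4)%:R <= N'%:R :> R by rewrite ler_nat leq_maxr.
have r3 : rhom K (fun s => pl a l ((N.+4)%:R * s)) (fun s => pl a l (N'%:R * s)).
  have := @rhom_reparam R W K (fun s => pl a l ((N.+4)%:R * s))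
    (fun s => clamp (N'%:R / (N.+4)%:R * s)) _ _ _ _ _.
  rewrite (_ : _ \o _ = fun s => pl a l (N'%:R * s)).
    apply.
    - by move=> w; apply: (@pl_cont _ _ _ _ _ (fun s : R => (N.+4)%:R * s)); cont.
    - by move=> s; exact: vl_pl_valid.
    - by cont.
    - by rewrite mulr0 clamp0.
    - by rewrite mulr1 clamp_ge1 // ler_pdivlMr // mul1r.
  apply/funext => s; set c := N'%:R / (N.+4)%:R * s.
  suff : pl a l ((N.+4)%:R * clamp c) = pl a l (N'%:R * s) by [].
  have E : (N.+4)%:R * c = N'%:R * s.
    by rewrite /c mulrA; congr (_ * _); rewrite mulrCA divff ?mulr1 // gt_eqF.
  have [c0|c0] := leP c 0.
    have h1 : N'%:R * s <= 0 by rewrite -E pmulr_rle0.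
    by rewrite clamp_le0 // mulr0 (pl_le0 _ _ h1) pl_le0.
  have [c1|c1] := leP 1 c.
    have h1 : (N.+4)%:R <= N'%:R * s by rewrite -E ler_peMr // ltW.
    by rewrite clamp_ge1 // mulr1 !pl_last // szl.
  by rewrite clamp_id ?E // (ltW c0) (ltW c1).
have r4 := hN1 N' (leq_maxl _ _).
exact: rhom_trans r1 (rhom_trans r2 (rhom_trans r3 r4)).
Qed.

Theorem simply_loop_connected_k_simply_connected :
  simply_loop_connected k Z -> k_simply_connected R k Z.
Proof.
by move=> slc; split; [exact: polygonal_path_connected|move=> g;
  exact: polygonal_null_homotopic].
Qed.

End SimplyConnected.

(** * Coverings of simply connected complexes *)

Section Sheets.
Variables (k : nat) (Z Y : graph) (f : Z -> Y).
Hypotheses (fP : locally_bijective f) (fK : lifts_loops f k).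
Local Notation W := (Y + set (seq Y))%type.
Local Notation K := (polygonal_simplices Y k).
Implicit Types (x y : Y) (c : seq Y) (sg tau : Y -> Z) (w v : W) (s : seq W).

Definition loop_section c sg : Prop :=
  forall x, x \in c -> f (sg x) = x /\ adj (sg x) (sg (next c x)).

(** The section reads the lift of the loop at [z] by position. Since that lift closes up, the last
    edge of the loop also goes to an edge. *)
Lemma loop_section_ex c z : simple_loop k c -> f z \in c ->
  exists2 sg, sg (f z) = z & loop_section c sg.
Proof.
move=> lc zc; have [/andP[_ ck] _] := lc; have [cc uc] := simple_loop_cycle lc.
have [i q cE] := rot_to zc; set x := f z in zc cE *.
have uq : uniq (x :: q) by rewrite -cE rot_uniq.
have cq : path (@adj Y) x (rcons q x) by have : cycle (@adj Y) (x :: q) by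
  rewrite -cE rot_cycle.
have szq : size (rcons q x) = size c by rewrite size_rcons -(size_rot i c) cE.
have ed : elementary_loop k x (rcons q x).
  split; rewrite ?last_rcons ?szq ?rcons_uniq //.
  by rewrite leq_max ck orbT.
have [pl fl] := lift_path fP cq; have lz := fK ed.
have lE : lift f z (rcons q x) = rcons (lift f z q) z.
  by move: lz; rewrite -cats1 lift_cat last_cat /= => ->; rewrite cats1.
have fq : map f (lift f z q) = q.
  by move: fl; rewrite lE map_rcons => /rcons_inj[].
rewrite lE in pl.
pose sg y := nth z (z :: lift f z q) (index y (x :: q)).
have szl : size (lift f z q) = size q by rewrite size_lift.
exists sg; first by rewrite /sg /= eqxx.
move=> y; rewrite -(mem_rot i) cE => yq.
have yi : (index y (x :: q) < (size q).+1)%N by rewrite -index_mem in yq.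
split.
  rewrite /sg -[RHS](nth_index x yq) -(nth_map z x); last by rewrite /= szl.
  by rewrite /= fq.
have -> : next c y = nth x q (index y (x :: q)).
  by rewrite -(next_rot i uc) cE next_nth yq.
have -> : sg (nth x q (index y (x :: q))) = nth z (lift f z q) (index y (x :: q)).
  move: yi; rewrite ltnS leq_eqVlt => /predU1P[->|yi].
    by rewrite !nth_default ?szl // /sg /= eqxx.
  rewrite /sg -[nth x q _]/(nth x (x :: q) (index y (x :: q)).+1) index_uniq //.
have := pathP z pl (index y (x :: q)); rewrite size_rcons szl => /(_ yi).
have E j : nth z (rcons (lift f z q) z) j = nth z (lift f z q) j.
  rewrite nth_rcons; case: ltnP => // h; rewrite [RHS]nth_default //.
  by case: eqP.
rewrite E /sg; case: (index y (x :: q)) => //= j.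
by rewrite E.
Qed.

Lemma loop_section_uniq c sg tau x y : simple_loop k c ->
  loop_section c sg -> loop_section c tau -> x \in c -> y \in c ->
  sg x = tau x -> sg y = tau y.
Proof.
move=> lc s1 s2 xc yc; have [_ uc] := simple_loop_cycle lc.
have [p fp <-] := loop_arc uc xc yc; elim: p x xc fp => //= t p IH x xc /andP[/eqP <- fp] e.
have nc : next c x \in c by rewrite mem_next.
apply: IH => //; have [_ a1] := s1 x xc; have [_ a2] := s2 x xc.
rewrite -e in a2; apply: (lb_inj fP a1 a2).
by have [-> _] := s1 _ nc; have [-> _] := s2 _ nc.
Qed.

(** A local section is a total map [Y -> Z] of which only the values near the label matter: the lift
    of a vertex, or, for a centre, the lift of the whole loop. Quantifying over all loops of class
    [C] avoids choosing one. *)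
Definition label_section w sg : Prop :=
  match w with
  | inl x => f (sg x) = x
  | inr C => forall c, simple_loop k c -> rotations c = C -> loop_section c sg
  end.

Definition germ w sg tau : Prop :=
  match w with
  | inl x => sg x = tau x
  | inr C => forall c, simple_loop k c -> rotations c = C -> {in c, sg =1 tau}
  end.

Lemma germ_refl w sg : germ w sg sg. Proof. by case: w. Qed.

Lemma germ_sym w sg tau : germ w sg tau -> germ w tau sg.
Proof. by case: w => //= C h c lc cC x xc; rewrite (h c lc cC). Qed.

Lemma germ_trans w sg1 sg2 sg3 : germ w sg1 sg2 -> germ w sg2 sg3 -> germ w sg1 sg3.
Proof.
case: w => [x|C] /=; first by move=> -> ->.
by move=> h1 h2 c lc cC x xc; rewrite (h1 c lc cC) // (h2 c lc cC).
Qed.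

Lemma germ_section w sg tau : germ w sg tau -> label_section w sg -> label_section w tau.
Proof.
case: w => [x|C] /=; first by move=> ->.
move=> h s c lc cC x xc; have [h1 h2] := s c lc cC x xc.
by rewrite -!(h c lc cC) // mem_next.
Qed.

Definition section_on s sg : Prop :=
  (forall w, w \in s -> label_section w sg) /\
  (forall x y, inl x \in s -> inl y \in s -> x != y -> adj (sg x) (sg y)).

Lemma section_on_loop c x sg : simple_loop k c -> x \in c -> loop_section c sg ->
  section_on [:: inr (rotations c); inl x; inl (next c x)] sg.
Proof.
move=> lc xc sc; have nc : next c x \in c by rewrite mem_next.
split=> [w|y z]; rewrite !inE /=.
  case/or3P=> /eqP -> /=; [|by have [] := sc _ xc|by have [] := sc _ nc].
  move=> c' lc' e y yc'; have yc : y \in c by rewrite -(rotations_mem e).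
  have [_ uc'] := simple_loop_cycle lc'.
  by rewrite (rotations_next uc' e); exact: sc.
by case/orP=> /eqP[->] /orP[] /eqP[->]; rewrite ?eqxx // => _; have [_] := sc _ xc;
  rewrite // adj_sym.
Qed.

(** Existence of continuations: over an edge by local bijectivity, over a triangle because the lift
    of its loop closes up. *)
Lemma section_extend s w sg : K s -> w \in s -> label_section w sg ->
  exists2 tau, section_on s tau & germ w tau sg.
Proof.
case=> [[x ->]|[x [y [xy ->]]]|[c [x [lc xc ->]]]].
- rewrite inE => /eqP -> /= h; exists sg => //; split=> [v|y z].
    by rewrite inE => /eqP ->.
  by rewrite !inE => /eqP[->] /eqP[->]; rewrite eqxx.
- have H a b : adj a b -> f (sg a) = a ->
    exists2 tau, section_on [:: inl a; inl b] tau & tau a = sg a.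
    move=> ab ha; pose tau t := if t == b then nb f (sg a) b else sg t.
    have ta : tau a = sg a by rewrite /tau (negbTE (adj_neq ab)).
    have tb : tau b = nb f (sg a) b by rewrite /tau eqxx.
    have [n1 n2] : adj (sg a) (nb f (sg a) b) /\ f (nb f (sg a) b) = b.
      by apply: nbP => //; rewrite ha.
    exists tau => //; split=> [v|t u]; rewrite !inE.
      by case/orP=> /eqP -> /=; rewrite ?ta ?tb.
    by case/orP=> /eqP[->] /orP[] /eqP[->]; rewrite ?eqxx // ta tb // adj_sym.
  rewrite !inE => /orP[] /eqP -> /=; first exact: H.
  rewrite adj_sym in xy; move=> /(H _ _ xy)[tau [t1 t2] te]; exists tau => //.
  have me (v : W) : (v \in [:: inl x; inl y]) = (v \in [:: inl y; inl x]).
    by rewrite !inE orbC.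
  by split=> [v|a b]; rewrite !me; [exact: t1|exact: t2].
- have nc : next c x \in c by rewrite mem_next.
  rewrite !inE => /or3P[] /eqP -> /= h.
  + exists sg; first by apply: section_on_loop => //; exact: h.
    by move=> *.
  + have hx : f (sg x) \in c by rewrite h.
    have [tau te ts] := loop_section_ex lc hx; rewrite h in te.
    by exists tau => //; exact: section_on_loop.
  + have hx : f (sg (next c x)) \in c by rewrite h.
    have [tau te ts] := loop_section_ex lc hx; rewrite h in te.
    by exists tau => //; exact: section_on_loop.
Qed.

(** Uniqueness of continuations: agreement propagates along an edge by local injectivity, hence also
    around a loop and to its centre. *)
Lemma germ_transfer s s' w w' tau tau' : K s -> K s' -> w \in s -> w \in s' ->
  w' \in s -> w' \in s' -> section_on s tau -> section_on s' tau' ->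
  germ w tau tau' -> germ w' tau tau'.
Proof.
move=> Ks Ks' ws ws' w's w's' [h1 h2] [h1' h2'].
case: w ws ws' => [x|C] ws ws'; case: w' w's w's' => [y|C'] w's w's'.
- case: (eqVneq x y) => [<-//|xy] /= e; have a := h2 _ _ ws w's xy.
  have a' := h2' _ _ ws' w's' xy; rewrite -e in a'; apply: (lb_inj fP a a').
  by have := h1 _ w's; have := h1' _ w's'; rewrite /= => -> ->.
- move=> e c lc cC y yc /=; have [|c' [lc' xc' cC']] := @wcom_center k Y x C'.
    by exists s.
  have xc : x \in c by rewrite (rotations_mem (c' := c')) // cC.
  apply: (loop_section_uniq lc (h1 _ w's c lc cC) (h1' _ w's' c lc cC) xc yc e).
- move=> /= e; have [|c [lc yc cC]] := @wcom_center k Y y C.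
    by exists s.
  by apply: e lc cC _ yc.
- by have <- : C = C' by apply: (@wcom_centers k Y); exists s.
Qed.

(** One step of analytic continuation. The maps are compared with [rho] through germs only, as their
    other values carry no information. *)
Definition related w sg v tau : Prop := exists s, exists2 rho, [/\ K s, w \in s & v \in s] &
  [/\ section_on s rho, germ w rho sg & germ v rho tau].

Fixpoint chain w sg (l : seq W) sge : Prop :=
  if l is v :: l' then exists2 sg', related w sg v sg' & chain v sg' l' sge
  else germ w sg sge.

Fixpoint corners w w' (P : seq (W * W)) : Prop :=
  if P is (v, v') :: P' then
    (exists2 s, K s & [/\ w \in s, w' \in s, v \in s & v' \in s]) /\ corners v v' P'
  else True.

(** Homotopy invariance of continuation across one row of squares: the simplex through the corners
    of a square carries a single section, which by [germ_transfer] has the germs already prescribed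
    at the corners. *)
Lemma chain_row w w' P sg sg' sge : chain w sg (unzip1 P) sge -> corners w w' P ->
  related w sg w' sg' -> exists2 sge', chain w' sg' (unzip2 P) sge' &
    related (last w (unzip1 P)) sge (last w' (unzip2 P)) sge'.
Proof.
elim: P w w' sg sg' => [|[v v'] P IH] w w' sg sg' /=.
  move=> e _ [s [rho Ks [sr e1 e2]]]; exists sg'; first exact: germ_refl.
  by exists s, rho => //; split=> //; exact: germ_trans e1 e.
move=> [sg1 r1 ch] [[s Ks [ws w's vs v's]] cP] r2.
have [s1 [rho1 [Ks1 ws1 vs1] [sr1 e1 e1']]] := r1.
have [s2 [rho2 [Ks2 ws2 vs2] [sr2 e2 e2']]] := r2.
have sw : label_section w sg by apply: germ_section e1 _; exact: sr1.1.
have [tau st et] := section_extend Ks ws sw.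
have g1 : germ v tau sg1.
  apply: germ_trans e1'; apply: (germ_transfer Ks Ks1 ws ws1 vs vs1 st sr1).
  exact: germ_trans et (germ_sym e1).
have g2 : germ w' tau sg'.
  apply: germ_trans e2'; apply: (germ_transfer Ks Ks2 ws ws2 w's vs2 st sr2).
  exact: germ_trans et (germ_sym e2).
have [|sge' ch' re] := IH v v' sg1 tau ch cP.
  by exists s, tau => //; split=> //; exact: germ_refl.
exists sge' => //; exists tau => //; exists s, tau => //; split=> //; exact: germ_refl.
Qed.

Lemma chain_iota (L : nat -> W) (S : nat -> Y -> Z) a m :
  (forall i, (i < m)%N -> related (L (a + i)%N) (S (a + i)%N) (L (a + i).+1) (S (a + i).+1)) ->
  chain (L a) (S a) (map L (iota a.+1 m)) (S (a + m)%N).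
Proof.
elim: m a => [|m IH] a h /=; first by rewrite addn0; exact: germ_refl.
exists (S a.+1); first by have := h 0%N isT; rewrite addn0.
rewrite -addSnnS; apply: IH => i im; rewrite addSnnS; exact: h.
Qed.

Lemma related_vertex x sg tau : related (inl x) sg (inl x) tau -> sg x = tau x.
Proof. by move=> [s [rho _ [_ /= <- <-]]]. Qed.

Lemma vertex_related x sg : f (sg x) = x -> related (inl x) sg (inl x) sg.
Proof.
move=> h; exists [:: inl x], sg; first by split; rewrite ?inE //; constructor 1; exists x.
split=> //; split=> [v|y z]; first by rewrite inE => /eqP ->.
by rewrite !inE => /eqP[->] /eqP[->]; rewrite eqxx.
Qed.

Lemma chain_constant x l sg sge : (forall v, v \in l -> v = inl x) ->
  chain (inl x) sg l sge -> sg x = sge x.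
Proof.
elim: l sg => //= v l IH sg h [sg' r ch].
have e : v = inl x by apply: h; rewrite mem_head.
subst v; rewrite (related_vertex r); apply: IH => // v vl; apply: h.
by rewrite inE vl orbT.
Qed.

End Sheets.

(** * Monodromy over a null-homotopic closed walk *)

Section Monodromy.
Variables (R : realType) (k : nat) (Z Y : graph) (f : Z -> Y).
Hypotheses (fP : locally_bijective f) (fK : lifts_loops f k).
Hypothesis hY : k_simply_connected R k Y.
Local Notation W := (Y + set (seq Y))%type.
Local Notation K := (polygonal_simplices Y k).
Local Notation dl := (@delta R W).
Let Ku : forall s, K s -> uniq s := @polygonal_uniq k Y.
Let Kf := @polygonal_locally_finite k Y.
Local Notation related := (related k f).
Local Notation chain := (chain k f).

Lemma delta_gt0 (v w : W) : 0 < dl v w -> w = v.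
Proof. by rewrite /delta; case: eqP => // _; rewrite ltxx. Qed.

(* Monodromy is read off a labelling of a fine grid of the square by vertices of
   the complex whose open stars contain the images of the cells. *)
Lemma grid_monodromy (w : seq Z) (z0 : Z) (M n m : nat) (L : nat -> nat -> W)
    (P : nat -> nat -> W -> R) :
  path (@adj Z) z0 w -> size w = n -> (0 < n)%N -> (0 < m)%N -> M = (n * m)%N ->
  f (last z0 w) = f z0 ->
  (forall i j, valid K (P i j)) ->
  (forall i j, (i < M)%N -> (j < M)%N -> [/\ 0 < P i j (L i j), 0 < P i.+1 j (L i j),
     0 < P i j.+1 (L i j) & 0 < P i.+1 j.+1 (L i j)]) ->
  (forall i, P i M = dl (inl (f z0))) ->
  (forall j, P 0%N j = dl (inl (f z0)) /\ P M j = dl (inl (f z0))) ->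
  (forall i, (i <= M)%N ->
     P i 0%N = pl (dl (inl (f z0))) (map dl (map inl (map f w))) (i%:R / m%:R)) ->
  last z0 w = z0.
Proof.
move=> pw szw n0 m0 ME lw vP PL Ptop Pside Pbot; set y0 := f z0 in lw Ptop Pside Pbot *.
have m0R : 0 < m%:R :> R by rewrite ltr0n.
have M0 : (0 < M)%N by rewrite ME muln_gt0 n0.
pose N := M.-1; have NE : N.+1 = M by rewrite prednK.
have supp i j s : K s -> in_simplex s (P i j) -> forall v, 0 < P i j v -> v \in s.
  by move=> Ks sP v; exact: in_simplex_supp.
(* At the grid point common to four cells the labels of all four have positive coordinate, so the
   simplex carrying that point contains them. *)
have crn i j : (i.+1 < M)%N -> (j.+1 < M)%N -> exists2 s, K s &
    [/\ L i j \in s, L i j.+1 \in s, L i.+1 j \in s & L i.+1 j.+1 \in s].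
  move=> iM jM; have [s Ks sP] := vP i.+1 j.+1; exists s => //.
  have sv := supp _ _ _ Ks sP.
  have [_ _ _ h1] := PL _ _ (ltnW iM) (ltnW jM).
  have [_ h2 _ _] := PL _ _ (ltnW iM) jM.
  have [_ _ h3 _] := PL _ _ iM (ltnW jM).
  have [h4 _ _ _] := PL _ _ iM jM.
  by split; exact: sv.
have L0 j : (j < M)%N -> L 0%N j = inl y0.
  by move=> jM; have [h _ _ _] := PL _ _ M0 jM; apply: delta_gt0; rewrite -(Pside j).1.
have LN j : (j < M)%N -> L N j = inl y0.
  move=> jM; have [|_ h _ _] := PL N j _ jM; first by rewrite -NE.
  by apply: delta_gt0; rewrite -(Pside j).2 -NE.
have Ltop i : (i < M)%N -> L i N = inl y0.
  move=> iM; have [|_ _ h _] := PL i N iM; first by rewrite -NE.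
  by apply: delta_gt0; rewrite -(Ptop i) -NE.
pose row j := map (L ^~ j) (iota 1 N).
pose zn := last z0 w.
(* Continuation along any row leads from [z0] to the far end [zn] of the walk; along the top row,
   where every label is [inl y0], it is constant. *)
suff key j : (j < M)%N -> exists2 sg, sg y0 = z0 &
    exists2 sge, sge y0 = zn & chain (L 0%N j) sg (row j) sge.
  have [|sg s0 [sge se ch]] := key N; first by rewrite -NE.
  rewrite L0 -?NE // in ch; rewrite -/zn -se -s0; apply/esym/(chain_constant _ ch).
  move=> v /mapP[i]; rewrite mem_iota => /andP[_ iN] ->.
  by apply: Ltop; rewrite -NE -add1n.
elim: j => [_|j IH jM]; last first.
  have [sg s0 [sge se ch]] := IH (ltnW jM).
  pose Q := [seq (L i j, L i j.+1) | i <- iota 1 N].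
  have Q1 : unzip1 Q = row j by rewrite /unzip1 -map_comp.
  have Q2 : unzip2 Q = row j.+1 by rewrite /unzip2 -map_comp.
  have cQ : corners k (L 0%N j) (L 0%N j.+1) Q.
    have : forall a b, (a + b < M)%N -> corners k (L a j) (L a j.+1)
        [seq (L i j, L i j.+1) | i <- iota a.+1 b].
      move=> a b; elim: b a => //= b IHb a; rewrite -addSnnS => ab; split; last exact: IHb.
      by apply: crn => //; apply: leq_ltn_trans ab; rewrite leq_addr.
    by apply; rewrite add0n -NE.
  have lQ : last (L 0%N j) (unzip1 Q) = inl y0 /\ last (L 0%N j.+1) (unzip2 Q) = inl y0.
    rewrite Q1 Q2 /row !last_map (_ : last 0%N (iota 1 N) = N).
      by rewrite !LN // ltnW.
    by have := last_rcons 0%N (iota 0 N) N; rewrite -cats1 -(iotaD 0 N 1) addn1.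
  have r0 : related (L 0%N j) sg (L 0%N j.+1) sg.
    by rewrite (L0 j (ltnW jM)) (L0 j.+1 jM); apply: vertex_related; rewrite s0.
  rewrite -Q1 in ch; have [sge' ch' re] := chain_row fP fK ch cQ r0.
  exists sg => //; exists sge'; last by rewrite -Q2.
  by rewrite lQ.1 lQ.2 in re; rewrite -(related_vertex re).
pose zz i := nth z0 (z0 :: w) i; pose x i := f (zz i).
have zadj i : (i < n)%N -> adj (zz i) (zz i.+1).
  by move=> i_n; have := pathP z0 pw i; rewrite szw => /(_ i_n).
have xneq i : (i < n)%N -> x i != x i.+1.
  by move=> /zadj/(lb_adj fP)/adj_neq.
(* The section over the [j]-th edge of the projected walk that follows the walk itself. *)
pose tau j y := if y == x j then zz j else zz j.+1.
have tau0 j : tau j (x j) = zz j by rewrite /tau eqxx.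
have tau1 j : (j < n)%N -> tau j (x j.+1) = zz j.+1.
  by move=> jn; rewrite /tau eq_sym (negbTE (xneq j jn)).
have zn_ : zz n = zn by rewrite /zz /zn (last_nth z0) szw.
have xn : x n = y0 by rewrite /x zn_.
have xE j : (j <= n)%N -> nth (dl (inl y0)) (dl (inl y0) ::
  map dl (map inl (map f w))) j = dl (inl (x j)).
  rewrite -szw; case: j => [|j] jn //=.
  by rewrite -!map_comp (nth_map z0).
have PE i j : (j < n)%N -> (j * m <= i)%N -> (i <= j.+1 * m)%N ->
    P i 0%N = fun v => (1 - (i%:R / m%:R - j%:R)) * dl (inl (x j)) v
                     + (i%:R / m%:R - j%:R) * dl (inl (x j.+1)) v.
  move=> jn ji ij; rewrite Pbot; last first.
    by rewrite (leq_trans ij) // ME leq_mul2r jn orbT.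
  rewrite (@pl_nth _ _ _ _ _ j) ?size_map ?szw //; last 2 first.
  - by rewrite ler_pdivlMr // -natrM ler_nat.
  - by rewrite ler_pdivrMr // -natrM ler_nat.
  rewrite xE; last exact: ltnW.
  by rewrite -[nth _ (map _ _) j]/(nth (dl (inl y0)) (dl (inl y0) ::
    map dl (map inl (map f w))) j.+1) xE.
have PS i j v : (j < n)%N -> (j * m <= i)%N -> (i <= j.+1 * m)%N -> 0 < P i 0%N v ->
    v \in [:: inl (x j); inl (x j.+1)].
  move=> jn ji ij; rewrite (PE i j) // !inE /delta; case: eqP => //= _; case: eqP => //= _.
  by rewrite !mulr0 addr0 ltxx.
have PS1 j v : (j < n)%N -> 0 < P (j.+1 * m)%N 0%N v -> v = inl (x j.+1).
  move=> jn; rewrite (PE _ j) // ?leq_mul2r ?leqnSn ?orbT // natrM mulfK ?gt_eqF //.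
  by rewrite -natr1 addrAC subrr add0r subrr mul0r add0r mul1r => /delta_gt0.
have divb i : (i %/ m * m <= i)%N /\ (i < (i %/ m).+1 * m)%N.
  by split; [exact: leq_trunc_div|exact: ltn_ceil].
have dn i : (i < M)%N -> (i %/ m < n)%N by rewrite ME => h; rewrite ltn_divLR.
have Li i : (i < M)%N -> L i 0%N \in [:: inl (x (i %/ m)%N); inl (x (i %/ m)%N.+1)].
  move=> iM; have [h _ _ _] := PL i 0%N iM M0; have [h1 h2] := divb i.
  by apply: PS h; rewrite ?dn // ltnW.
have ch0 := @chain_iota k Z Y f (fun i => L i 0%N) (fun i => tau (i %/ m)%N) 0 N.
exists (tau (0 %/ m)%N); first by rewrite div0n /tau eqxx.
exists (tau (N %/ m)%N).
  have -> : (N %/ m)%N = n.-1.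
    have nE : n = n.-1.+1 by rewrite prednK.
    apply/eqP; rewrite eqn_leq -ltnS -nE dn -?NE //= leq_divRL // -ltnS NE ME.
    by rewrite {2}nE mulSn -addn1 addnC leq_add2r.
  by have := tau1 n.-1; rewrite prednK // leqnn xn zn_; apply.
rewrite /row; apply: ch0 => i iN; rewrite add0n.
have iM : (i.+1 < M)%N by rewrite -NE ltnS.
have iM' := ltnW iM; have jn := dn _ iM'; have [d1 d2] := divb i.
set j := (i %/ m)%N in jn d1 d2 *.
have [_ hR _ _] := PL i 0%N iM' M0; have [hL _ _ _] := PL i.+1 0%N iM M0.
have mi := Li i iM'; rewrite -/j in mi.
have sec : section_on k f [:: inl (x j); inl (x j.+1)] (tau j).
  have a := zadj j jn; have b := xneq j jn.
  split=> [v|t u]; rewrite !inE.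
    by case/orP=> /eqP -> /=; rewrite ?tau0 ?tau1.
  by case/orP=> /eqP[->] /orP[] /eqP[->]; rewrite ?eqxx // ?tau0 ?tau1 // adj_sym.
have Kj : K [:: inl (x j); inl (x j.+1)].
  by constructor 2; exists (x j), (x j.+1); split=> //; exact: (lb_adj fP (zadj j jn)).
(* Passing from one edge to the next, the grid point is exactly the vertex [x j.+1]; both adjacent
   labels are then this vertex, where [tau j] and [tau j.+1] agree. *)
have [e|ne] := eqVneq (i.+1) (j.+1 * m)%N.
  have e1 : L i 0%N = inl (x j.+1) by apply: (PS1 j) => //; rewrite -e.
  have e2 : L i.+1 0%N = inl (x j.+1) by apply: (PS1 j) => //; rewrite -e.
  have -> : (i.+1 %/ m)%N = j.+1 by rewrite e mulnK.
  rewrite e1 e2; exists [:: inl (x j); inl (x j.+1)], (tau j).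
    by rewrite !inE eqxx orbT.
  split=> //=; rewrite tau0 tau1 //.
have lt : (i.+1 < j.+1 * m)%N by rewrite ltn_neqAle ne d2.
have -> : (i.+1 %/ m)%N = j.
  apply/eqP; rewrite eqn_leq -ltnS ltn_divLR // lt leq_divRL //.
  exact: leqW.
exists [:: inl (x j); inl (x j.+1)], (tau j).
  by split=> //; apply: (PS i.+1) => //; exact: leqW.
by split=> //; exact: germ_refl.
Qed.

Theorem k_simply_connected_covering_injective : injective f.
Proof.
move=> z0 z1 z01; have [w pw lw] := adj_connected z0 z1; rewrite -lw.
case: (posnP (size w)) => [/size0nil ->//|n0]; set n := size w in n0.
have [_ hnull] := hY; pose y0 := f z0.
pose l := map dl (map inl (map f w)).
have szl : size l = n by rewrite !size_map.
have vl_l : vl K (dl (inl y0)) l.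
  by apply: (wl_vl R Ku); apply: path_wl; exact: path_map_lb.
have lastl : last (dl (inl y0)) l = dl (inl y0).
  by rewrite /l last_map (last_map (inl : Y -> W)) last_map lw -z01.
have [||g cg gE] := @realize R W K Ku Kf R (fun s => pl (dl (inl y0)) l (n%:R * s)).
- by move=> v; apply: (@pl_cont _ _ _ _ _ (fun s : R => n%:R * s)); cont.
- by move=> s; exact: vl_pl_valid.
have g0 : bary (g 0) = dl (inl y0).
  by apply/funext => v; rewrite gE mulr0 pl_le0.
have g1 : bary (g 1) = dl (inl y0).
  by apply/funext => v; rewrite gE mulr1 pl_last ?szl // lastl.
have [||H [cH H0 H1 Hs]] := hnull g.
- exact: continuous_subspaceT.
- by apply: realization_ext => v; rewrite g0 g1.
have cG := within_clamp2 cH.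
pose G (z : R * R) : realization R K := H (clamp z.1, clamp z.2).
have [d d0 dP] := @open_star_lebesgue R W K G cG.
have [m m0 md] : exists2 m, (0 < m)%N & m%:R^-1 < d :> R.
  exists (Num.trunc d^-1).+1 => //; rewrite invf_plt ?posrE ?ltr0n //.
  have d1 : 0 <= d^-1 by rewrite invr_ge0 ltW.
  by have /andP[] := truncn_itv d1.
(* A multiple of [n], so that each edge of the walk spans exactly [m] columns of the grid. *)
pose M := (n * m)%N; have M0 : (0 < M)%N by rewrite muln_gt0 n0.
have M0R : 0 < M%:R :> R by rewrite ltr0n.
have Md : M%:R^-1 < d.
  apply: le_lt_trans md; rewrite lef_pV2 ?posrE ?ltr0n // ler_nat.
  by rewrite /M leq_pmull.
pose pt i : R := i%:R / M%:R.
have pt01 i : (i <= M)%N -> 0 <= pt i <= 1.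
  by move=> iM; rewrite divr_ge0 ?ler0n //= ler_pdivrMr // mul1r ler_nat.
have ptS i : pt i - pt i.+1 = - M%:R^-1.
  by rewrite /pt -mulrBl -natr1 opprD addrA subrr sub0r mulN1r.
have dS i : `|pt i - pt i.+1| < d by rewrite ptS normrN ger0_norm // invr_ge0 ltW.
have dd i : `|pt i - pt i| < d by rewrite subrr normr0.
have /choice[L LP] : forall ij : nat * nat, exists v, (ij.1 < M)%N -> (ij.2 < M)%N ->
    forall z' : R * R, `|pt ij.1 - z'.1| < d -> `|pt ij.2 - z'.2| < d -> 0 < G z' v.
  move=> [i j] /=; have [iM|iM] := ltnP i M; last by exists (inl y0).
  have [jM|jM] := ltnP j M; last by exists (inl y0).
  by have [v hv] := dP (pt i, pt j) (pt01 _ (ltnW iM)) (pt01 _ (ltnW jM)); exists v.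
have lz : f (last z0 w) = f z0 by rewrite lw z01.
have := @grid_monodromy w z0 M n m (fun i j => L (i, j)) (fun i j => bary (G (pt i, pt j)))
  pw erefl n0 m0 erefl lz.
have ptM : pt M = 1 by rewrite /pt divff // gt_eqF.
have pt0 : pt 0%N = 0 by rewrite /pt mul0r.
move=> ->//.
- by move=> i j; exact: baryP.
- by move=> i j iM jM; split; apply: (LP (i, j)).
- move=> i; rewrite /G /= ptM clamp1 H1 //; exact: clamp_itv.
- move=> j; have [h0 h1] := Hs (clamp (pt j)) (clamp_itv _).
  by rewrite /G /= pt0 ptM clamp0 clamp1 h0 h1.
- move=> i iM; rewrite /G /= pt0 clamp0 H0; last exact: clamp_itv.
  apply/funext => v; rewrite gE clamp_id ?pt01 //; congr (pl _ _ _ _).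
  by rewrite /pt natrM; field; rewrite !gt_eqF // ltr0n.
Qed.

End Monodromy.

(** * The metric graph *)

Section MetricGraph.
Variables (R : realType) (X : graph).
Implicit Types (x y u v a b : X) (p q z : point R X) (A B : set (point R X)).
Local Notation vx := (@vertex_point R X).
Local Notation GS := (graph_simplices X).

Lemma graph_simplices_uniq s : GS s -> uniq s.
Proof.
by case=> [[x ->]|[x [y [xy ->]]]] //=; rewrite inE (adj_neq xy).
Qed.

Lemma graph_simplex2 x y : adj x y -> GS [:: x; y].
Proof. by move=> xy; right; exists x, y. Qed.

Lemma bary_ge0 p x : 0 <= p x.
Proof. by have [s _ [h _ _]] := baryP p. Qed.

Lemma edge_sum x y p : in_simplex [:: x; y] p -> p x + p y = 1.
Proof. by move=> [_ _]; rewrite !big_cons big_nil addr0. Qed.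

Lemma edge_out x y p w : in_simplex [:: x; y] p -> w != x -> w != y -> p w = 0.
Proof. by move=> [_ h _] /negbTE wx /negbTE wy; apply: h; rewrite !inE wx wy. Qed.

Lemma edge_sym x y p : in_simplex [:: x; y] p -> in_simplex [:: y; x] p.
Proof.
move=> [h1 h2 h3]; split=> // [w ws|].
  by apply: h2; move: ws; rewrite !inE orbC.
by rewrite -h3 !big_cons !big_nil !addr0 addrC.
Qed.

Lemma point_edge p : (exists x, p = vx x) \/
  (exists x y, [/\ adj x y, in_simplex [:: x; y] p, 0 < p x & 0 < p y]).
Proof.
have pv x : (forall w, w \notin [:: x] -> p w = 0) -> p x = 1 -> p = vx x.
  move=> h px; apply: realization_ext => w /=; case: eqP => [->//|/eqP wx].
  by apply: h; rewrite inE.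
have [s Ks sp] := baryP p; case: Ks => [[x e]|[x [y [xy e]]]]; subst s.
  left; exists x; case: sp => [_ h]; rewrite big_seq1 => px; exact: pv.
have e := edge_sum sp; have px := bary_ge0 p x; have py := bary_ge0 p y.
have [x0|x0] := eqVneq (p x) 0.
  left; exists y; apply: pv; last by rewrite x0 add0r in e.
  move=> w; rewrite inE => wy; have [->//|wx] := eqVneq w x.
  exact: edge_out sp wx wy.
have [y0|y0] := eqVneq (p y) 0.
  left; exists x; apply: pv; last by rewrite y0 addr0 in e.
  move=> w; rewrite inE => wx; have [->//|wy] := eqVneq w y.
  exact: edge_out sp wx wy.
by right; exists x, y; split=> //; rewrite lt_neqAle eq_sym ?x0 ?y0.
Qed.

Lemma vertex_self x : vx x x = 1. Proof. by rewrite /= eqxx. Qed.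

Lemma vertex_pos x a : 0 < vx x a -> a = x.
Proof. by rewrite /=; case: eqP => // _; rewrite ltxx. Qed.

Lemma vertex_inj : injective vx.
Proof.
by move=> x y e; apply: vertex_pos; rewrite -e vertex_self ltr01.
Qed.

Lemma bary_pos p : exists x, 0 < p x.
Proof. by have [s _ sp] := baryP p; have [x _ px] := in_simplex_ex sp; exists x. Qed.

Lemma edge_point x y (t : R) : adj x y -> 0 <= t <= 1 ->
  exists p : point R X, [/\ in_simplex [:: x; y] p, p x = 1 - t & p y = t].
Proof.
move=> xy t01; have us : uniq [:: x; y] by rewrite /= inE (adj_neq xy).
have h := in_simplex_convex t01 (in_simplex_delta R us (mem_head _ _))
  (in_simplex_delta R us (_ : y \in [:: x; y])).
have {}h := h ltac:(by rewrite !inE eqxx orbT).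
have vp : exists2 s, GS s & in_simplex s (fun w => (1 - t) * delta R x w + t * delta R y w).
  by exists [:: x; y] => //; exact: graph_simplex2.
exists (Realization vp); split=> //=; rewrite /delta eqxx.
  by rewrite (negbTE (adj_neq xy)) mulr1 mulr0 addr0.
by rewrite eq_sym (negbTE (adj_neq xy)) mulr1 mulr0 add0r.
Qed.

Lemma edge_ext x y p q : in_simplex [:: x; y] p -> in_simplex [:: x; y] q ->
  p x = q x -> p = q.
Proof.
move=> px qx e; apply: realization_ext => w.
have [->//|wx] := eqVneq w x; have [->|wy] := eqVneq w y.
  by apply: (addrI (p x)); rewrite {2}e !edge_sum.
by rewrite !(edge_out _ wx wy).
Qed.

Lemma bary_eq1 p x : p x = 1 -> p = vx x.
Proof.
have [[y ->]|[y [z [yz yzp py pz]]]] := point_edge p.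
  by move=> h; congr vx; apply/esym/vertex_pos; rewrite h ltr01.
move=> px; have e := edge_sum yzp; have [xy|xy] := eqVneq x y.
  by subst x; exfalso; lra.
have [xz|xz] := eqVneq x z; first by subst x; exfalso; lra.
by move/eqP: px; rewrite (edge_out yzp xy xz) eq_sym oner_eq0.
Qed.

Lemma vertex_in_edge x y : adj x y -> in_simplex [:: x; y] (vx x).
Proof.
move=> xy; have us : uniq [:: x; y] by rewrite /= inE (adj_neq xy).
exact: (in_simplex_delta R us (mem_head _ _)).
Qed.

Lemma pos2_in_edge p x y : x != y -> 0 < p x -> 0 < p y ->
  adj x y /\ in_simplex [:: x; y] p.
Proof.
move=> xy px py; have [[z e]|[u [v [uv puv _ _]]]] := point_edge p.
  by rewrite e in px py; rewrite (vertex_pos px) (vertex_pos py) eqxx in xy.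
have mx := in_simplex_supp puv px; have my := in_simplex_supp puv py.
move: mx my xy; rewrite !inE => /orP[] /eqP -> /orP[] /eqP ->; rewrite ?eqxx // => _.
by rewrite adj_sym; split=> //; exact: edge_sym.
Qed.

Lemma pos_in_edge p x : 0 < p x -> p = vx x \/ exists2 y, adj x y & in_simplex [:: x; y] p.
Proof.
move=> px; have [[z e]|[u [v [uv puv _ _]]]] := point_edge p.
  by rewrite e in px *; rewrite (vertex_pos px); left.
have := in_simplex_supp puv px; rewrite !inE => /orP[] /eqP ->.
  by right; exists v.
by right; exists u; rewrite 1?adj_sym //; exact: edge_sym.
Qed.

Lemma edge_convex x y p q (t : R) : adj x y -> in_simplex [:: x; y] p ->
  in_simplex [:: x; y] q -> 0 <= t <= 1 ->
  exists2 z : point R X, in_simplex [:: x; y] z & forall w, z w = (1 - t) * p w + t * q w.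
Proof.
move=> xy px qx t01; have h := in_simplex_convex t01 px qx.
have vp : exists2 s, GS s & in_simplex s (fun w => (1 - t) * p w + t * q w).
  by exists [:: x; y] => //; exact: graph_simplex2.
by exists (Realization vp).
Qed.

Lemma edge_dist x y p q : in_simplex [:: x; y] p -> in_simplex [:: x; y] q ->
  `|p x - q x| = `|p y - q y|.
Proof.
move=> /edge_sum e /edge_sum e'.
by rewrite (_ : p x - q x = - (p y - q y)) ?normrN //; lra.
Qed.

(** ** Piecewise linear paths *)

Lemma pl_path_ge0 A p q l : pl_path A p q l -> 0 <= l.
Proof. by elim=> *; rewrite ?lexx ?addr_ge0. Qed.

Lemma pl_path_in A p q l : pl_path A p q l -> A p /\ A q.
Proof.
elim=> // {}p {}q r x y {}l xy px qx seg _ [_ Ar]; split=> //.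
apply: (seg 0) => [|w]; first by rewrite lexx ler01.
by rewrite subr0 mul1r mul0r addr0.
Qed.

Lemma pl_path_trans A p q r l l' :
  pl_path A p q l -> pl_path A q r l' -> pl_path A p r (l + l').
Proof.
elim=> [{}p _|{}p {}q q' x y {}l xy px qx seg _ IH] h; first by rewrite add0r.
by rewrite -addrA; exact: (pl_path_cons xy px qx seg (IH h)).
Qed.

Lemma pl_path_edge A p q x y : adj x y -> in_simplex [:: x; y] p ->
  in_simplex [:: x; y] q ->
  (forall (t : R) z, 0 <= t <= 1 -> (forall w, z w = (1 - t) * p w + t * q w) -> A z) ->
  pl_path A p q `|p x - q x|.
Proof.
move=> xy px qx seg; rewrite -[`|_|]addr0; apply: (pl_path_cons xy px qx seg).
apply: pl_path_nil; apply: (seg 1) => [|w]; first by rewrite lexx ler01.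
by rewrite subrr mul1r mul0r add0r.
Qed.

Lemma pl_path_sym A p q l : pl_path A p q l -> pl_path A q p l.
Proof.
elim=> [{}p Ap|{}p {}q r x y {}l xy px qx seg _ IH]; first exact: pl_path_nil.
rewrite addrC distrC; apply: pl_path_trans IH _; apply: (pl_path_edge xy) => // t z t01 zE.
apply: (seg (1 - t)) => [|w]; first by lra.
by rewrite zE; ring.
Qed.

Lemma pl_path_sub A B p q l : A `<=` B -> pl_path A p q l -> pl_path B p q l.
Proof.
move=> AB; elim=> [{}p Ap|{}p {}q r x y {}l xy px qx seg _ IH].
  by apply: pl_path_nil; exact: AB.
by apply: (pl_path_cons xy px qx) => // t z t01 zE; apply: AB; exact: seg zE.
Qed.

(** Such functions bound the intrinsic metric of any subset from below. The ones in [lip_bary],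
    [lip_edge] and [lip_tents] locate points near a vertex or an edge. *)
Definition lipschitz (h : point R X -> R) := forall x y p q, adj x y ->
  in_simplex [:: x; y] p -> in_simplex [:: x; y] q -> `|h p - h q| <= `|p x - q x|.

Lemma pl_path_lip h A p q l : lipschitz h -> pl_path A p q l -> `|h p - h q| <= l.
Proof.
move=> lh; elim=> [{}p Ap|{}p {}q r x y {}l xy px qx seg _ IH].
  by rewrite subrr normr0.
rewrite (_ : h p - h r = (h p - h q) + (h q - h r)); last by ring.
by rewrite (le_trans (ler_normD _ _)) // lerD //; exact: (lh x y).
Qed.

(** ** The intrinsic metric *)

Lemma geodist_le A p q l : pl_path A p q l -> geodist A p q <= l.
Proof. by move=> h; apply: ge_inf => //; exists 0 => l' /pl_path_ge0. Qed.

Lemma geodist_ge A p q l c : pl_path A p q l ->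
  (forall l, pl_path A p q l -> c <= l) -> c <= geodist A p q.
Proof. by move=> h hc; apply: lb_le_inf => //; exists l. Qed.

Lemma geodist_sym A p q : geodist A p q = geodist A q p.
Proof.
by congr inf; apply/seteqP; split=> l /=; exact: pl_path_sym.
Qed.

Definition pconnected A := forall p q, A p -> A q -> exists l, pl_path A p q l.

Definition econvex A := forall x y p q, adj x y -> in_simplex [:: x; y] p ->
  in_simplex [:: x; y] q -> A p -> A q ->
  forall (t : R) z, 0 <= t <= 1 -> (forall w, z w = (1 - t) * p w + t * q w) -> A z.

(** Connectedness makes the infimum a genuine distance; containing the segment between two of its
    points on an edge makes that distance the length along the edge. *)
Definition good A := pconnected A /\ econvex A.

Lemma geodist_triangle A p q r : pconnected A -> A p -> A q -> A r ->
  geodist A p r <= geodist A p q + geodist A q r.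
Proof.
move=> pA Ap Aq Ar; have [l1 h1] := pA p q Ap Aq; have [l2 h2] := pA q r Aq Ar.
rewrite -lerBlDr; apply: geodist_ge h1 _ => l h; rewrite lerBlDr -lerBlDl.
by apply: geodist_ge h2 _ => l' h'; rewrite lerBlDl geodist_le //; exact: pl_path_trans h'.
Qed.

Lemma geodistxx A p : A p -> geodist A p p = 0.
Proof.
move=> Ap; apply/eqP; rewrite eq_le; apply/andP; split.
  by apply: geodist_le; exact: pl_path_nil.
apply: (@geodist_ge _ _ _ 0); first exact: pl_path_nil.
by move=> l /pl_path_ge0.
Qed.

Lemma lip_geodist h A p q : lipschitz h -> pconnected A -> A p -> A q ->
  `|h p - h q| <= geodist A p q.
Proof.
move=> lh pA Ap Aq; have [l hl] := pA p q Ap Aq.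
by apply: geodist_ge hl _ => l'; exact: pl_path_lip.
Qed.

Lemma lip_bary v : lipschitz (fun p => p v).
Proof.
move=> x y p q xy px qx; have [->|vx_] := eqVneq v x; first by [].
have [->|vy] := eqVneq v y; first by rewrite (edge_dist px qx).
by rewrite !(edge_out _ vx_ vy) // subrr normr0.
Qed.

(** On the edge [u b] the function is the distance to the nearer end, on another edge at [u] or [b]
    minus the distance to that end, and [-1] elsewhere. A nonnegative value thus detects the closed
    edge. *)
Lemma lip_edge u b : adj u b -> lipschitz (fun p => p u + p b - 1 + Num.min (p u) (p b)).
Proof.
move=> ub.
suff H x y p q : adj x y -> in_simplex [:: x; y] p -> in_simplex [:: x; y] q -> y != u ->
   `|p u + p b - 1 + Num.min (p u) (p b) - (q u + q b - 1 + Num.min (q u) (q b))| <=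
     `|p x - q x|.
  move=> x y p q xy px qx; have [yu|] := eqVneq y u; last exact: H.
  rewrite (edge_dist px qx); apply: (H y x) => //; rewrite 1?adj_sym //; try exact: edge_sym.
  by rewrite -yu; exact: adj_neq.
move=> xy px qx yu; have ep := edge_sum px; have eq_ := edge_sum qx.
have [p1 p2 q1 q2] := And4 (bary_ge0 p x) (bary_ge0 p y) (bary_ge0 q x) (bary_ge0 q y).
have nbu := adj_neq ub.
have lb := lip_bary b xy px qx; have lu := lip_bary u xy px qx.
have h1 := ler_norm (p x - q x); have h2 := ler_norm (q x - p x); rewrite distrC in h2.
have [ux|ux] := eqVneq u x; last first.
  have pu : p u = 0 by apply: (edge_out px) => //; rewrite eq_sym.
  have qu : q u = 0 by apply: (edge_out qx) => //; rewrite eq_sym.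
  rewrite pu qu !min_l ?bary_ge0 // (_ : _ - _ = p b - q b) //; ring.
subst x; have [by_|by_] := eqVneq b y; last first.
  have pb : p b = 0 by apply: (edge_out px) => //; rewrite eq_sym.
  have qb : q b = 0 by apply: (edge_out qx) => //; rewrite eq_sym.
  rewrite pb qb !min_r ?bary_ge0 // (_ : _ - _ = p u - q u) //; ring.
subst y; rewrite ler_norml; apply/andP.
by have [hp|hp] := leP (p u) (p b); have [hq|hq] := leP (q u) (q b); split; lra.
Qed.

Definition tent v a p : R := Num.min (p v) (p a).

(** Near [v] the difference is the distance to [v] on the edge to [a], and minus that distance on
    the edge to [b]. It shows that points at distance [e <= 1/2] from [v] on the two edges are at
    least [2 e] apart. *)
Lemma lip_tents v a b : a != b -> adj v a -> adj v b ->
  lipschitz (fun p => tent v a p - tent v b p).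
Proof.
move=> ab va vb.
have T0 c x y p : in_simplex [:: x; y] p -> (v \notin [:: x; y]) || (c \notin [:: x; y]) ->
    tent v c p = 0.
  move=> [_ h _] /orP[] /h e; rewrite /tent e.
    by rewrite min_l ?bary_ge0.
  by rewrite min_r ?bary_ge0.
have T1 c p q : adj v c -> in_simplex [:: v; c] p -> in_simplex [:: v; c] q ->
    `|tent v c p - tent v c q| <= `|p v - q v|.
  move=> vc px qx; have ep := edge_sum px; have eq_ := edge_sum qx.
  have h1 := ler_norm (p v - q v); have h2 := ler_norm (q v - p v); rewrite distrC in h2.
  rewrite ler_norml; apply/andP; rewrite /tent.
  by have [hp|hp] := leP (p v) (p c); have [hq|hq] := leP (q v) (q c); split; lra.
suff H y p q : adj v y -> in_simplex [:: v; y] p -> in_simplex [:: v; y] q ->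
   `|tent v a p - tent v b p - (tent v a q - tent v b q)| <= `|p v - q v|.
  move=> x y p q xy px qx; have [vx_|vx_] := eqVneq v x; first by subst x;
    exact: (H _ _ _ xy px qx).
  have [vy|vy] := eqVneq v y.
    by subst y; rewrite (edge_dist px qx); apply: (H x _ _ _ (edge_sym px) (edge_sym qx));
      rewrite adj_sym.
  by rewrite !(T0 _ x y) ?subrr ?normr0 // !inE (negbTE vx_) (negbTE vy).
move=> vy px qx; have [ya|ya] := eqVneq y a.
  subst y; rewrite (T0 b v a p) // ?(T0 b v a q) //; last 2 first.
  - by rewrite !inE (eq_sym b a) (negbTE ab) (eq_sym b v) (negbTE (adj_neq vb)) /= orbT.
  - by rewrite !inE (eq_sym b a) (negbTE ab) (eq_sym b v) (negbTE (adj_neq vb)) /= orbT.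
  by rewrite !subr0; exact: T1.
have na (r : point R X) : in_simplex [:: v; y] r -> tent v a r = 0.
  move=> rx; apply: (T0 _ v y) => //.
  by rewrite !inE (eq_sym a v) (negbTE (adj_neq va)) (eq_sym a y) (negbTE ya) /= orbT.
rewrite !na // !sub0r -opprD normrN; have [yb|yb] := eqVneq y b; first by subst y; exact: T1.
rewrite !(T0 b v y) ?subrr ?normr0 //.
  by rewrite !inE (eq_sym b v) (negbTE (adj_neq vb)) (eq_sym b y) (negbTE yb) /= orbT.
by rewrite !inE (eq_sym b v) (negbTE (adj_neq vb)) (eq_sym b y) (negbTE yb) /= orbT.
Qed.

Lemma geodist_edge A x y p q : good A -> adj x y -> in_simplex [:: x; y] p ->
  in_simplex [:: x; y] q -> A p -> A q -> geodist A p q = `|p x - q x|.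
Proof.
move=> [pA cA] xy px qx Ap Aq; apply/eqP; rewrite eq_le.
rewrite (lip_geodist (lip_bary x)) // andbT; apply: geodist_le.
apply: (@pl_path_edge A p q x y xy px qx). exact: (cA x y p q xy px qx Ap Aq).
Qed.

(** ** Balls *)

(** [(dist x a)%:R + (1 - p a)] is the length of a route from [x] to [p] through the vertex [a].
    Along a path of length [l], the best route grows by at most [l]. *)
Lemma pl_path_dist A p q l x a : pl_path A p q l -> 0 < p a ->
  exists2 b, 0 < q b & (dist x b)%:R + (1 - q b) <= (dist x a)%:R + (1 - p a) + l.
Proof.
move=> h; elim: h a => [{}p Ap|{}p {}q r u v {}l uv pu qu seg _ IH] a pa.
  by exists a; rewrite // addr0.
have h1 := ler_norm (p u - q u); have h2 := ler_norm (q u - p u); rewrite distrC in h2.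
have ep := edge_sum pu; have eq_ := edge_sum qu.
have [p1 p2 q1 q2] := And4 (bary_ge0 p u) (bary_ge0 p v) (bary_ge0 q u) (bary_ge0 q v).
have duv : (dist x v)%:R <= (dist x u)%:R + 1 :> R.
  by rewrite natr1 ler_nat dist_adj_le.
have dvu : (dist x u)%:R <= (dist x v)%:R + 1 :> R.
  by rewrite natr1 ler_nat dist_adj_le // adj_sym.
have := in_simplex_supp pu pa; rewrite !inE => /orP[] /eqP e; subst a.
  have [q0|q0] := ltP 0 (q u).
    by have [b rb hb] := IH u q0; exists b => //; lra.
  have [|b rb hb] := IH v; first by lra.
  by exists b => //; lra.
have [q0|q0] := ltP 0 (q v).
  by have [b rb hb] := IH v q0; exists b => //; lra.
have [|b rb hb] := IH u; first by lra.
by exists b => //; lra.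
Qed.

End MetricGraph.

(** * Metric balls in combinatorial terms *)

Section Balls.
Variables (R : realType) (X : graph).
Implicit Types (x y u v a b : X) (p q z : point R X) (A B : set (point R X)).
Local Notation vx := (@vertex_point R X).

Definition near_ball x (r : R) : set (point R X) :=
  [set p | exists2 a, 0 < p a & (dist x a)%:R + (1 - p a) <= r].

Lemma bary_le1 p x : p x <= 1.
Proof.
have [->|/eqP h] := eqVneq (p x) 0; first exact: ler01.
have [->|[y xy pxy]] : p = vx x \/ exists2 y, adj x y & in_simplex [:: x; y] p.
- by apply: pos_in_edge; rewrite lt_neqAle eq_sym bary_ge0 andbT; apply/eqP.
- by rewrite vertex_self.
- by rewrite -(edge_sum pxy) lerDl bary_ge0.
Qed.

Lemma near_ball_mono x r r' : r <= r' -> near_ball x r `<=` near_ball x r'.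
Proof. by move=> rr p [a pa h]; exists a => //; exact: le_trans rr. Qed.

Lemma pl_path_vertex_ball x a :
  pl_path (near_ball x (dist x a)%:R) (vx x) (vx a) (dist x a)%:R.
Proof.
have [n] : exists n, dist x a = n by exists (dist x a).
elim: n a => [|n IH] a dn; rewrite dn.
  rewrite (dist0_eq dn); apply: pl_path_nil; exists a; first by rewrite vertex_self ltr01.
  by rewrite vertex_self distxx subrr addr0.
have [b ba db] := dist_pred dn; have := IH b db; rewrite db => h.
rewrite -natr1; apply: (@pl_path_trans _ _ _ _ (vx b)).
  by apply: pl_path_sub h; apply: near_ball_mono; lra.
have e1 : `|vx b b - vx a b| = 1.
  by rewrite vertex_self /= (negbTE (adj_neq ba)) subr0 normr1.
rewrite -[X in pl_path _ _ _ X]e1.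
apply: (pl_path_edge ba (vertex_in_edge R ba)).
  by apply: edge_sym; apply: vertex_in_edge; rewrite adj_sym.
move=> t z /andP[t0 t1] zE; have zb := zE b; have za := zE a.
have vab : vx a b = 0 by rewrite /= (negbTE (adj_neq ba)).
have vba : vx b a = 0 by rewrite /= eq_sym (negbTE (adj_neq ba)).
rewrite vertex_self vab in zb; rewrite vertex_self vba in za.
have [b0|b0] := ltP 0 (z b).
  exists b => //; rewrite db; lra.
by exists a; rewrite ?dn -?natr1; lra.
Qed.

Lemma pl_path_near_ball x r p a : 0 < p a -> (dist x a)%:R + (1 - p a) <= r ->
  pl_path (near_ball x r) (vx x) p ((dist x a)%:R + (1 - p a)).
Proof.
move=> pa hr; have pa1 := bary_le1 p a.
apply: (@pl_path_trans _ _ _ _ (vx a)).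
  by apply: pl_path_sub (pl_path_vertex_ball x a); apply: near_ball_mono; lra.
have [e|[y ay pay]] := pos_in_edge pa.
  rewrite e vertex_self subrr; apply: pl_path_nil.
  exists a; first by rewrite vertex_self ltr01.
  by rewrite vertex_self; rewrite e vertex_self in hr; lra.
have e1 : `|vx a a - p a| = 1 - p a by rewrite vertex_self ger0_norm //; lra.
rewrite -[X in pl_path _ _ _ X]e1.
apply: (pl_path_edge ay (vertex_in_edge R ay) pay) => t z /andP[t0 t1] zE.
by exists a; rewrite zE vertex_self; nra.
Qed.

Lemma pconnectedT : pconnected [set: point R X].
Proof.
move=> p q _ _; have [a pa] := bary_pos p; have [b qb] := bary_pos q.
have h1 := @pl_path_near_ball a _ p a pa (lexx _).
have h2 := @pl_path_near_ball a _ q b qb (lexx _).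
exists ((dist a a)%:R + (1 - p a) + ((dist a b)%:R + (1 - q b))).
apply: (@pl_path_trans _ _ _ _ (vx a)).
  by apply: pl_path_sym; exact: pl_path_sub h1.
exact: pl_path_sub h2.
Qed.

Lemma econvexT : econvex [set: point R X]. Proof. by []. Qed.

Lemma goodT : good [set: point R X].
Proof. by split; [exact: pconnectedT|exact: econvexT]. Qed.

Lemma geodist_vertex_near A x p r : pconnected A -> A (vx x) -> A p ->
  geodist A (vx x) p <= r -> near_ball x r p.
Proof.
move=> pA Ax Ap hr; apply: contrapT => hn.
have {}hn a : 0 < p a -> r < (dist x a)%:R + (1 - p a).
  by move=> pa; rewrite ltNge; apply/negP => h; apply: hn; exists a.
(* The distance is an infimum, so strict inequalities for each vertex of the support must be turned
   into a uniform gap; the support has at most two vertices. *)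
have [c rc hc] : exists2 c, r < c & forall a, 0 < p a -> c <= (dist x a)%:R + (1 - p a).
  have [[y e]|[y [z [yz pyz py pz]]]] := point_edge p.
    exists ((dist x y)%:R + (1 - p y)); first by apply: hn; rewrite e vertex_self ltr01.
    by move=> a; rewrite {1}e => /vertex_pos ->.
  exists (Num.min ((dist x y)%:R + (1 - p y)) ((dist x z)%:R + (1 - p z))).
    by rewrite lt_min !hn.
  move=> a pa; have := in_simplex_supp pyz pa; rewrite !inE => /orP[] /eqP ->.
    by rewrite ge_min lexx.
  by rewrite ge_min lexx orbT.
have [l hl] := pA _ _ Ax Ap; have : c <= geodist A (vx x) p.
  apply: geodist_ge hl _ => l' /(pl_path_dist x (a := x)).
  rewrite vertex_self distxx subrr !add0r => /(_ ltr01)[b pb]; apply: le_trans.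
  exact: hc.
by rewrite leNgt (le_lt_trans hr rc).
Qed.

Lemma gballE x r : gball x r = near_ball x r.
Proof.
apply/seteqP; split=> p; first exact: (geodist_vertex_near pconnectedT).
move=> [a pa h]; apply: le_trans h; apply: geodist_le.
exact: pl_path_sub (pl_path_near_ball pa (lexx _)).
Qed.

Lemma gball_vertex x v n : gball x (n%:R + 2^-1) (vx v) <-> (dist x v <= n)%N.
Proof.
rewrite gballE; split=> [[a /vertex_pos -> ]|dn].
  rewrite vertex_self subrr addr0 => h.
  by rewrite -ltnS -(ltr_nat R) -natr1; lra.
exists v; rewrite vertex_self ?ltr01 // subrr addr0.
have : (dist x v)%:R <= n%:R :> R by rewrite ler_nat.
by lra.
Qed.

Lemma geodist_gball_le x r p : gball x r p -> geodist (gball x r) (vx x) p <= r.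
Proof.
rewrite gballE => -[a pa h]; apply: le_trans (h); apply: geodist_le.
exact: pl_path_near_ball.
Qed.

Lemma pconnected_gball x (r : R) : pconnected (gball x r).
Proof.
rewrite gballE => p q [a pa ha] [b qb hb].
have h1 := pl_path_near_ball pa ha; have h2 := pl_path_near_ball qb hb.
by exists ((dist x a)%:R + (1 - p a) + ((dist x b)%:R + (1 - q b)));
  apply: pl_path_trans (pl_path_sym h1) h2.
Qed.

(** The half matters: an edge joining two vertices at distance [n] lies in this ball entirely,
    whereas the ball of radius [n] contains its ends but nothing in between. *)
Lemma econvex_gball x n : econvex (gball x (n%:R + 2^-1 : R)).
Proof.
rewrite gballE => u v p q uv pu qu [a pa ha] [b qb hb] t z /andP[t0 t1] zE.
have [p1 p2 q1 q2] := And4 (bary_ge0 p u) (bary_ge0 p v) (bary_ge0 q u) (bary_ge0 q v).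
have ep := edge_sum pu; have eq_ := edge_sum qu.
have zu := zE u; have zv := zE v.
have lt0 d : d%:R <= n%:R + 2^-1 :> R -> d%:R <= n%:R :> R.
  by move=> h; rewrite ler_nat -ltnS -(ltr_nat R) -natr1; lra.
have same c : 0 < p c -> 0 < q c -> (dist x c)%:R + (1 - p c) <= n%:R + 2^-1 ->
    (dist x c)%:R + (1 - q c) <= n%:R + 2^-1 -> near_ball x (n%:R + 2^-1) z.
  by move=> pc qc hp hq; exists c; rewrite zE; nra.
have cross : (dist x u)%:R <= n%:R + 2^-1 :> R -> (dist x v)%:R <= n%:R + 2^-1 :> R ->
    near_ball x (n%:R + 2^-1) z.
  move=> /lt0 du /lt0 dv; have zs : z u + z v = 1 by nra.
  have [h|h] := leP 2^-1 (z u); first by exists u; lra.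
  by exists v; lra.
have := in_simplex_supp pu pa; have := in_simplex_supp qu qb.
rewrite !inE => /orP[] /eqP e /orP[] /eqP e'; subst a b.
- exact: (same u).
- by apply: cross; lra.
- by apply: cross; lra.
- exact: (same v).
Qed.

Lemma good_gball x n : good (gball x (n%:R + 2^-1 : R)).
Proof. by split; [exact: pconnected_gball|exact: econvex_gball]. Qed.

Lemma half_edge_in_ball x v v' n (m : point R X) : (dist x v <= n)%N -> adj v v' ->
  in_simplex [:: v; v'] m -> 2^-1 <= m v -> gball x (n%:R + 2^-1) m.
Proof.
move=> dn vv mv mh; rewrite gballE; exists v; first by lra.
have : (dist x v)%:R <= n%:R :> R by rewrite ler_nat.
by lra.
Qed.

End Balls.

(** * Isometries *)

Lemma no_three_points (R : realType) (z a b c e : R) : 0 < e ->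
  `|z - a| = e -> `|z - b| = e -> `|z - c| = e ->
  2 * e <= `|a - b| -> 2 * e <= `|a - c| -> 2 * e <= `|b - c| -> False.
Proof.
move=> e0 ha hb hc.
have sgn t : `|z - t| = e -> t = z - e \/ t = z + e.
  by have [h|h] := leP 0 (z - t); [rewrite ger0_norm|rewrite ltr0_norm] => // <-;
    [left|right]; ring.
have xx t : 2 * e <= `|t - t| -> False by rewrite subrr normr0; lra.
have [->|->] := sgn _ ha; have [->|->] := sgn _ hb; have [->|->] := sgn _ hc;
  by [move=> /xx|move=> _ /xx|move=> _ _ /xx].
Qed.

Section Isometries.
Variables (R : realType) (X Y : graph).
Variables (A : set (point R X)) (B : set (point R Y)) (f : point R X -> point R Y).
Local Notation vx := (@vertex_point R _).

Lemma isometry_inv : isometry A B f -> exists g, [/\ isometry B A g,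
  forall p, A p -> g (f p) = p & forall q, B q -> f (g q) = q].
Proof.
move=> [[fAB fI fS] fD].
have /choice[g gP] : forall q, exists p, B q -> A p /\ f p = q.
  move=> q; have [Bq|nBq] := pselect (B q).
    by have [p Ap <-] := fS q Bq; exists p.
  have [x] := vertex_inh X; exists (vx x) => /nBq //.
have gf p : A p -> g (f p) = p.
  by move=> Ap; have [Ag e] := gP _ (fAB _ Ap); apply: fI; rewrite ?inE.
have fg q : B q -> f (g q) = q by move=> /gP[].
exists g; split=> //; split; first split.
- by move=> q /gP[].
- by move=> q q'; rewrite !inE => Bq Bq' e; rewrite -(fg q) // e fg.
- by move=> p Ap; exists (f p); [exact: fAB|exact: gf].
- by move=> q q' Bq Bq'; rewrite -fD ?fg //; [case: (gP q Bq)|case: (gP q' Bq')].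
Qed.

Hypotheses (gA : good A) (gB : good B) (fP : isometry A B f).

Let fA p : A p -> B (f p). Proof. by case: fP => [[h _ _] _]; exact: h. Qed.
Let fD p q : A p -> A q -> geodist B (f p) (f q) = geodist A p q.
Proof. by case: fP => _; apply. Qed.

(* The isometry is controlled at the midpoint [m] of an edge, which still lies in
   the ball when the other end of the edge does not. *)
Lemma isometry_half_edge v v' m u : adj v v' -> A (vx v) -> A m ->
  in_simplex [:: v; v'] m -> m v = 2^-1 -> f (vx v) = vx u ->
  exists b, [/\ adj u b, in_simplex [:: u; b] (f m) & f m u = 2^-1].
Proof.
move=> vv Av Am mv mh fv; have Bv := fA Av; have Bm := fA Am; rewrite fv in Bv.
have dm : geodist B (vx u) (f m) = 2^-1.
  rewrite -fv fD // (geodist_edge gA vv (vertex_in_edge R vv)) //.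
  by rewrite vertex_self mh ger0_norm; lra.
have := lip_geodist (lip_bary u) gB.1 Bv Bm; rewrite dm vertex_self => hu.
have := ler_norm (1 - f m u) => hu'.
have fu : 0 < f m u by lra.
have [e|[b ub fmb]] := pos_in_edge fu.
  by move: dm; rewrite -e geodistxx // => h; exfalso; lra.
exists b; split=> //; move: dm; rewrite (geodist_edge gB ub (vertex_in_edge R ub)) //.
by rewrite vertex_self; have := bary_le1 (f m) u => h1; rewrite ger0_norm; lra.
Qed.

(** [f (vx v')] is at distance 1/2 from the midpoint [f m], so the function of [lip_edge] is
    nonnegative there and the point lies on the closed edge; its distance 1 to [vx u] leaves only
    the other end. *)
Lemma isometry_edge v v' m u : adj v v' -> A (vx v) -> A (vx v') -> A m ->
  in_simplex [:: v; v'] m -> m v = 2^-1 -> f (vx v) = vx u ->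
  exists b, [/\ adj u b, in_simplex [:: u; b] (f m), f m u = 2^-1 & f (vx v') = vx b].
Proof.
move=> vv Av Av' Am mv mh fv.
have [b [ub fmb fmh]] := isometry_half_edge vv Av Am mv mh fv.
exists b; split=> //; set z := f (vx v').
have Bz : B z := fA Av'; have Bm := fA Am; have Bu := fA Av; rewrite fv in Bu.
have vv' : adj v' v by rewrite adj_sym.
have dz : geodist B (vx u) z = 1.
  rewrite -fv fD // (geodist_edge gA vv (vertex_in_edge R vv)) //; last first.
    by apply: edge_sym; exact: vertex_in_edge.
  by rewrite vertex_self /= (negbTE (adj_neq vv)) subr0 normr1.
have dm : geodist B (f m) z = 2^-1.
  rewrite fD // (geodist_edge gA vv mv) //; last first.
    by apply: edge_sym; exact: vertex_in_edge.
  by rewrite mh /= (negbTE (adj_neq vv)) subr0 ger0_norm; lra.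
have := lip_geodist (lip_edge ub) gB.1 Bm Bz; rewrite dm.
have e1 := edge_sum fmb; have e2 : f m b = 2^-1 by lra.
rewrite e2 fmh minxx => hz; set hh := z u + _ - 1 + _ in hz.
have hz' := ler_norm (2^-1 + 2^-1 - 1 + 2^-1 - hh).
have h0 : 0 <= hh by lra.
have [zu zb] : 0 <= z u /\ 0 <= z b by rewrite !bary_ge0.
have [zu0|zu0] := leP (z u) 0.
  apply: bary_eq1; have e : z u = 0 by lra.
  by move: h0; rewrite /hh e min_l //; have := bary_le1 z b; lra.
have [zb0|zb0] := leP (z b) 0.
  have e : z b = 0 by lra.
  have ez : z = vx u.
    by apply: bary_eq1; move: h0; rewrite /hh e min_r //; have := bary_le1 z u; lra.
  by move: dz; rewrite ez geodistxx // => h; exfalso; lra.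
have [_ zub] := pos2_in_edge (adj_neq ub) zu0 zb0.
move: dz; rewrite (geodist_edge gB ub (vertex_in_edge R ub)) // vertex_self.
have h1 := bary_le1 z u; rewrite ger0_norm; last by lra.
by move=> h; exfalso; lra.
Qed.

(** Three points at a small distance [e] from [v], one on each edge, are pairwise [2 e] apart.
    Around an interior point of an edge there is room for only two such points. *)
Lemma isometry_branch_vertex v a1 a2 a3 : adj v a1 -> adj v a2 -> adj v a3 ->
  a1 != a2 -> a1 != a3 -> a2 != a3 -> A (vx v) ->
  (forall b (q : point R X), adj v b -> in_simplex [:: v; b] q -> 2^-1 <= q v -> A q) ->
  exists u, f (vx v) = vx u.
Proof.
move=> va1 va2 va3 n12 n13 n23 Av hA; set z := f (vx v); have Bz : B z := fA Av.
have [[u ->]|[u [c [uc zuc zu zc]]]] := point_edge z; first by exists u.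
exfalso; have ez := edge_sum zuc.
pose e := Num.min (z u) (z c) / 2.
have [e0 eu ec eh] : [/\ 0 < e, e < z u, e < z c & e <= 2^-1].
  by rewrite /e; have [h|h] := leP (z u) (z c); split; lra.
have pt a : adj v a -> exists q : point R X,
    [/\ in_simplex [:: v; a] q, q v = 1 - e, q a = e & A q].
  move=> va; have [|q [qva qv qa]] := @edge_point R X v a e va; first by rewrite (ltW e0); lra.
  by exists q; split=> //; apply: (hA a) => //; lra.
have dv a (q : point R X) : adj v a -> in_simplex [:: v; a] q -> q v = 1 - e -> A q ->
    geodist A (vx v) q = e.
  move=> va qva qv Aq; rewrite (geodist_edge gA va (vertex_in_edge R va)) // vertex_self.
  by rewrite qv ger0_norm; lra.
have [q1 [i1 q1v q1a A1]] := pt _ va1; have [q2 [i2 q2v q2a A2]] := pt _ va2.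
have [q3 [i3 q3v q3a A3]] := pt _ va3.
have d1 := dv _ _ va1 i1 q1v A1; have d2 := dv _ _ va2 i2 q2v A2;
  have d3 := dv _ _ va3 i3 q3v A3.
have far a b (q r : point R X) : adj v a -> adj v b -> a != b -> in_simplex [:: v; a] q ->
    in_simplex [:: v; b] r -> q v = 1 - e -> q a = e -> r v = 1 - e -> r b = e ->
    A q -> A r -> 2 * e <= geodist A q r.
  move=> va vb ab qa rb qv qe rv re Aq Ar.
  have := lip_geodist (lip_tents ab va vb) gA.1 Aq Ar; rewrite /tent.
  rewrite (_ : q b = 0); last by apply: (edge_out qa); rewrite eq_sym // adj_neq.
  rewrite (_ : r a = 0); last by apply: (edge_out rb) => //; rewrite eq_sym adj_neq.
  rewrite qv qe rv re (min_r (_ : e <= 1 - e)); last by lra.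
  rewrite !(min_r (_ : 0 <= 1 - e)); try lra.
  move=> h; have := ler_norm (e - 0 - (0 - e)); lra.
have f12 := far _ _ _ _ va1 va2 n12 i1 i2 q1v q1a q2v q2a A1 A2.
have f13 := far _ _ _ _ va1 va3 n13 i1 i3 q1v q1a q3v q3a A1 A3.
have f23 := far _ _ _ _ va2 va3 n23 i2 i3 q2v q2a q3v q3a A2 A3.
have img (q : point R X) : A q -> geodist A (vx v) q = e ->
    in_simplex [:: u; c] (f q) /\ `|z u - f q u| = e.
  move=> Aq dq; have Bq := fA Aq; have dB : geodist B z (f q) = e by rewrite fD.
  have hu := lip_geodist (lip_bary u) gB.1 Bz Bq;
    have hc := lip_geodist (lip_bary c) gB.1 Bz Bq.
  rewrite dB in hu hc; have hu' := ler_norm (z u - f q u); have hc' := ler_norm (z c - f q c).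
  have [||_ fq] := @pos2_in_edge R Y (f q) u c (adj_neq uc); try lra.
  by split=> //; rewrite -dB (geodist_edge gB uc).
have [w1 e1] := img _ A1 d1; have [w2 e2] := img _ A2 d2; have [w3 e3] := img _ A3 d3.
have dist2 q r : A q -> A r -> in_simplex [:: u; c] (f q) -> in_simplex [:: u; c] (f r) ->
    2 * e <= geodist A q r -> 2 * e <= `|f q u - f r u|.
  move=> Aq Ar wq wr; rewrite -fD // (geodist_edge gB uc) //; exact: fA.
have g12 := dist2 _ _ A1 A2 w1 w2 f12; have g13 := dist2 _ _ A1 A3 w1 w3 f13.
have g23 := dist2 _ _ A2 A3 w2 w3 f23.
exact: no_three_points e0 e1 e2 e3 g12 g13 g23.
Qed.

End Isometries.

(** * Combinatorial isomorphisms of graphs and of balls *)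

Definition graph_iso (X Y : graph) (g : X -> Y) (g' : Y -> X) : Prop :=
  [/\ cancel g g', cancel g' g, forall a b, adj a b -> adj (g a) (g b)
    & forall a b, adj a b -> adj (g' a) (g' b)].

(** An isomorphism of the subgraphs induced on the balls, given by total maps whose values outside
    the balls are arbitrary. *)
Definition pointed_iso (n : nat) (X Y : graph) (x : X) (y : Y) : Prop :=
  exists (g : X -> Y) (g' : Y -> X), [/\ g x = y,
    forall a, (dist x a <= n)%N -> (dist y (g a) <= n)%N /\ g' (g a) = a,
    forall b, (dist y b <= n)%N -> (dist x (g' b) <= n)%N /\ g (g' b) = b,
    forall a b, (dist x a <= n)%N -> (dist x b <= n)%N -> adj a b -> adj (g a) (g b)
  & forall a b, (dist y a <= n)%N -> (dist y b <= n)%N -> adj a b -> adj (g' a) (g' b)].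

Lemma pointed_iso_sym n (X Y : graph) (x : X) (y : Y) :
  pointed_iso n x y -> pointed_iso n y x.
Proof.
move=> [g [g' [gx h1 h2 a1 a2]]]; exists g', g; split=> //.
by have [|_] := h1 x; rewrite ?distxx // gx.
Qed.

Lemma pointed_iso_trans n (X Y Z : graph) (x : X) (y : Y) (z : Z) :
  pointed_iso n x y -> pointed_iso n y z -> pointed_iso n x z.
Proof.
move=> [g [g' [gx g1 g2 ga ga']]] [h [h' [hy h1 h2 ha ha']]].
exists (h \o g), (g' \o h'); split=> /=.
- by rewrite gx.
- by move=> a xa; have [b1 e1] := g1 a xa; have [b2 e2] := h1 _ b1; rewrite e2.
- by move=> b zb; have [b1 e1] := h2 b zb; have [b2 e2] := g2 _ b1; rewrite e2.
- by move=> a b xa xb ab; apply: ha (ga _ _ xa xb ab); [case: (g1 a xa)|case: (g1 b xb)].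
- by move=> a b xa xb ab; apply: ga' (ha' _ _ xa xb ab); [case: (h2 a xa)|case: (h2 b xb)].
Qed.

Lemma walk_in_map (X Y : graph) (P : pred X) (g : X -> Y) a w : P a -> all P w ->
  (forall a b, P a -> P b -> adj a b -> adj (g a) (g b)) ->
  path (@adj X) a w -> path (@adj Y) (g a) (map g w).
Proof.
move=> + + h; elim: w a => //= b w IH a Pa /andP[Pb Pw] /andP[ab pw].
by rewrite h // IH.
Qed.

Lemma pointed_map_dist_le n (X Y : graph) (x : X) (y : Y) (g : X -> Y) : g x = y ->
  (forall a b, (dist x a <= n)%N -> (dist x b <= n)%N -> adj a b -> adj (g a) (g b)) ->
  forall a, (dist x a <= n)%N -> (dist y (g a) <= dist x a)%N.
Proof.
move=> gx gadj a xa; have [w [pw lw sw]] := distP x a.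
have := @walk_in_map X Y (fun b => dist x b <= n)%N g x w _ _ gadj pw.
rewrite distxx (walk_in_ball pw) ?sw // => /(_ isT isT) pg.
by have := dist_le_walk pg; rewrite last_map lw size_map sw gx.
Qed.

Lemma pointed_iso_sub m n (X Y : graph) (x : X) (y : Y) : (m <= n)%N ->
  pointed_iso n x y -> pointed_iso m x y.
Proof.
move=> mn [g [g' [gx h1 h2 a1 a2]]]; have le k : (k <= m)%N -> (k <= n)%N.
  by move=> km; exact: leq_trans mn.
have g'y : g' y = x by have [|_] := h1 x; rewrite ?distxx // gx.
exists g, g'; split=> //.
- move=> a xa; have [_ ->] := h1 a (le _ xa); split=> //.
  exact: leq_trans (pointed_map_dist_le gx a1 (le _ xa)) xa.
- move=> b yb; have [_ ->] := h2 b (le _ yb); split=> //.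
  exact: leq_trans (pointed_map_dist_le g'y a2 (le _ yb)) yb.
- by move=> a b xa xb; apply: a1; exact: le.
- by move=> a b xa xb; apply: a2; exact: le.
Qed.

Section Anchored.
Variable R : realType.
Local Notation vx := (@vertex_point R _).

Lemma midpoint (X : graph) (v v' : X) : adj v v' ->
  exists m : point R X, in_simplex [:: v; v'] m /\ m v = 2^-1.
Proof.
move=> vv; have [|m [h1 h2 h3]] := @edge_point R X v v' 2^-1 vv; first by apply/andP;
  split; lra.
by exists m; split=> //; rewrite h2; lra.
Qed.

Lemma isometry_adj (X Y : graph) (A : set (point R X)) (B : set (point R Y)) f v v' u :
  good A -> good B -> isometry A B f -> A (vx v) -> A (vx v') -> adj v v' ->
  f (vx v) = vx u -> exists2 b, adj u b & f (vx v') = vx b.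
Proof.
move=> gA gB fP Av Av' vv fv; have [m [mv mh]] := midpoint vv.
have Am : A m.
  have vv' : adj v' v by rewrite adj_sym.
  have e := edge_sum mv.
  apply: (gA.2 v v' (vx v) (vx v') vv (vertex_in_edge R vv) _ Av Av' 2^-1); first 2 last.
  - move=> w; have [->|wv] := eqVneq w v.
      have z1 : vx v' v = 0 :> R by rewrite /= (negbTE (adj_neq vv)).
      by rewrite vertex_self z1 mh; lra.
    have [->|wv'] := eqVneq w v'.
      have z2 : vx v v' = 0 :> R by rewrite /= (negbTE (adj_neq vv')).
      by rewrite vertex_self z2; lra.
    by rewrite (edge_out mv) //= (negbTE wv) (negbTE wv') !mulr0 addr0.
  - by apply: edge_sym; exact: vertex_in_edge.
  - by apply/andP; split; lra.
by have [b [ub _ _ fv']] := isometry_edge gA gB fP vv Av Av' Am mv mh fv; exists b.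
Qed.

Lemma anchored_isometry_iso (X Y : graph) (f : point R X -> point R Y) v0 u0 :
  isometry setT setT f -> f (vx v0) = vx u0 ->
  exists g g', graph_iso g g' /\ g v0 = u0 :> Y.
Proof.
move=> fP f0; have [h [hP hf fh]] := isometry_inv fP.
have all_vertex (X1 Y1 : graph) (F : point R X1 -> point R Y1) a b :
    isometry setT setT F -> F (vx a) = vx b -> forall v, exists u, F (vx v) = vx u.
  move=> FP Fa v; have [w pw <-] := adj_connected a v.
  elim: w a b Fa pw => [|c w IH] a b Fa /=; first by exists b.
  move=> /andP[ac pw]; have [d bd Fc] := isometry_adj (goodT R X1) (goodT R Y1) FP I I ac Fa.
  exact: IH Fc pw.
have h0 : h (vx u0) = vx v0 by rewrite -f0 hf.
have /choice[g gP] := all_vertex _ _ _ _ _ fP f0.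
have /choice[g' g'P] := all_vertex _ _ _ _ _ hP h0.
exists g, g'; split; last by apply: (@vertex_inj R); rewrite -gP.
split.
- by move=> v; apply: (@vertex_inj R); rewrite -g'P -gP hf.
- by move=> v; apply: (@vertex_inj R); rewrite -gP -g'P fh.
- move=> a b ab; have [d gd Fb] := isometry_adj (goodT R X) (goodT R Y) fP I I ab (gP a).
  by move: Fb; rewrite gP => /vertex_inj ->.
- move=> a b ab; have [d gd Fb] := isometry_adj (goodT R Y) (goodT R X) hP I I ab (g'P a).
  by move: Fb; rewrite g'P => /vertex_inj ->.
Qed.

Section BallIsometry.
Variables (X Y : graph) (x : X) (y : Y) (n : nat) (f : point R X -> point R Y).
Local Notation A := (gball x (n%:R + 2^-1 : R)).
Local Notation B := (gball y (n%:R + 2^-1 : R)).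
Hypothesis fP : isometry A B f.

(** Geodesics to the centre stay in the ball. The property of going to a vertex therefore passes
    along one from [v0] to [x], and from there to every vertex of the ball. *)
Lemma ball_isometry_vertices v0 u0 : (dist x v0 <= n)%N -> f (vx v0) = vx u0 ->
  forall v, (dist x v <= n)%N -> exists u, f (vx v) = vx u.
Proof.
move=> d0 f0; have step v v' u : (dist x v <= n)%N -> (dist x v' <= n)%N -> adj v v' ->
    f (vx v) = vx u -> exists u', f (vx v') = vx u'.
  move=> dv dv' vv fv; have [||u' _ h] :=
    isometry_adj (good_gball R x n) (good_gball R y n) fP _ _ vv fv.
  - exact/gball_vertex.
  - exact/gball_vertex.
  - by exists u'.
have [ux fx] : exists u, f (vx x) = vx u.
  have [d e] : exists d, dist x v0 = d by exists (dist x v0).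
  elim: d v0 u0 d0 f0 e => [|d IH] v u dv fv e.
    by rewrite (dist0_eq e); exists u.
  have [v' vv' e'] := dist_pred e.
  have dv' : (dist x v' <= n)%N by rewrite e' ltnW // -e.
  have [u' fv'] := step v v' u dv dv' (eq_ind_r is_true vv' (adj_sym v v')) fv.
  exact: IH fv' e'.
move=> v; have [d e] : exists d, dist x v = d by exists (dist x v).
elim: d v e => [|d IH] v e dv; first by exists ux; rewrite -(dist0_eq e).
have [v' vv' e'] := dist_pred e.
have dv' : (dist x v' <= n)%N by rewrite e' ltnW // -e.
by have [u' fv'] := IH v' e' dv'; exact: step fv'.
Qed.

End BallIsometry.

(** The isometry need not send [x] to [y]. The new centre [p] is the preimage of [y], and the point
    is that the whole ball of radius [n] about [p] lies inside the given ball about [x]. *)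
Lemma ball_isometry_pointed (X Y : graph) (x : X) (y : Y) n f v0 u0 :
  isometry (gball x (n%:R + 2^-1 : R)) (gball y (n%:R + 2^-1)) f ->
  (dist x v0 <= n)%N -> f (vx v0) = vx u0 -> exists p : X, pointed_iso n p y.
Proof.
set A := gball x _; set B := gball y _ => fP d0 f0.
have gA : good A := good_gball R x n; have gB : good B := good_gball R y n.
have [h [hP hf fh]] := isometry_inv fP.
have fA p : A p -> B (f p) by case: fP => [[H _ _] _]; exact: H.
have hB p : B p -> A (h p) by case: hP => [[H _ _] _]; exact: H.
have Av v : (dist x v <= n)%N -> A (vx v) by move=> ?; apply/gball_vertex.
have Bv v : (dist y v <= n)%N -> B (vx v) by move=> ?; apply/gball_vertex.
have /choice[g gP] : forall v, exists u, (dist x v <= n)%N -> f (vx v) = vx u.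
  move=> v; have [dv|dv] := leqP (dist x v) n; last by exists y.
  by have [u fu] := ball_isometry_vertices fP d0 f0 dv; exists u.
have gd v : (dist x v <= n)%N -> (dist y (g v) <= n)%N.
  by move=> dv; apply/(gball_vertex R); rewrite -gP //; exact/fA/Av.
have du0 : (dist y u0 <= n)%N.
  by apply/(gball_vertex R); rewrite -f0; exact/fA/Av.
have h0 : h (vx u0) = vx v0 by rewrite -f0 hf //; exact: Av.
have /choice[g' g'P] : forall v, exists u, (dist y v <= n)%N -> h (vx v) = vx u.
  move=> v; have [dv|dv] := leqP (dist y v) n; last by exists x.
  by have [u fu] := ball_isometry_vertices hP du0 h0 dv; exists u.
have gd' v : (dist y v <= n)%N -> (dist x (g' v) <= n)%N.
  by move=> dv; apply/(gball_vertex R); rewrite -g'P //; exact/hB/Bv.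
have gK v : (dist x v <= n)%N -> g' (g v) = v.
  by move=> dv; apply: (@vertex_inj R); rewrite -g'P ?gd // -gP // hf //; exact: Av.
have gK' v : (dist y v <= n)%N -> g (g' v) = v.
  by move=> dv; apply: (@vertex_inj R); rewrite -gP ?gd' // -g'P // fh //; exact: Bv.
have ga a b : (dist x a <= n)%N -> (dist x b <= n)%N -> adj a b -> adj (g a) (g b).
  move=> da db ab; have [c gc fb] := isometry_adj gA gB fP (Av _ da) (Av _ db) ab (gP _ da).
  by move: fb; rewrite gP // => /vertex_inj ->.
have ga' a b : (dist y a <= n)%N -> (dist y b <= n)%N -> adj a b -> adj (g' a) (g' b).
  move=> da db ab; have [c gc fb] := isometry_adj gB gA hP (Bv _ da) (Bv _ db) ab (g'P _ da).
  by move: fb; rewrite g'P // => /vertex_inj ->.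
have yn : (dist y y <= n)%N by rewrite distxx.
pose p := g' y; have dp : (dist x p <= n)%N := gd' _ yn.
have gp : g p = y by rewrite /p gK'.
(* Edges leaving a vertex strictly inside the ball of [y] are seen entirely. *)
have out v v' : (dist x v <= n)%N -> (dist y (g v) < n)%N -> adj v v' -> (dist x v' <= n)%N.
  move=> dv dgv vv; have [m [mv mh]] := midpoint vv.
  have Am : A m by apply: half_edge_in_ball dv vv mv _; rewrite mh.
  have [b [gb fmb fmh]] := isometry_half_edge gA gB fP vv (Av _ dv) Am mv mh (gP _ dv).
  have db : (dist y b <= n)%N by apply: leq_trans (dist_adj_le y gb) dgv.
  have hgv : h (vx (g v)) = vx v by rewrite -gP // hf //; exact: Av.
  have [b' [vb' hm hmh hb]] :=
    isometry_edge gB gA hP gb (Bv _ (ltnW dgv)) (Bv _ db) (fA _ Am) fmb fmh hgv.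
  rewrite hf // in hm hmh; have e := edge_sum mv.
  have v'b' : v' = b'.
    have : 0 < m v' by lra.
    move=> /(in_simplex_supp hm); rewrite !inE => /orP[] /eqP // e'.
    by move: vv; rewrite e' adj_irr.
  by apply/(gball_vertex R); rewrite v'b' -hb; exact/hB/Bv.
have inb j : (j <= n)%N -> forall v, dist p v = j ->
  (dist x v <= n)%N /\ (dist y (g v) <= j)%N.
  elim: j => [|j IH] jn v e; first by rewrite -(dist0_eq e) gp distxx.
  have [v' vv' e'] := dist_pred e; have [d1 d2] := IH (ltnW jn) v' e'.
  have dv : (dist x v <= n)%N by apply: out vv' => //; apply: leq_ltn_trans d2 jn.
  by split=> //; apply: leq_trans (dist_adj_le y (ga _ _ d1 dv vv')) _; rewrite ltnS.
have inb' j : (j <= n)%N -> forall b, dist y b = j -> (dist p (g' b) <= j)%N.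
  elim: j => [|j IH] jn b e; first by rewrite -(dist0_eq e) distxx.
  have [b' bb' e'] := dist_pred e; have d := IH (ltnW jn) b' e'.
  have adjb : adj (g' b') (g' b) by apply: ga' => //; rewrite ?e ?e' // ltnW.
  by apply: leq_trans (dist_adj_le p adjb) _; rewrite ltnS.
exists p, g, g'; split=> //.
- move=> a pa; have [d1 d2] := inb _ pa a erefl.
  by split; [exact: leq_trans d2 pa|exact: gK].
- move=> b yb; split; last exact: gK'.
  exact: leq_trans (inb' _ yb b erefl) yb.
- by move=> a b pa pb; apply: ga; [case: (inb _ pa a erefl)|case: (inb _ pb b erefl)].
Qed.

End Anchored.

(** * From combinatorial isomorphisms to isometries *)

Section Push.
Variables (R : realType) (X Y : graph) (dX : pred X) (dY : pred Y).
Variables (g : X -> Y) (g' : Y -> X).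
Hypotheses (gd : forall a, dX a -> dY (g a) /\ g' (g a) = a)
  (gd' : forall b, dY b -> dX (g' b) /\ g (g' b) = b)
  (ga : forall a b, dX a -> dX b -> adj a b -> adj (g a) (g b)).
Local Notation vx := (@vertex_point R _).

Definition push (p : X -> R) (w : Y) : R := if dY w then p (g' w) else 0.

Lemma push_g p a : dX a -> push p (g a) = p a.
Proof. by move=> da; have [d e] := gd da; rewrite /push d e. Qed.

Lemma push_out p w : (forall a, dX a -> w = g a -> p a = 0) -> push p w = 0.
Proof.
move=> h; rewrite /push; case: ifP => // dw; have [d e] := gd' dw.
by apply: h => //; rewrite e.
Qed.

Lemma push_edge a b (p : point R X) : adj a b -> dX a -> dX b ->
  in_simplex [:: a; b] p -> in_simplex [:: g a; g b] (push p).
Proof.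
move=> ab da db pab; split=> [w|w|].
- by rewrite /push; case: ifP => // _; exact: bary_ge0.
- rewrite !inE negb_or => /andP[wa wb]; apply: push_out => c dc e; subst w.
  apply: (edge_out pab); first by apply: contraNneq wa => ->.
  by apply: contraNneq wb => ->.
- by rewrite !big_cons big_nil addr0 !push_g // edge_sum.
Qed.

Lemma push_point (p : point R X) : (forall a, 0 < p a -> dX a) ->
  exists q : point R Y, forall w, q w = push p w.
Proof.
move=> hp; have [[a e]|[a [b [ab pab pa pb]]]] := point_edge p.
  have da : dX a by apply: hp; rewrite e vertex_self ltr01.
  exists (vx (g a)) => w; rewrite e /=; have [->|wa] := eqVneq w (g a).
    by rewrite push_g //= eqxx.
  rewrite push_out // => c dc ew /=; case: eqP => // ca.
  by move: wa; rewrite ew ca eqxx.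
have da := hp _ pa; have db := hp _ pb.
have vp : exists2 s, graph_simplices Y s & in_simplex s (push p).
  exists [:: g a; g b]; first by apply: graph_simplex2; exact: ga.
  exact: push_edge.
by exists (Realization vp).
Qed.

Variables (A : set (point R X)) (B : set (point R Y)) (F : point R X -> point R Y).
Hypotheses (hA : forall p a b, A p -> adj a b -> in_simplex [:: a; b] p -> dX a /\ dX b)
  (FE : forall p, A p -> forall w, F p w = push p w)
  (hB : forall (p : point R X) (q : point R Y), A p -> (forall w, q w = push p w) -> B q).

Lemma pl_path_push p q l : pl_path A p q l -> pl_path B (F p) (F q) l.
Proof.
elim=> [{}p Ap|{}p {}q r x y {}l xy px qx seg h IH].
  by apply: pl_path_nil; apply: (hB Ap); exact: FE.
have Aq : A q by have [] := pl_path_in h.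
have Ap : A p.
  apply: (seg 0) => [|w]; first by rewrite lexx ler01.
  by rewrite subr0 mul1r mul0r addr0.
have [dx dy] := hA Ap xy px.
have FpE : bary (F p) = push p by apply/funext => w; exact: FE.
have FqE : bary (F q) = push q by apply/funext => w; exact: FE.
rewrite (_ : `|p x - q x| = `|F p (g x) - F q (g x)|); last by rewrite FpE FqE !push_g.
apply: (@pl_path_cons _ _ _ _ _ _ (g x) (g y)) IH.
- exact: ga.
- by rewrite FpE; exact: push_edge.
- by rewrite FqE; exact: push_edge.
- move=> t z t01 zE; have [z0 z0x z0E] := edge_convex xy px qx t01.
  have Az0 : A z0 := seg t z0 t01 z0E.
  apply: (hB Az0) => w; rewrite zE FpE FqE /push.
  by case: ifP => // _; rewrite ?z0E ?mulr0 ?addr0.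
Qed.

End Push.

Section Transport.
Variables (R : realType) (X Y : graph) (dX : pred X) (dY : pred Y).
Variables (g : X -> Y) (g' : Y -> X).
Hypotheses (gd : forall a, dX a -> dY (g a) /\ g' (g a) = a)
  (gd' : forall b, dY b -> dX (g' b) /\ g (g' b) = b)
  (ga : forall a b, dX a -> dX b -> adj a b -> adj (g a) (g b))
  (ga' : forall a b, dY a -> dY b -> adj a b -> adj (g' a) (g' b)).
Variables (A : set (point R X)) (B : set (point R Y)).
Hypotheses (hA : forall p a b, A p -> adj a b -> in_simplex [:: a; b] p -> dX a /\ dX b)
  (hB : forall p a b, B p -> adj a b -> in_simplex [:: a; b] p -> dY a /\ dY b)
  (sA : forall (p : point R X) a, A p -> 0 < p a -> dX a)
  (sB : forall (p : point R Y) a, B p -> 0 < p a -> dY a)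
  (AB : forall (p : point R X) (q : point R Y), A p -> (forall w, q w = push dY g' p w) -> B q)
  (BA : forall (p : point R Y) (q : point R X), B p -> (forall w, q w = push dX g p w) -> A q).

Lemma transport_isometric : isometric_sets A B.
Proof.
have /choice[F FE] : forall p, exists q : point R Y, A p -> forall w, q w = push dY g' p w.
  move=> p; have [Ap|nA] := pselect (A p).
    by have [q qE] := push_point gd gd' ga (fun a => @sA p a Ap); exists q.
  by have [y] := vertex_inh Y; exists (vertex_point R y).
have /choice[G GE] : forall p, exists q : point R X, B p -> forall w, q w = push dX g p w.
  move=> p; have [Bp|nB] := pselect (B p).
    by have [q qE] := push_point gd' gd ga' (fun a => @sB p a Bp); exists q.
  by have [y] := vertex_inh X; exists (vertex_point R y).
have FB p : A p -> B (F p) by move=> Ap; apply: (AB Ap); exact: FE.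
have GA p : B p -> A (G p) by move=> Bp; apply: (BA Bp); exact: GE.
have out (V : graph) (d : pred V) (p : point R V) a : (forall b, 0 < p b -> d b) ->
  ~~ d a -> p a = 0.
  move=> h da; apply/eqP; rewrite eq_le bary_ge0 andbT leNgt.
  by apply: contra da; exact: h.
have GF p : A p -> G (F p) = p.
  move=> Ap; apply: realization_ext => a; rewrite (GE _ (FB _ Ap)) /push; case: ifP => da.
    by have [db e] := gd da; rewrite FE // /push db e.
  by rewrite (out _ dX p) ?da // => b; exact: sA.
have FG p : B p -> F (G p) = p.
  move=> Bp; apply: realization_ext => a; rewrite (FE _ (GA _ Bp)) /push; case: ifP => da.
    by have [db e] := gd' da; rewrite GE // /push db e.
  by rewrite (out _ dY p) ?da // => b; exact: sB.
exists F; split; first split.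
- by move=> p; exact: FB.
- by move=> p q; rewrite !inE => Ap Aq e; rewrite -(GF p) // e GF.
- by move=> q Bq; exists (G q); [exact: GA|exact: FG].
move=> p q Ap Aq; congr inf; apply/seteqP; split=> l /= h.
  by rewrite -(GF p) // -(GF q) //; exact: (pl_path_push gd' gd ga' hB GE BA h).
exact: (pl_path_push gd gd' ga hA FE AB h).
Qed.

End Transport.

Section TransportApplications.
Variable R : realType.
Local Notation vx := (@vertex_point R _).

Lemma graph_iso_isometric (X Y : graph) (g : X -> Y) g' : graph_iso g g' -> isometric R X Y.
Proof.
move=> [gK gK' ga ga']; apply: (@transport_isometric R X Y predT predT g g') => // a b _ _.
  exact: ga.
exact: ga'.
Qed.

(** The margin 1 puts both ends of every edge meeting the metric ball of radius [r] inside the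
    combinatorial ball of radius [n]. *)
Lemma pointed_iso_isometric_balls n (X Y : graph) (x : X) (y : Y) (r : R) :
  pointed_iso n x y -> r + 1 <= n%:R -> isometric_sets (gball x r) (gball y r).
Proof.
move=> [g [g' [gx h1 h2 a1 a2]]] rn; have g'y : g' y = x by have [|_] := h1 x;
  rewrite ?distxx // gx.
have supp (V : graph) (v : V) (p : point R V) a : gball v r p -> 0 < p a -> (dist v a <= n)%N.
  rewrite gballE => -[b pb hb] pa; rewrite -(ler_nat R).
  have [<-|ba] := eqVneq b a; first by have := bary_le1 p b; lra.
  have [adjba _] := pos2_in_edge ba pb pa; have : (dist v a)%:R <= (dist v b)%:R + 1 :> R.
    by rewrite natr1 ler_nat; exact: dist_adj_le.
  by have := bary_le1 p b; lra.
have edge (V : graph) (v : V) (p : point R V) a b : gball v r p -> adj a b ->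
    in_simplex [:: a; b] p -> (dist v a <= n)%N /\ (dist v b <= n)%N.
  move=> vp; wlog: a b / 0 < p a => [hw ab pab|pa ab pab].
    have [pa|pa] := ltP 0 (p a); first exact: hw.
    have := edge_sum pab; have := bary_ge0 p a => p0 e.
    by have [|||] := hw b a; rewrite 1?adj_sym //; [lra|exact: edge_sym].
  have da := supp _ _ _ _ vp pa; split=> //.
  have [pb|pb] := ltP 0 (p b); first exact: supp vp pb.
  have e1 : p a = 1 by have := edge_sum pab; have := bary_ge0 p b; lra.
  move: vp; rewrite gballE => -[c pc hc]; rewrite -(ler_nat R).
  have ca : c = a by apply: (@vertex_pos R); rewrite -(bary_eq1 e1).
  subst c; have : (dist v b)%:R <= (dist v a)%:R + 1 :> R.
    by rewrite natr1 ler_nat; exact: dist_adj_le.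
  by lra.
have img (V V' : graph) (v : V) (v' : V') (k : V -> V') (k' : V' -> V) (p : point R V)
    (q : point R V') : k v = v' ->
    (forall a, (dist v a <= n)%N -> (dist v' (k a) <= n)%N /\ k' (k a) = a) ->
    (forall a b, (dist v a <= n)%N -> (dist v b <= n)%N -> adj a b -> adj (k a) (k b)) ->
    gball v r p -> (forall w, q w = push (fun b => dist v' b <= n)%N k' p w) -> gball v' r q.
  move=> kv kd ka vp qE; have := vp; rewrite !gballE => -[a pa ha].
  have da := supp _ _ _ _ vp pa; have [db e] := kd a da.
  have qa : q (k a) = p a by rewrite qE /push db e.
  exists (k a); rewrite qa //; apply: le_trans ha; rewrite lerD2r ler_nat.
  exact: pointed_map_dist_le ka _ da.
apply: (@transport_isometric R X Y (fun a => dist x a <= n)%N (fun b => dist y b <= n)%N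
  g g') => //.
- exact: edge.
- exact: edge.
- exact: supp.
- exact: supp.
- by move=> p q; exact: (img X Y x y g g').
- by move=> p q; exact: (img Y X y x g' g).
Qed.

(** If [f (vx v)] were inside an edge, the two points at distance [e] on either side of it would
    both come from the only point at distance [e] from the leaf. *)
Lemma isometry_leaf_vertex (X Y : graph) (f : point R X -> point R Y) v :
  isometry setT setT f -> (forall a b, adj v a -> adj v b -> a = b) ->
  exists u, f (vx v) = vx u.
Proof.
move=> fP leaf; set z := f (vx v).
have [[u ->]|[u [c [uc zuc zu zc]]]] := point_edge z; first by exists u.
exfalso; have ez := edge_sum zuc; have [h [hP hf fh]] := isometry_inv fP.
have [gX gY] := (goodT R X, goodT R Y).
pose e := Num.min (z u) (z c) / 2.
have [e0 eu ec eh] : [/\ 0 < e, e < z u, e < z c & e <= 2^-1].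
  by rewrite /e; have [h1|h1] := leP (z u) (z c); split; lra.
have pt (t : R) : 0 <= t <= 1 -> exists q : point R Y, in_simplex [:: u; c] q /\ q u = t.
  move=> t01; have [|q [q1 q2 _]] := @edge_point R Y u c (1 - t) uc; first by lra.
  by exists q; split=> //; rewrite q2; lra.
have [|w1 [i1 e1]] := pt (z u - e); first by apply/andP; split; lra.
have [|w2 [i2 e2]] := pt (z u + e); first by apply/andP; split; lra.
have img (w : point R Y) : in_simplex [:: u; c] w -> `|z u - w u| = e -> h w v = 1 - e.
  move=> wi we; have dw : geodist setT (vx v) (h w) = e.
    have [_ hD] := hP; rewrite -(hf (vx v)) // hD // -/z.
    by rewrite (geodist_edge gY uc zuc wi).
  have := lip_geodist (lip_bary v) gX.1 (I : setT (vx v)) (I : setT (h w)).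
  rewrite dw vertex_self => hv; have hv' := ler_norm (1 - h w v).
  have pv : 0 < h w v by lra.
  have [e'|[a va hw]] := pos_in_edge pv.
    by move: dw; rewrite e' geodistxx // => e''; exfalso; lra.
  move: dw; rewrite (geodist_edge gX va (vertex_in_edge R va) hw) // vertex_self.
  by have h1 := bary_le1 (h w) v; rewrite ger0_norm; lra.
have h1 : h w1 v = 1 - e by apply: img => //; rewrite e1 ger0_norm; lra.
have h2 : h w2 v = 1 - e by apply: img => //; rewrite e2 ler0_norm; lra.
have e12 : h w1 = h w2.
  have pw1 : 0 < h w1 v by rewrite h1; lra.
  have [e'|[a va ha]] := pos_in_edge pw1.
    by move: h1; rewrite e' vertex_self => ?; exfalso; lra.
  have pw2 : 0 < h w2 v by rewrite h2; lra.
  have [e'|[b vb hb]] := pos_in_edge pw2.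
    by move: h2; rewrite e' vertex_self => ?; exfalso; lra.
  have ab := leaf a b va vb; subst b.
  by apply: (edge_ext ha hb); rewrite h1 h2.
have : w1 = w2 by rewrite -(fh w1) // e12 fh.
by move=> e'; move: e1; rewrite e' e2; lra.
Qed.

End TransportApplications.

(** * Lines and cycles *)

Definition two_regular (X : graph) : Prop := forall x : X, exists a b,
  [/\ a != b, adj x a, adj x b & forall c, adj x c -> c = a \/ c = b].

(** In a two-regular graph this is a parametrization by the universal cover, the line; it treats
    lines and cycles alike. *)
Definition non_backtracking (X : graph) (u : int -> X) : Prop :=
  forall i, adj (u i) (u (i + 1)) /\ u (i + 2) != u i.

Section TwoRegular.
Variable X : graph.
Hypothesis X2 : two_regular X.
Implicit Type u v : int -> X.

Lemma non_backtracking_ex : exists u, non_backtracking u.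
Proof.
have /choice[h hP] : forall p : X * X, exists c, adj p.2 p.1 -> adj p.2 c /\ c != p.1.
  move=> [a x] /=; have [b [c [bc xb xc xbc]]] := X2 x.
  have [ba|ba] := eqVneq b a; last by exists b.
  by exists c => _; split=> //; rewrite -ba eq_sym.
pose nx (p : X * X) := (p.2, h p); pose f p n := (iter n nx p).1.
have fS p n : f p n.+1 = (iter n nx p).2 by [].
have fP p : adj p.1 p.2 -> forall n, adj (f p n) (f p n.+1) /\ f p n.+2 != f p n.
  move=> hp; have inv (n : nat) : adj (f p n) (f p n.+1).
    by elim: n => // n; rewrite adj_sym => /hP[].
  by move=> n; split=> //; have := inv n; rewrite adj_sym => /hP[].
have [a] := vertex_inh X; have [b [_ [_ ab _ _]]] := X2 a.
have ba : adj b a by rewrite adj_sym.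
have [F G] := (fP (a, b) ab, fP (b, a) ba).
(* The ray from [(b, a)] begins with [b] and [a], already the values at 1 and 0; hence the shift by
   two on negative integers. *)
exists (fun i => match i with Posz n => f (a, b) n | Negz n => f (b, a) n.+2 end).
case=> [n|[|[|n]]].
- by rewrite -!PoszD addn1 addn2; exact: F.
- rewrite (_ : Negz 0 + 1 = 0%N) // (_ : Negz 0 + 2 = 1%N) //.
  have [h1 h2] := (G 1%N, G 0%N); split; first by rewrite adj_sym; case: h1.
  by rewrite eq_sym; case: h2.
- rewrite (_ : Negz 1 + 1 = Negz 0) // (_ : Negz 1 + 2 = 0%N) //.
  have [h1 h2] := (G 2%N, G 1%N); split; first by rewrite adj_sym; case: h1.
  by rewrite eq_sym; case: h2.
- rewrite (_ : Negz n.+2 + 1 = Negz n.+1); last by lia.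
  rewrite (_ : Negz n.+2 + 2 = Negz n); last by lia.
  have [h1 h2] := (G n.+3, G n.+2); split; first by rewrite adj_sym; case: h1.
  by rewrite eq_sym; case: h2.
Qed.

Lemma non_backtracking_nbr u i c : non_backtracking u -> adj (u i) c ->
  c = u (i - 1) \/ c = u (i + 1).
Proof.
move=> uP ic; have [h1 _] := uP i; have [h2 h3] := uP (i - 1).
rewrite subrK in h2; rewrite (_ : i - 1 + 2 = i + 1) in h3; last by ring.
rewrite adj_sym in h2; have [a [b [ab xa xb xab]]] := X2 (u i).
case: (xab _ ic) => ->; case: (xab _ h1) => e1; case: (xab _ h2) => e2;
  rewrite e1 e2 ?eqxx // in h3 *; by [left|right].
Qed.

Lemma non_backtracking_uniq u v : non_backtracking u -> non_backtracking v ->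
  u 0 = v 0 -> u 1 = v 1 -> u =1 v.
Proof.
move=> uP vP e0 e1; suff h i : u i = v i /\ u (i + 1) = v (i + 1) by move=> i; case: (h i).
have up j : u j = v j -> u (j + 1) = v (j + 1) -> u (j + 2) = v (j + 2).
  move=> h0 h1; have [_ n1] := uP j; have [_ n2] := vP j.
  have [a _] := uP (j + 1); rewrite (_ : j + 1 + 1 = j + 2) in a; last by ring.
  rewrite h1 in a; have := non_backtracking_nbr vP a.
  rewrite addrK (_ : j + 1 + 1 = j + 2); last by ring.
  by case=> // e; rewrite e h0 eqxx in n1.
have down j : u j = v j -> u (j + 1) = v (j + 1) -> u (j - 1) = v (j - 1).
  move=> h0 h1; have [a n1] := uP (j - 1); rewrite subrK in a.
  rewrite (_ : j - 1 + 2 = j + 1) in n1; last by ring.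
  rewrite adj_sym h0 in a; have := non_backtracking_nbr vP a.
  by case=> // e; rewrite e h1 eqxx in n1.
elim/int_ind: i => [|n [h0 h1]|n [h0 h1]].
- by rewrite add0r.
- have e : n%:Z + 2 = n.+1%:Z + 1 by lia.
  have e' : n%:Z + 1 = n.+1%:Z by lia.
  by rewrite -e -e'; split=> //; exact: up.
- have e : - n%:Z - 1 = - n.+1%:Z by lia.
  have e' : - n.+1%:Z + 1 = - n%:Z by lia.
  by rewrite e' -e; split=> //; exact: down.
Qed.

Lemma non_backtracking_shift u t : non_backtracking u -> non_backtracking (fun i => u (i + t)).
Proof.
move=> uP i; have [h1 h2] := uP (i + t).
by rewrite -addrA (addrC 1) addrA -(addrA i 2) (addrC 2) addrA.
Qed.

Lemma non_backtracking_reflect u t : non_backtracking u ->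
  non_backtracking (fun i => u (t - i)).
Proof.
move=> uP i; have [h1 _] := uP (t - (i + 1)); have [_ h2] := uP (t - (i + 2)).
rewrite (_ : t - (i + 1) + 1 = t - i) in h1; last by ring.
rewrite (_ : t - (i + 2) + 2 = t - i) in h2; last by ring.
by split; [rewrite adj_sym|rewrite eq_sym].
Qed.

Lemma non_backtracking_surj u x : non_backtracking u -> exists i, u i = x.
Proof.
move=> uP; have [w pw <-] := adj_connected (u 0) x.
elim: w 0 pw => [|c w IH] i /=; first by exists i.
move=> /andP[ic pw]; have [e|e] := non_backtracking_nbr uP ic; subst c; exact: IH pw.
Qed.

(** From a common vertex the two walks leave either in the same direction, and coincide, or in
    opposite directions; in the latter case [u] would be symmetric under a reflection of the
    integers. *)
Lemma non_backtracking_period u i j s : non_backtracking u -> u i = u j ->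
  u (i + s) = u (j + s).
Proof.
move=> uP e; have si := non_backtracking_shift i uP; have sj := non_backtracking_shift j uP.
have [a _] := uP j; rewrite -e in a; have [e1|e1] := non_backtracking_nbr uP a; last first.
  rewrite !(addrC _ s); apply: (non_backtracking_uniq si sj) => /=.
    by rewrite !add0r.
  by rewrite !(addrC 1).
have R t : u (i - t) = u (t + j).
  apply: (non_backtracking_uniq (non_backtracking_reflect i uP) sj);
    first by rewrite subr0 add0r.
  by rewrite -e1 addrC.
(* A reflection fixing an integer makes [u] backtrack there; one exchanging two consecutive integers
   gives an edge with equal ends. *)
have [[t ij]|[t ij]] : (exists t, i - j = 2 * t) \/ (exists t, i - j = 2 * t + 1).
  have := divz_eq (i - j) 2; have := modz_ge0 (i - j) (isT : (2 : int) != 0).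
  have := ltz_pmod (i - j) (isT : 0 < (2 : int)); set q := (_ %/ _)%Z; set m := (_ %% _)%Z.
  move=> h1 h2 h3; have [m0|m1] : m = 0 \/ m = 1 by lia.
    by left; exists q; lia.
  by right; exists q; lia.
- have [_] := uP (i - (t + 1)); rewrite (_ : i - (t + 1) + 2 = t + 1 + j); last by lia.
  by rewrite R eqxx.
- have := R t; have [] := uP (t + j); rewrite (_ : t + j + 1 = i - t); last by lia.
  by move=> + _ => /[swap] ->; rewrite adj_irr.
Qed.

End TwoRegular.

(** * Separated points on a cycle *)

Section Packing.
Variables (R : realType) (X : graph).
Local Notation vx := (@vertex_point R _).

Lemma geodist_vertex_ge1 (x y : X) : x != y -> 1 <= geodist setT (vx x) (vx y).
Proof.
move=> xy; have := lip_geodist (lip_bary x) (goodT R X).1 (I : setT (vx x)) (I : setT (vx y)).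
by rewrite vertex_self /= (negbTE xy) subr0 normr1.
Qed.

Hypothesis X2 : two_regular X.

(* At most one point of the family lies on each of the two edges at [v]. *)
Lemma two_regular_packing_vertex (s : seq (point R X)) (v : X) : uniq s ->
  {in s &, forall p q, p != q -> 1 <= geodist setT p q} ->
  \sum_(p <- s) p v <= 1.
Proof.
move=> us sep; have gX := goodT R X; have [a [b [ab va vb vab]]] := X2 v.
have edge (p : point R X) : 0 < p v -> in_simplex [:: v; a] p \/ in_simplex [:: v; b] p.
  move=> pv; have [->|[c vc pc]] := pos_in_edge pv; first by left; exact: vertex_in_edge.
  by case: (vab c vc) => e; subst c; [left|right].
have same c (p q : point R X) : adj v c -> p \in s -> q \in s -> 0 < p v -> 0 < q v ->
    in_simplex [:: v; c] p -> in_simplex [:: v; c] q -> p = q.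
  move=> vc ps qs pv qv pc qc; apply/eqP; apply: contraT => pq.
  have := sep p q ps qs pq; rewrite (geodist_edge gX vc pc qc) //.
  have h1 := bary_le1 p v; have h2 := bary_le1 q v.
  by have [h|h] := leP (q v) (p v); [rewrite ger0_norm|rewrite ler0_norm]; lra.
have far p q : p \in s -> q \in s -> p != q -> p v + q v <= 1.
  move=> ps qs pq; have := sep p q ps qs pq.
  have h0 (r : point R X) : 0 < r v -> geodist setT (vx v) r = 1 - r v.
    move=> rv; have hr := bary_le1 r v.
    by case: (edge r rv) => hh; [have vc := va|have vc := vb];
      rewrite (geodist_edge gX vc (vertex_in_edge R vc) hh) // vertex_self ger0_norm //; lra.
  have [pv|pv] := leP (p v) 0; first by have := bary_le1 q v; lra.
  have [qv|qv] := leP (q v) 0; first by have := bary_le1 p v; lra.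
  have := geodist_triangle gX.1 (I : setT p) (I : setT (vx v)) (I : setT q).
  by rewrite (geodist_sym _ p (vx v)) !h0 //; lra.
rewrite (bigID (fun p : point R X => 0 < p v)) /= [X in _ + X]big1 ?addr0; last first.
  by move=> p; rewrite lt_neqAle bary_ge0 andbT negbK => /eqP.
rewrite -big_filter; set t := [seq p <- s | _].
have ts p : p \in t -> p \in s /\ 0 < p v by rewrite mem_filter => /andP[].
have : uniq t by exact: filter_uniq.
case: t ts => [|p [|q [|r t]]] ts.
- by rewrite big_nil ler01.
- by rewrite big_seq1 bary_le1.
- rewrite cons_uniq mem_seq1 andbT => pq; rewrite !big_cons big_nil addr0.
  by apply: far pq; [case: (ts p)|case: (ts q)]; rewrite ?inE ?eqxx ?orbT.
have [ps pv] : p \in s /\ 0 < p v by apply: ts; rewrite inE eqxx.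
have [qs qv] : q \in s /\ 0 < q v by apply: ts; rewrite !inE eqxx orbT.
have [rs rv] : r \in s /\ 0 < r v by apply: ts; rewrite !inE eqxx !orbT.
move=> ut.
have pq : p != q by apply: contraTneq ut => ->; rewrite cons_uniq mem_head.
have pr : p != r by apply: contraTneq ut => ->; rewrite cons_uniq in_cons mem_head orbT.
have qr : q != r by apply: contraTneq ut => ->; rewrite !cons_uniq (mem_head r) andbF.
have no c (p' q' : point R X) : adj v c -> p' \in s -> q' \in s -> 0 < p' v -> 0 < q' v ->
    p' != q' -> in_simplex [:: v; c] p' -> in_simplex [:: v; c] q' -> False.
  by move=> vc ps' qs' pv' qv' + hp hq; rewrite (same c p' q') ?eqxx.
case: (edge p pv) => hp; case: (edge q qv) => hq; case: (edge r rv) => hr; exfalso;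
  by [exact: no _ _ _ va ps qs pv qv pq hp hq|exact: no _ _ _ vb ps qs pv qv pq hp hq
  |exact: no _ _ _ va ps rs pv rv pr hp hr|exact: no _ _ _ vb ps rs pv rv pr hp hr
  |exact: no _ _ _ va qs rs qv rv qr hq hr|exact: no _ _ _ vb qs rs qv rv qr hq hr].
Qed.

(** Double counting: the coordinates of one point sum to 1, and the coordinates of all points at one
    vertex sum to at most 1. The bound applies to arbitrary points, hence to images of vertices
    under an isometry. *)
Lemma two_regular_packing (V : seq X) (s : seq (point R X)) : uniq V ->
  (forall x, x \in V) -> uniq s ->
  {in s &, forall p q, p != q -> 1 <= geodist setT p q} -> (size s <= size V)%N.
Proof.
move=> uV hV us sep; rewrite -(ler_nat R).
have sum1 (p : point R X) : \sum_(v <- V) p v = 1.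
  have [t tK pt] := baryP p; have [_ h <-] := pt.
  have ut := graph_simplices_uniq tK.
  rewrite (bigID (fun v => v \in t)) /= [X in _ + X]big1 ?addr0; last by move=> v; exact: h.
  rewrite -big_filter; apply: perm_big; apply: uniq_perm => //; first exact: filter_uniq.
  by move=> v; rewrite mem_filter hV andbT.
rewrite (_ : (size s)%:R = \sum_(p <- s) \sum_(v <- V) p v); last first.
  rewrite (eq_bigr (fun=> 1)) => [|p _]; last exact: sum1.
  by rewrite big_const_seq count_predT iter_addr_0.
rewrite exchange_big /= (_ : (size V)%:R = \sum_(v <- V) 1); last first.
  by rewrite big_const_seq count_predT iter_addr_0.
by apply: ler_sum => v _; exact: two_regular_packing_vertex.
Qed.

End Packing.

Section Periods.
Variable X : graph.
Hypothesis X2 : two_regular X.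
Implicit Type u : int -> X.

Lemma period_mul u (n q i : int) : non_backtracking u -> u n = u 0 -> u (i + q * n) = u i.
Proof.
move=> uP e; have step j : u (j + n) = u j.
  by have := non_backtracking_period X2 j uP e; rewrite add0r addrC.
elim/int_ind: q => [|q IH|q IH]; first by rewrite mul0r addr0.
  by rewrite -IH -[in RHS]step; congr u; rewrite intS; ring.
by rewrite -IH -step; congr u; rewrite intS; ring.
Qed.

Lemma period_sub u (i j : int) : non_backtracking u -> u i = u j -> u (i - j) = u 0.
Proof. by move=> uP /(non_backtracking_period X2 (- j) uP); rewrite subrr. Qed.

Lemma period_ex u (i j : int) : non_backtracking u -> i != j -> u i = u j ->
  exists2 n : nat, (0 < n)%N & u n = u 0.
Proof.
move=> uP ij uij; exists `|i - j|%N; first by lia.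
have [h|h] : `|i - j|%N = i - j :> int \/ `|i - j|%N = j - i :> int by lia.
  by rewrite h period_sub.
by rewrite h period_sub.
Qed.

Lemma period_repr u (n : nat) x : non_backtracking u -> (0 < n)%N -> u n = u 0 ->
  exists2 r : nat, (r < n)%N & u r = x.
Proof.
move=> uP n0 e; have [i <-] := non_backtracking_surj X2 x uP.
have n0' : n%:Z != 0 by lia.
have := modz_ge0 i n0'; have := ltz_pmod i (n0 : 0 < n%:Z); have := divz_eq i n.
case: (i %% _)%Z => // r ei rn _; exists r; first by lia.
by rewrite ei addrC period_mul.
Qed.

Lemma minimal_period u (n : nat) : non_backtracking u -> (0 < n)%N -> u n = u 0 ->
  exists m : nat, [/\ (0 < m)%N, u m = u 0,
    forall d : int, u d = u 0 -> exists q, d = q * m%:Z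
    & forall k : nat, (0 < k)%N -> u k = u 0 -> (m <= k)%N].
Proof.
move=> uP n0 e; have ex : exists m : nat, (0 < m)%N && (u m == u 0) by exists n;
  rewrite n0 e eqxx.
have [m /andP[m0 /eqP um] min] := ex_minnP ex; exists m; split=> //; last first.
  by move=> k k0 uk; apply: min; rewrite k0 uk eqxx.
move=> d ud; exists (d %/ m%:Z)%Z.
have := divz_eq d m; have m0' : m%:Z != 0 by lia.
have := modz_ge0 d m0'; have := ltz_pmod d (m0 : 0 < m%:Z).
set q := (_ %/ _)%Z; case: (d %% _)%Z => [r|//] h1 _ h3; rewrite h3.
have [->|r0] := posnP r; first by rewrite addr0.
have ur : u r = u 0 by rewrite -ud h3 addrC period_mul.
by have := min r; rewrite r0 ur eqxx => /(_ isT); lia.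
Qed.

End Periods.

(** Every period of [u] is one of [v], so sending [u i] to [v i] is well defined; it respects the
    two neighbours on either side. *)
Lemma non_backtracking_covers (X Y : graph) (u : int -> X) (v : int -> Y) :
  two_regular X -> two_regular Y -> non_backtracking u -> non_backtracking v ->
  (forall i j, u i = u j -> v i = v j) -> covers X Y.
Proof.
move=> X2 Y2 uP vP uv.
have /choice[k kP] : forall x, exists i, u i = x by move=> x; exact: non_backtracking_surj.
pose f x := v (k x); have fE i : f (u i) = v i by apply: uv; rewrite kP.
have prev (Z : graph) (w : int -> Z) i : non_backtracking w ->
    adj (w i) (w (i - 1)) /\ w (i + 1) != w (i - 1).
  move=> wP; have := wP (i - 1); rewrite subrK adj_sym (_ : i - 1 + 2 = i + 1) //.
  by ring.
exists f; split.
  by move=> y _; have [i <-] := non_backtracking_surj Y2 y vP; exists (u i).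
move=> x; have [i <-] := non_backtracking_surj X2 x uP; rewrite fE.
have [v1 _] := vP i; have [v2 v3] := prev _ _ i vP.
have [u1 _] := uP i; have [u2 u3] := prev _ _ i uP; split.
- by move=> a /= /(non_backtracking_nbr X2 uP)[->|->]; rewrite fE.
- move=> a b; rewrite !inE /= => /(non_backtracking_nbr X2 uP) ha.
  move=> /(non_backtracking_nbr X2 uP) hb.
  by case: ha => ->; case: hb => -> //; rewrite !fE => e; rewrite e eqxx in v3.
- move=> b /= /(non_backtracking_nbr Y2 vP)[->|->].
    by exists (u (i - 1)); rewrite ?fE.
  by exists (u (i + 1)); rewrite ?fE.
Qed.

Section TwoRegularIsometry.
Variable R : realType.
Local Notation vx := (@vertex_point R _).

(** If [u 0, ..., u n] were distinct, their images would be [n + 1] points at mutual distance at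
    least 1 in a graph with at most [n] vertices. Two of them coincide, and their difference is a
    period. *)
Lemma isometry_period (X Y : graph) (f : point R X -> point R Y) (u : int -> X) (v : int -> Y)
    (n : nat) :
  isometry setT setT f -> two_regular X -> two_regular Y ->
  non_backtracking u -> non_backtracking v -> (0 < n)%N -> v n = v 0 ->
  exists m : nat, [/\ (0 < m)%N, (m <= n)%N & u m = u 0].
Proof.
move=> [[_ fI _] fD] X2 Y2 uP vP n0 vn.
pose V := undup [seq v (Posz i) | i <- iota 0 n].
have hV y : y \in V.
  have [r rn <-] := period_repr Y2 y vP n0 vn.
  by rewrite mem_undup; apply: (map_f (fun i => v (Posz i))); rewrite mem_iota.
have sV : (size V <= n)%N by apply: leq_trans (size_undup _) _; rewrite size_map size_iota.
pose s := [seq u (Posz i) | i <- iota 0 n.+1].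
have [us|nus] := boolP (uniq s).
  exfalso; have : (size [seq f (vx x) | x <- s] <= size V)%N.
    apply: (two_regular_packing Y2 (undup_uniq _) hV).
      by rewrite map_inj_uniq // => a b e; apply: (@vertex_inj R); apply: fI e; rewrite inE.
    move=> p q /mapP[a _ ->] /mapP[b _ ->] ab; rewrite fD //.
    by apply: geodist_vertex_ge1; apply: contraNneq ab => ->.
  by rewrite !size_map size_iota => h; have := leq_trans h sV; rewrite ltnn.
have [x] := vertex_inh X.
have := nus => /(uniqPn x)[i [j [ij]]]; rewrite size_map size_iota => jn.
rewrite !(nth_map 0%N) ?size_iota ?(ltn_trans ij) // !nth_iota ?(ltn_trans ij) // !add0n.
move=> /esym /(period_sub X2 uP) e; exists (j - i)%N; split; [lia|lia|].
by rewrite -e; congr u; lia.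
Qed.

Lemma two_regular_isometric_covers (X Y : graph) : two_regular X -> two_regular Y ->
  isometric R X Y -> covers X Y.
Proof.
move=> X2 Y2 [f fP]; have [g [gP _ _]] := isometry_inv fP.
have [u uP] := non_backtracking_ex X2; have [v vP] := non_backtracking_ex Y2.
apply: (non_backtracking_covers X2 Y2 uP vP) => i j uij.
have [->//|ij] := eqVneq i j.
have [n n0 un] := period_ex X2 uP ij uij.
(* The minimal period [m] of [u] bounds a period [m'] of [v], which in turn bounds a period of [u];
   hence [m' = m], and all periods of [u] are periods of [v]. *)
have [m [m0 um md mmin]] := minimal_period X2 uP n0 un.
have [m' [m'0 m'm vm']] := isometry_period gP Y2 X2 vP uP m0 um.
have [m2 [m20 m2m um2]] := isometry_period fP X2 Y2 uP vP m'0 vm'.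
have e : m' = m by have := mmin _ m20 um2; lia.
subst m'; have [q e] := md _ (period_sub X2 uP uij).
by rewrite -(period_mul Y2 q j vP vm') -e addrC subrK.
Qed.

End TwoRegularIsometry.

Definition leaf (X : graph) (v : X) : Prop := forall a b, adj v a -> adj v b -> a = b.

Definition branch (X : graph) (v : X) : Prop := exists a b c,
  [/\ adj v a, adj v b & adj v c] /\ [/\ a != b, a != c & b != c].

Lemma two_regular_or (X : graph) : two_regular X \/ exists v : X, leaf v \/ branch v.
Proof.
have [|h] := pselect (exists v : X, leaf v \/ branch v); first by right.
left=> x; have [[a [b [xa xb ab]]]|h1] := pselect (exists a b, [/\ adj x a, adj x b & a != b]).
  exists a, b; split=> // c xc; apply: contrapT => hc; apply: h; exists x; right.
  exists a, b, c; split=> //; split=> //; apply/eqP => e; subst c; apply: hc; by [left|right].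
exfalso; apply: h; exists x; left=> a b xa xb; apply/eqP; apply: contraT => ab.
by exfalso; apply: h1; exists a, b.
Qed.

Lemma graph_iso_covers (X Y : graph) (g : X -> Y) g' : graph_iso g g' -> covers X Y.
Proof.
move=> [gK gK' ga ga']; exists g; split; first by move=> y _; exists (g' y).
move=> x; split=> [a|a b|b] /=.
- exact: ga.
- by rewrite !inE => _ _ /(can_inj gK).
- by move=> /ga'; rewrite gK => h; exists (g' b).
Qed.

Section IsometryCovers.
Variable R : realType.
Local Notation vx := (@vertex_point R _).

Lemma isometry_special_vertex (X Y : graph) (f : point R X -> point R Y) v :
  isometry setT setT f -> leaf v \/ branch v -> exists u, f (vx v) = vx u.
Proof.
move=> fP [h|[a [b [c [[va vb vc] [ab ac bc]]]]]]; first exact: isometry_leaf_vertex fP h.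
exact: (isometry_branch_vertex (goodT R X) (goodT R Y) fP va vb vc ab ac bc).
Qed.

Lemma isometric_covers (X Y : graph) : isometric R X Y -> covers X Y.
Proof.
move=> XY; have [f fP] := XY; have [g [gP gf fg]] := isometry_inv fP.
have [X2|[v /(isometry_special_vertex fP)[u fv]]] := two_regular_or X; last first.
  by have [h [h' [hP _]]] := anchored_isometry_iso fP fv; exact: graph_iso_covers hP.
have [Y2|[v /(isometry_special_vertex gP)[u gv]]] := two_regular_or Y; last first.
  have fu : f (vx u) = vx v by rewrite -gv fg.
  by have [h [h' [hP _]]] := anchored_isometry_iso fP fu; exact: graph_iso_covers hP.
exact: (@two_regular_isometric_covers R).
Qed.

End IsometryCovers.

(** * Cocompact graphs *)

Definition bounded_graph (X : graph) : Prop := exists n, forall x v : X, (dist x v <= n)%N.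

Lemma bounded_graph_from (X : graph) (x : X) n : (forall v, (dist x v <= n)%N) ->
  bounded_graph X.
Proof.
move=> h; exists (n + n)%N => a b; apply: leq_trans (dist_triangle a x b) _.
by rewrite leq_add // dist_sym.
Qed.

Lemma unbounded_graph_far (X : graph) (x : X) n : ~ bounded_graph X ->
  exists v, (n < dist x v)%N.
Proof.
move=> hX; apply: contrapT => h; apply: hX; apply: (@bounded_graph_from X x n) => v.
by rewrite leqNgt; apply/negP => hv; apply: h; exists v.
Qed.

Lemma dist_onto (X : graph) (x v : X) m : (m <= dist x v)%N -> exists u, dist x u = m.
Proof.
have [d e] : exists d, dist x v = d by exists (dist x v).
elim: d v e => [|d IH] v e; rewrite e; first by rewrite leqn0 => /eqP ->; exists v.
rewrite leq_eqVlt => /orP[/eqP ->|]; first by exists v.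
by have [y _ dy] := dist_pred e; rewrite ltnS -{1}dy; exact: IH.
Qed.

(** * Balls exhausting a bounded graph *)

Section FiniteBalls.
Variable R : realType.
Local Notation vx := (@vertex_point R _).

Lemma gball_bounded (X : graph) (x : X) n (r : R) : (forall v, (dist x v <= n)%N) ->
  n%:R + 1 <= r -> gball x r = setT.
Proof.
move=> hn hr; rewrite gballE; apply/seteqP; split=> // p _.
have [a pa] := bary_pos p; exists a => //.
have : (dist x a)%:R <= n%:R :> R by rewrite ler_nat.
by have := bary_le1 p a; lra.
Qed.

(** Every point of [X] is within [n + 1] of [x], so distances are at most [2 n + 2]. A vertex at
    distance [2 n + 3] from [y] would still belong to the ball and contradict this; so both balls
    are the whole graphs. *)
Lemma bounded_ball_isometric (X Y : graph) (x : X) (y : Y) n :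
  (forall x v : X, (dist x v <= n)%N) ->
  isometric_sets (gball x ((2 * n + 3)%N%:R + 2^-1 : R)) (gball y ((2 * n + 3)%N%:R + 2^-1)) ->
  isometric R X Y.
Proof.
move=> hn [f fP]; set r : R := _ + _ in fP.
have rE : r = 2 * n%:R + 3 + 2^-1 by rewrite /r natrD natrM.
have n0 : 0 <= n%:R :> R by exact: ler0n.
have xT : gball x r = setT by apply: (gball_bounded (hn x)); lra.
have hy v : (dist y v <= 2 * n + 2)%N.
  rewrite leqNgt; apply/negP => hv.
  have [u du] := dist_onto hv; have Bu : gball y r (vx u).
    by apply/(gball_vertex R); rewrite du addn3 addn2.
  have By : gball y r (vx y) by apply/(gball_vertex R); rewrite distxx.
  have [g [[[gB _ _] gD] gf fg]] := isometry_inv fP.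
  have near p : geodist setT (vx x) p <= n%:R + 1.
    by have : gball x (n%:R + 1) p by rewrite (gball_bounded (hn x)).
  have := geodist_triangle (goodT R X).1 (I : setT (g (vx y))) (I : setT (vx x))
    (I : setT (g (vx u))).
  rewrite -{1}xT gD // (geodist_sym _ _ (vx x)) => h.
  have h1 := near (g (vx y)); have h2 := near (g (vx u)).
  have hr : geodist (gball y r) (vx y) (vx u) <= 2 * n%:R + 2 by lra.
  have [a /vertex_pos -> ] := geodist_vertex_near (@pconnected_gball R _ y r) By Bu hr.
  by rewrite vertex_self subrr addr0 du -natr1 natrD natrM; lra.
have yT : gball y r = setT by apply: (gball_bounded hy); rewrite natrD natrM; lra.
by exists f; rewrite -xT -yT.
Qed.

End FiniteBalls.

(** * Orbits under automorphisms *)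

Section Orbits.
Variables (R : realType) (X : graph).
Local Notation vx := (@vertex_point R _).

Lemma graph_iso_pointed n (Y Z : graph) (g : Y -> Z) g' x : graph_iso g g' ->
  pointed_iso n x (g x).
Proof.
move=> [gK gK' ga ga']; exists g, g'; split=> //.
- move=> a xa; split=> //; apply: leq_trans xa.
  by apply: (@pointed_map_dist_le (dist x a)) => // b c _ _; exact: ga.
- move=> a xa; split=> //; apply: leq_trans xa; rewrite -{1}(gK x).
  by apply: (@pointed_map_dist_le (dist (g x) a)) => // b c _ _; exact: ga'.
- by move=> b c _ _; exact: ga.
- by move=> b c _ _; exact: ga'.
Qed.

Lemma graph_iso_dist (Y Z : graph) (g : Y -> Z) g' x y : graph_iso g g' ->
  dist (g x) (g y) = dist x y.
Proof.
move=> [gK gK' ga ga']; apply/eqP; rewrite eqn_leq; apply/andP; split.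
  by apply: (@pointed_map_dist_le (dist x y)) => // b c _ _; exact: ga.
rewrite -{1}(gK x) -{1}(gK y).
by apply: (@pointed_map_dist_le (dist (g x) (g y))) => // b c _ _; exact: ga'.
Qed.

Hypothesis hc : cocompact_isometry_group R X.

Lemma cocompact_automorphisms : exists s : seq X, forall x, exists2 y, y \in s &
  exists (a a' : X -> X), graph_iso a a' /\ a y = x.
Proof.
have [s hs] := hc; exists s => x; have [y ys [g gP gy]] := hs x; exists y => //.
exact: anchored_isometry_iso gP gy.
Qed.

(** [S] is the largest distance between orbit representatives: [x] is moved to its representative,
    then by the automorphism taking the representative of [z] to [z]. *)
Lemma cocompact_dense : exists S, forall x z : X,
  exists (a a' : X -> X), graph_iso a a' /\ (dist z (a x) <= S)%N.
Proof.
have [s hs] := cocompact_automorphisms.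
exists (\max_(y <- s) \max_(y' <- s) dist y y') => x z.
have [y ys [a [a' [aP <-]]]] := hs z; have [y' ys' [b [b' [bP <-]]]] := hs x.
exists (a \o b'), (b \o a'); split=> /=; last first.
  have [bK _ _ _] := bP; rewrite bK (graph_iso_dist _ _ aP).
  apply: leq_trans (_ : \max_(y' <- s) dist y y' <= _)%N.
    exact: (leq_bigmax_seq (F := fun y' => dist y y')).
  exact: (leq_bigmax_seq (F := fun y => \max_(y' <- s) dist y y')).
have [[aK a'K aa aa'] [bK b'K bb bb']] := (aP, bP); split.
- by move=> v /=; rewrite aK b'K.
- by move=> v /=; rewrite bK a'K.
- by move=> v v' vv; exact/aa/bb'.
- by move=> v v' vv; exact/bb/aa'.
Qed.

(** Two vertices on one sphere would share their predecessor by induction, and that vertex would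
    branch; at the first step the leaf itself forbids it. *)
Lemma leaf_sphere (x : X) : leaf x -> (forall v : X, ~ branch v) ->
  forall a b, dist x a = dist x b -> a = b.
Proof.
move=> lx nb a; have [d e] : exists d, dist x a = d by exists (dist x a).
elim: d a e => [|d IH] a ea b eab; first by rewrite -(dist0_eq ea) (@dist0_eq X x b) // -eab.
have [y ya dy] := dist_pred ea; have eb : dist x b = d.+1 by rewrite -eab.
have [y' yb dy'] := dist_pred eb.
have yy : y = y' by apply: IH => //; rewrite dy dy'.
subst y'; case: d {IH} => [|d] in ea eb dy dy' *.
  by have xy := dist0_eq dy; rewrite -xy in ya yb; exact: lx ya yb.
have [c cy dc] := dist_pred dy; apply/eqP; apply: contraT => ab; exfalso; apply: (nb y).
exists c, a, b; rewrite adj_sym cy; split=> //; split=> //.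
  by apply: contra_eq_neq dc => ->; rewrite ea; lia.
by apply: contra_eq_neq dc => ->; rewrite eb; lia.
Qed.

(** The graph would be a ray from [x]. A translate of the leaf different from [x] has a neighbour
    closer to [x] and, the ray being infinite, another one farther away. *)
Lemma unbounded_cocompact_no_leaf (x : X) : ~ bounded_graph X -> (forall v : X, ~ branch v) ->
  ~ leaf x.
Proof.
move=> ub nb lx; have [S hS] := cocompact_dense.
have [v hv] := unbounded_graph_far x S ub.
have [a [a' [aP da]]] := hS x v; have [aK a'K aa aa'] := aP.
have lax : leaf (a x).
  move=> b c /aa' + /aa'; rewrite aK => xb xc.
  by rewrite -(a'K b) -(a'K c); congr a; exact: lx.
have [m e] : exists m, dist x (a x) = m.+1.
  case e : (dist x (a x)) => [|m]; last by exists m.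
  by exfalso; have := leq_trans hv; rewrite (dist0_eq e) dist_sym => /(_ _ da); rewrite ltnn.
have [w hw] := unbounded_graph_far x m.+1 ub; have [z ez] := dist_onto hw.
have [y yz dy] := dist_pred ez.
have ya : y = a x by apply: (leaf_sphere lx nb); rewrite dy e.
have [y' yy' dy'] := dist_pred e; rewrite ya in yz.
by move: ez; rewrite -(lax y' z _ yz) 1?adj_sym // dy'; lia.
Qed.

End Orbits.

(** * The line *)

Section Line.
Variables (R : realType) (X : graph).
Local Notation vx := (@vertex_point R _).
Hypotheses (X2 : two_regular X) (ub : ~ bounded_graph X).
Variable u : int -> X.
Hypothesis uP : non_backtracking u.

Lemma dist_non_backtracking_le (i : int) (n : nat) : (dist (u i) (u (i + n%:Z)) <= n)%N.
Proof.
elim: n => [|n IH]; first by rewrite addr0 distxx.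
have [h _] := uP (i + n%:Z); rewrite -addrA (_ : n%:Z + 1 = n.+1) // in h; last by lia.
by apply: leq_trans (dist_adj_le _ h) _; rewrite ltnS.
Qed.

Lemma non_backtracking_inj : injective u.
Proof.
move=> i j uij; apply/eqP; apply: contraT => ij; exfalso; apply: ub.
have [n n0 un] := period_ex X2 uP ij uij.
apply: (@bounded_graph_from X (u 0) n) => v.
have [r rn <-] := period_repr X2 v uP n0 un.
by have := dist_non_backtracking_le 0 r; rewrite add0r => h; apply: leq_trans h (ltnW rn).
Qed.

Lemma dist_non_backtracking_ge (i j : int) : (`|i - j| <= dist (u i) (u j))%N.
Proof.
have [w [pw lw <-]] := distP (u i) (u j); elim: w i pw lw => [|c w IH] i /=.
  by move=> _ /non_backtracking_inj ->; rewrite subrr.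
move=> /andP[ic pw] lw; have [e|e] := non_backtracking_nbr X2 uP ic; subst c;
  by have := IH _ pw lw; lia.
Qed.

Lemma near_two_ends (n : nat) (q : point R X) :
  near_ball (u n.+1%:Z) n.+1%:R q -> near_ball (u (- n.+1%:Z)) n.+1%:R q -> q = vx (u 0).
Proof.
move=> [a qa ha] [b qb hb].
have [i ei] := non_backtracking_surj X2 a uP; have [j ej] := non_backtracking_surj X2 b uP.
subst a b.
have gi : n.+1%:R - i%:~R <= (dist (u n.+1%:Z) (u i))%:R :> R.
  apply: le_trans (_ : (`|n.+1%:Z - i|%N)%:R <= _);
    last by rewrite ler_nat dist_non_backtracking_ge.
  by rewrite natr_absz (pmulrn 1 n.+1) -rmorphB ler_int; lia.
have gj : n.+1%:R + j%:~R <= (dist (u (- n.+1%:Z)) (u j))%:R :> R.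
  apply: le_trans (_ : (`|- n.+1%:Z - j|%N)%:R <= _);
    last by rewrite ler_nat dist_non_backtracking_ge.
  by rewrite natr_absz (pmulrn 1 n.+1) -rmorphD ler_int; lia.
have qi := bary_le1 q (u i); have qj := bary_le1 q (u j).
have [ij|ij] := eqVneq (u i) (u j).
  have e := non_backtracking_inj ij; subst j.
  have i0 : i = 0.
    have : (-1)%:~R < i%:~R :> R by rewrite mulrNz; lra.
    have : i%:~R < 1%:~R :> R by lra.
    by rewrite !ltr_int; lia.
  by subst i; apply: bary_eq1; lra.
have [aij eij] := pos2_in_edge ij qa qb; have es := edge_sum eij; exfalso.
have i0 : 0 <= i by rewrite -(ler_int R) mulr0z; lra.
have j0 : j <= 0 by rewrite -(ler_int R) mulr0z; lra.
have [j00|i00] : j = 0 \/ i = 0.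
  have := non_backtracking_nbr X2 uP aij; clear -i0 j0 ub uP X2.
  by case=> /non_backtracking_inj; lia.
  have jR : j%:~R = 0 :> R by rewrite j00.
  by lra.
have iR : i%:~R = 0 :> R by rewrite i00.
by lra.
Qed.

End Line.

Section LocalIsometries.
Variables (R : realType) (X : graph).
Local Notation vx := (@vertex_point R _).

Lemma geodist_sub (A : set (point R X)) p q : pconnected A -> A p -> A q ->
  geodist setT p q <= geodist A p q.
Proof.
move=> pA Ap Aq; have [l hl] := pA p q Ap Aq; apply: geodist_ge hl _ => l' h.
by apply: geodist_le; exact: pl_path_sub h.
Qed.

(** The ball of a line is a segment. The preimage [q] of the centre [y] is within [n + 1/2] of both
    end points, hence is the middle. *)
Lemma line_ball_center (Y : graph) (x : X) (y : Y) n f : two_regular X -> ~ bounded_graph X ->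
  isometry (gball x (n%:R + 2^-1 : R)) (gball y (n%:R + 2^-1)) f -> f (vx x) = vx y.
Proof.
move=> X2 ub fP; have [v vP] := non_backtracking_ex X2.
have [i0 vi0] := non_backtracking_surj X2 x vP.
pose u i := v (i + i0); have uP : non_backtracking u := non_backtracking_shift i0 vP.
have ux : u 0 = x by rewrite /u add0r.
have [g [gP gf fg]] := isometry_inv fP; have [[fA _ _] fD] := fP; have [[gB _ _] gD] := gP.
set A := gball x _ in fP fA gf fD gB gD *; set B := gball y _ in fP fA fg gB gD fD *.
have pA : pconnected A := @pconnected_gball R X x _.
have By : B (vx y) by apply/(gball_vertex R); rewrite distxx.
have Aq := gB _ By; set q := g (vx y) in Aq.
suff e : q = vx x by rewrite -e fg.
(* In the two uses below [m] is an end point of the segment; another half edge leads from it to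
   [w'], whence the radius [n + 1]. *)
have end_ w w' : (dist x w <= n)%N -> adj w w' -> near_ball w' n.+1%:R q.
  move=> dw ww; have [m [mw mh]] := midpoint R ww.
  have Am : A m by apply: half_edge_in_ball dw ww mw _; rewrite mh.
  apply: (geodist_vertex_near (goodT R X).1) => //.
  have := geodist_triangle (goodT R X).1 (I : setT (vx w')) (I : setT m) (I : setT q).
  have := geodist_sub pA Aq Am; rewrite (geodist_sym _ q m).
  have : geodist A q m <= n%:R + 2^-1.
    by rewrite -(gf m) // -/q gD //; [exact: geodist_gball_le (fA _ Am)|exact: fA].
  have w'w : adj w' w by rewrite adj_sym.
  have e1 := edge_sum mw;
    rewrite (geodist_edge (goodT R X) w'w (vertex_in_edge R w'w) (edge_sym mw)) //.
  by rewrite vertex_self -(natr1 n) ger0_norm; lra.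
have r1 := dist_non_backtracking_le uP 0 n; rewrite add0r ux in r1.
have := dist_non_backtracking_le uP (- n%:Z) n; rewrite addNr ux dist_sym => r2.
have [a1 _] := uP n%:Z; have [a2 _] := uP (- n.+1%:Z).
rewrite (_ : n%:Z + 1 = n.+1%:Z) in a1; last by lia.
rewrite (_ : - n.+1%:Z + 1 = - n%:Z) in a2; last by lia.
rewrite adj_sym in a2; rewrite -ux.
exact: (near_two_ends X2 ub uP (end_ _ _ r1 a1) (end_ _ _ r2 a2)).
Qed.

Lemma locally_graph_pointed_iso : cocompact_isometry_group R X -> ~ bounded_graph X ->
  exists n0, forall n (Y : graph), (n0 <= n)%N -> locally_graph (n%:R + 2^-1 : R) X Y ->
  forall y : Y, exists p : X, pointed_iso n p y.
Proof.
move=> hc ub; have [[v bv]|nb] := pselect (exists v : X, branch v); last first.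
  have {}nb (v : X) : ~ branch v by move=> bv; apply: nb; exists v.
  have X2 : two_regular X.
    have [//|[v [lv|bv]]] := two_regular_or X; last by case: (nb v).
    by case: (unbounded_cocompact_no_leaf hc ub nb lv).
  exists 0%N => n Y _ hY y; have [x [f fP]] := hY y.
  apply: (ball_isometry_pointed fP (v0 := x)); first by rewrite distxx.
  exact: line_ball_center X2 ub fP.
(* From this radius on, every ball contains a translate of the branching vertex [v]. *)
have [S hS] := cocompact_dense hc; exists S => n Y Sn hY y.
have [x [f fP]] := hY y; have [a [a' [[aK a'K aa _] da]]] := hS v x.
have dn := leq_trans da Sn.
have [b1 [b2 [b3 [[v1 v2 v3] [n12 n13 n23]]]]] := bv.
have ai := can_inj aK.
have [u fu] : exists u, f (vx (a v)) = vx u.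
  apply: (isometry_branch_vertex (good_gball R x n) (good_gball R y n) fP
    (aa _ _ v1) (aa _ _ v2) (aa _ _ v3)); rewrite ?(inj_eq ai) //.
    exact/gball_vertex.
  by move=> b q vb qb qh; exact: half_edge_in_ball dn vb qb qh.
exact: ball_isometry_pointed fP dn fu.
Qed.

End LocalIsometries.

(** * Rigidity *)

Lemma map_inv_walk (X Y : graph) (f : X -> Y) x w :
  map f (inv_walk x w) = inv_walk (f x) (map f w).
Proof. by rewrite /inv_walk map_rev belast_map. Qed.

(** * Coverings that are isomorphisms on small balls *)

Section Lifting.
Variables (Z Y : graph) (f : Z -> Y).
Hypothesis fP : locally_bijective f.

(** When the lift of the concatenation closes up, its second half read backwards is the lift of
    [w2]. *)
Lemma lift_same_end z w1 w2 : path (@adj Y) (f z) w1 -> path (@adj Y) (f z) w2 ->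
  last (f z) w1 = last (f z) w2 ->
  last z (lift f z (w1 ++ inv_walk (f z) w2)) = z ->
  last z (lift f z w1) = last z (lift f z w2).
Proof.
move=> p1 p2 e12; rewrite lift_cat last_cat; set z1 := last z (lift f z w1) => ev.
set v := lift f z1 _ in ev.
have fz1 : f z1 = last (f z) w2 by rewrite f_last_lift.
have pi : path (@adj Y) (f z1) (inv_walk (f z) w2) by rewrite fz1; exact: path_inv_walk.
have [pv fv] := lift_path fP pi.
have := lift_map fP (path_inv_walk pv); rewrite map_inv_walk fv ev fz1 inv_walkK => ->.
by have := last_inv_walk z1 v; rewrite ev => ->.
Qed.

Variable n : nat.
Variable u : Z.
Hypothesis short : forall w, path (@adj Y) (f u) w -> last (f u) w = f u ->
  (size w <= 2 * n + 1)%N -> last u (lift f u w) = u.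

(** Two geodesics of length at most [n] and one edge make a closed walk of length at most [2 n + 1].
    When these lift to closed walks, [f] is injective on the ball and the inverse respects edges. *)
Lemma short_loops_pointed_iso : pointed_iso n u (f u).
Proof.
have same w1 w2 : path (@adj Y) (f u) w1 -> path (@adj Y) (f u) w2 ->
    last (f u) w1 = last (f u) w2 -> (size w1 + size w2 <= 2 * n + 1)%N ->
    last u (lift f u w1) = last u (lift f u w2).
  move=> p1 p2 e s; apply: lift_same_end => //; apply: short.
  - by rewrite cat_path p1 e path_inv_walk.
  - by rewrite last_cat e last_inv_walk.
  - by rewrite size_cat size_inv_walk.
have /choice[W WP] : forall b, exists w,
    [/\ path (@adj Y) (f u) w, last (f u) w = b & size w = dist (f u) b] by move=> b;
      exact: distP.
pose g' b := last u (lift f u (W b)).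
have fd a : (dist (f u) (f a) <= dist u a)%N.
  have [w [pw <- <-]] := distP u a; rewrite -last_map -(size_map f).
  exact: dist_le_walk (path_map_lb fP pw).
have fg' b : f (g' b) = b by have [pw lw _] := WP b; rewrite f_last_lift.
exists f, g'; split=> //.
- move=> a ua; have fua := leq_trans (fd a) ua; split=> //.
  have [w [pw lw sw]] := distP u a; have [pW lW sW] := WP (f a).
  rewrite /g' -(same (map f w)) ?lift_map ?lw //; first exact: path_map_lb.
    by rewrite last_map lw.
  by rewrite size_map sw sW; lia.
- move=> b ub; split=> //; have [pW lW sW] := WP b.
  apply: leq_trans ub; rewrite -sW -(size_lift f u).
  by apply: dist_le_walk; case: (lift_path fP pW).
- by move=> a b _ _; exact: lb_adj.
- move=> a b ua ub ab; have [pa la sa] := WP a; have [pb lb sb] := WP b.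
  have pab : path (@adj Y) (f u) (W a ++ [:: b]) by rewrite cat_path pa la /= ab.
  have lab : last (f u) (W a ++ [:: b]) = b by rewrite last_cat.
  rewrite /g' -(same _ _ pab pb) ?lab ?lb //; last by rewrite size_cat /=; lia.
  rewrite lift_cat last_cat -/(g' a) /=.
  by have [|] := @nbP _ _ _ fP (g' a) b; rewrite ?fg'.
Qed.

End Lifting.

(** * Counting closed walks *)

Section ClosedWalks.
Variable L : nat.

Lemma ex_closed_walks (X : graph) (x : X) : exists2 ws : seq (seq X), uniq ws &
  forall w, w \in ws <-> [/\ path (@adj X) x w, last x w = x & (size w <= L)%N].
Proof.
have [ws wsP] := ex_walks L x.
exists (undup [seq w <- ws | [&& path (@adj X) x w, last x w == x & size w <= L]%N]).
  exact: undup_uniq.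
move=> w; rewrite mem_undup mem_filter; split.
  by move=> /andP[/and3P[p /eqP l s] _].
by move=> [p l s]; rewrite p l eqxx s wsP.
Qed.

Definition closed_walks (X : graph) (x : X) : seq (seq X) := s2val (cid2 (ex_closed_walks x)).

Lemma closed_walks_uniq (X : graph) (x : X) : uniq (closed_walks x).
Proof. by rewrite /closed_walks; case: cid2. Qed.

Lemma closed_walksP (X : graph) (x : X) w : w \in closed_walks x <->
  [/\ path (@adj X) x w, last x w = x & (size w <= L)%N].
Proof. by rewrite /closed_walks; case: cid2. Qed.

Lemma pointed_iso_closed_walks n (X Y : graph) (x : X) (y : Y) : (L <= n)%N ->
  pointed_iso n x y -> (size (closed_walks x) <= size (closed_walks y))%N.
Proof.
move=> Ln [g [g' [gx h1 h2 a1 a2]]].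
have inb w : w \in closed_walks x -> all (fun a => dist x a <= n)%N w.
  by move=> /closed_walksP[p l s]; apply: walk_in_ball p _; exact: leq_trans Ln.
rewrite -(size_map (map g)); apply: uniq_leq_size.
  rewrite map_inj_in_uniq ?closed_walks_uniq // => w w' /inb hw /inb hw' e.
  have back v : all (fun a => dist x a <= n)%N v -> map g' (map g v) = v.
    by move=> /allP hv; rewrite -map_comp map_id_in // => a /hv /h1[].
  by rewrite -(back w) // e back.
move=> _ /mapP[w ww ->]; have [p l s] := (closed_walksP x w).1 ww; apply/closed_walksP.
split; last by rewrite size_map.
  by rewrite -gx; apply: (@walk_in_map X Y (fun a => dist x a <= n)%N) => //;
    rewrite ?distxx ?inb.
by rewrite -gx last_map l.
Qed.

(** [f] sends the closed walks at [x] injectively to those at [f x]. The inequality makes this onto,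
    so every closed walk below is the image of a closed walk, which is its lift. *)
Lemma covering_closed_walks (X Y : graph) (f : X -> Y) x : locally_bijective f ->
  (size (closed_walks (f x)) <= size (closed_walks x))%N ->
  forall w, path (@adj Y) (f x) w -> last (f x) w = f x -> (size w <= L)%N ->
  last x (lift f x w) = x.
Proof.
move=> fP le w p l s.
have inj : {in closed_walks x &, injective (map f)}.
  move=> v v' /closed_walksP[pv _ _] /closed_walksP[pv' _ _] e.
  by rewrite -(lift_map fP pv) e lift_map.
have sub v : v \in map (map f) (closed_walks x) -> v \in closed_walks (f x).
  move=> /mapP[v' /closed_walksP[pv lv sv] ->]; apply/closed_walksP.
  by rewrite last_map lv size_map; split=> //; exact: path_map_lb.
have u : uniq (map (map f) (closed_walks x)) by rewrite map_inj_in_uniq // closed_walks_uniq.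
have [] := uniq_min_size u sub; first by rewrite size_map.
move=> _ /(_ w) e; have : w \in closed_walks (f x) by exact/closed_walksP.
by rewrite -e => /mapP[v /closed_walksP[pv lv _] ->]; rewrite lift_map.
Qed.

End ClosedWalks.

Lemma pointed_iso_le_radius (R : realType) (r : R) : exists n : nat, r + 1 <= n%:R.
Proof.
exists (Num.bound `|r + 1|); apply: le_trans (ler_norm _) _.
exact/ltW/archi_boundP/normr_ge0.
Qed.

Lemma pointed_iso_locally_graph (R : realType) (r : R) n (X Y : graph) : r + 1 <= n%:R ->
  (forall y : Y, exists x : X, pointed_iso n x y) -> locally_graph r X Y.
Proof.
by move=> rn h y; have [x xy] := h y; exists x; exact: pointed_iso_isometric_balls rn.
Qed.

Lemma covers_trans (X Y Z : graph) (f : Y -> Z) : covers X Y -> locally_bijective f ->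
  (forall z, exists y, f y = z) -> covers X Z.
Proof.
move=> [g [gS gP]] fP fS; exists (f \o g); split.
  by move=> z _; have [y <-] := fS z; have [x _ <-] := gS y I; exists x.
move=> x; have [g1 g2 g3] := gP x; have [f1 f2 f3] := fP (g x); split.
- by move=> a /g1 /f1.
- move=> a b; rewrite !inE /= => ha hb e; apply: g2; rewrite ?inE //.
  by apply: f2; rewrite ?inE //; exact: g1.
- by move=> c /f3[b /g3[a ha <-] <-]; exists a.
Qed.

Lemma injective_covering_iso (X Y : graph) (f : X -> Y) : is_covering f -> injective f ->
  exists f', graph_iso f f'.
Proof.
move=> [fS fP] fI; have /choice[f' f'P] : forall y, exists x, f x = y.
  by move=> y; have [x _] := fS y I; exists x.
exists f'; split=> //.
- by move=> x; apply: fI.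
- by move=> a b; exact: lb_adj.
- move=> a b ab; have [_ _ h] := fP (f' a); have [|c ac e] := h b; first by rewrite /= f'P.
  by have -> : f' b = c by apply: fI; rewrite f'P.
Qed.

(** * The equivalence *)

Section Main.
Variables (R : realType) (k : nat) (X : graph).
Hypotheses (hk : k_simply_connected R k X) (hc : cocompact_isometry_group R X).

(** The cover of [X] by classes of walks is injective by monodromy. A closed walk thus lifts to a
    closed walk, whose contraction upstairs is projected back. *)
Lemma k_simply_connected_simply_loop_connected : simply_loop_connected k X.
Proof.
have [x0] := vertex_inh X.
pose f : ucover k x0 -> X := @uproj k X x0.
have fP : locally_bijective f := @uproj_lb k X x0.
have fK : lifts_loops f k by exact: uproj_lifts_loops.
have fI : injective f := k_simply_connected_covering_injective fP fK hk.
move=> x w pw lw; have [u ux] : exists u, f u = x by exact: uproj_surj.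
rewrite -ux in pw lw *.
have [pl fl] := lift_path fP pw.
have cl : last u (lift f u w) = u by apply: fI; rewrite f_last_lift.
rewrite -fl; apply: (walk_homo_map
  (w' := [::]) _ _ _ (ucover_simply_loop_connected pl cl)) => //.
- by move=> a b _ _; exact: fI.
- by move=> a b _ _; exact: lb_adj.
Qed.

Lemma maximal_closed_walks L : exists x0 : X, forall x : X,
  (size (closed_walks L x) <= size (closed_walks L x0))%N.
Proof.
have [s hs] := cocompact_automorphisms hc.
pose P m := `[< exists x : X, size (closed_walks L x) = m >].
have hx (x : X) : exists2 y, y \in s & size (closed_walks L x) = size (closed_walks L y).
  have [y ys [a [a' [aP <-]]]] := hs x; exists y => //.
  have h := graph_iso_pointed L y aP; apply/eqP; rewrite eqn_leq.
  by rewrite (pointed_iso_closed_walks (leqnn L) h)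
    (pointed_iso_closed_walks (leqnn L) (pointed_iso_sym h)).
have exP : exists m, P m by have [x] := vertex_inh X; exists (size (closed_walks L x));
  apply/asboolP; exists x.
have bP m : P m -> (m <= \max_(y <- s) size (closed_walks L y))%N.
  move=> /asboolP[x <-]; have [y ys ->] := hx x.
  exact: (leq_bigmax_seq (F := fun y => size (closed_walks L y))).
have [m /asboolP[x0 e] h] := ex_maxnP exP bP; exists x0 => x; rewrite e.
by apply: h; apply/asboolP; exists x.
Qed.

(* A loop that does not lift to a loop would give some vertex of [Y] more closed walks
   than any vertex of [X] has. *)
Lemma covering_lifts_loops : exists L, forall (Y : graph) (f : X -> Y), locally_bijective f ->
  (forall y : Y, exists x : X, pointed_iso L x y) -> lifts_loops f k.
Proof.
(* At most [S] steps lead from a translate of [x0] to [z], the loop takes at most [maxn 2 k], and at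
   most [S] lead back. *)
have [S hS] := cocompact_dense hc; pose L := (2 * S + maxn 2 k)%N; exists L => Y f fP hY.
have [x0 max] := maximal_closed_walks L.
move=> z d [pd ld _ sd]; have [a [a' [aP dz]]] := hS x0 z; set x1 := a x0 in dz.
have M1 : (size (closed_walks L x0) <= size (closed_walks L x1))%N.
  exact: (pointed_iso_closed_walks (leqnn L) (graph_iso_pointed L x0 aP)).
have [w [pw lw sw]] := distP x1 z; have sw' : (size w <= S)%N by rewrite sw dist_sym.
have pfw := path_map_lb fP pw; have lfw : last (f x1) (map f w) = f z by rewrite last_map lw.
have [p py] := hY (f x1); have M2 := pointed_iso_closed_walks (leqnn L) (pointed_iso_sym py).
have p1 : path (@adj Y) (f x1) (map f w ++ d) by rewrite cat_path pfw lfw.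
have l1 : last (f x1) (map f w ++ d) = f z by rewrite last_cat lfw.
have := @lift_same_end X Y f fP x1 (map f w ++ d) (map f w) p1 pfw.
rewrite l1 lfw => /(_ erefl); rewrite (lift_cat f x1 _ d) lift_map // last_cat lw; apply.
apply: (covering_closed_walks fP (leq_trans M2 (leq_trans (max p) M1))).
- by rewrite cat_path p1 l1 -lfw path_inv_walk.
- by rewrite last_cat l1 -lfw last_inv_walk.
- by rewrite !size_cat size_inv_walk !size_map /L; lia.
Qed.

Lemma short_walks_null n : exists N, forall m (Y : graph), (N <= m)%N -> (2 * n + 1 <= m)%N ->
  (forall y : Y, exists x : X, pointed_iso m x y) ->
  forall (y : Y) w, path (@adj Y) y w -> last y w = y -> (size w <= 2 * n + 1)%N ->
  walk_homo k predT y w [::].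
Proof.
have slc := k_simply_connected_simply_loop_connected.
have [s hs] := cocompact_automorphisms hc.
have /choice[B BP] : forall xw : X * seq X, exists N,
    path (@adj X) xw.1 xw.2 -> last xw.1 xw.2 = xw.1 ->
    walk_homo k (fun y => dist xw.1 y <= N)%N xw.1 xw.2 [::].
  move=> [x w] /=; have [h|h] := pselect (path (@adj X) x w /\ last x w = x).
    by have [N hN] := walk_homo_bound (slc x w h.1 h.2); exists N.
  by exists 0%N => h1 h2; case: h.
pose N := (\max_(x <- s) \max_(w <- closed_walks (2 * n + 1) x) B (x, w))%N.
exists N => m Y Nm nm hY y w pw lw sw.
have [x1 x1y] := hY y; have [x xs [a [a' [aP ax]]]] := hs x1.
have xy : pointed_iso m x y.
  by apply: pointed_iso_trans x1y; rewrite -ax; exact: graph_iso_pointed aP.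
have [g [g' [gx h1 h2 a1 a2]]] := xy.
have wm : all (fun b => dist y b <= m)%N w by apply: walk_in_ball pw _; exact: leq_trans nm.
have g'y : g' y = x by have [|_] := h1 x; rewrite ?distxx // gx.
have pw' : path (@adj X) x (map g' w).
  by rewrite -g'y; apply: (@walk_in_map Y X (fun b => dist y b <= m)%N) => //; rewrite distxx.
have lw' : last x (map g' w) = x by rewrite -g'y last_map lw.
have hw : walk_homo k (fun b => dist x b <= m)%N x (map g' w) [::].
  apply: (sub_homo _ (BP (x, map g' w) pw' lw')) => b; rewrite !unfold_in /= => hb.
  apply: leq_trans hb _; apply: leq_trans Nm.
  apply: leq_trans (_ : \max_(v <- closed_walks (2 * n + 1) x) B (x, v) <= _)%N.
    apply: (leq_bigmax_seq (F := fun v => B (x, v))) => //; apply/closed_walksP.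
    by rewrite size_map.
  exact: (leq_bigmax_seq (F := fun x => \max_(v <- closed_walks (2 * n + 1) x) B (x, v))%N).
have gg : map g (map g' w) = w.
  by rewrite -map_comp map_id_in // => b /(allP wm) /h2[].
rewrite -gx -gg; apply: (walk_homo_map (w' := [::]) _ _ _ hw).
- by rewrite distxx.
- by move=> b c; rewrite !unfold_in => /h1[_ eb] /h1[_ ec] e; rewrite -eb e ec.
- by move=> b c; rewrite !unfold_in; exact: a1.
Qed.

End Main.

Theorem proposition1p5 (R : realType) (k : nat) (X : graph)
    (hk : k_simply_connected R k X) (hc : cocompact_isometry_group R X) :
  LG_rigid R X <->
  exists r : R, 0 < r /\
    forall Y : graph,
      k_simply_connected R k Y -> locally_graph r X Y -> isometric R X Y.
Proof.
have pos n : 0 < n%:R + 2^-1 :> R by rewrite ltr_wpDl // invr_gt0.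
have [[n hn]|ub] := pselect (bounded_graph X).
  pose r : R := (2 * n + 3)%N%:R + 2^-1.
  have loc Y : locally_graph r X Y -> isometric R X Y.
    by move=> hY; have [y] := vertex_inh Y; have [x] := hY y; exact: bounded_ball_isometric hn.
  split=> _; exists r; [|exact: pos|by move=> Y /loc; exact: isometric_covers].
  by split=> [|Y _]; [exact: pos|exact: loc].
have [n0 hn0] := locally_graph_pointed_iso hc ub.
split.
  move=> [r0 _ rig]; have [n1 hn1] := pointed_iso_le_radius r0.
  have [L hL] := covering_lifts_loops k hc.
  (* [n0] turns metric balls into combinatorial ones, [n1] exceeds the rigidity scale [r0] by 1, and
     [L] makes short loops lift to loops. *)
  pose n := maxn n0 (maxn n1 L); exists (n%:R + 2^-1); split=> // Y kY hY.
  have hp := hn0 n Y (leq_maxl _ _) hY.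
  have hp' m : (m <= n)%N -> forall y : Y, exists x : X, pointed_iso m x y.
    by move=> mn y; have [x xy] := hp y; exists x; exact: pointed_iso_sub xy.
  have [|f fC] := rig Y.
    by apply: (pointed_iso_locally_graph hn1); apply: hp'; rewrite /n; lia.
  have fK : lifts_loops f k by apply: hL; [exact: fC.2|apply: hp'; rewrite /n; lia].
  have [f' fiso] :=
    injective_covering_iso fC (k_simply_connected_covering_injective fC.2 fK kY).
  exact: graph_iso_isometric fiso.
move=> [r0 [_ hr0]]; have [n hn] := pointed_iso_le_radius r0.
have [N hN] := short_walks_null hk hc n.
(* Balls of radius [m] contain all closed walks of length at most [2 n + 1] from their centre,
   together with contractions of them, which stay within [N]. *)
pose m := maxn (maxn n0 N) (2 * n + 1); exists (m%:R + 2^-1) => // Y hY.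
have hp : forall y : Y, exists x : X, pointed_iso m x y by apply: hn0 hY; rewrite /m; lia.
have [y0] := vertex_inh Y; have fP := @uproj_lb k Y y0.
have fK := @uproj_lifts_loops k Y y0.
have cU : covers X (ucover k y0).
  apply: (@isometric_covers R); apply: hr0.
    by apply: simply_loop_connected_k_simply_connected; exact: ucover_simply_loop_connected.
  apply: (pointed_iso_locally_graph hn) => u; have [x xy] := hp (uproj u); exists x.
  apply: (@pointed_iso_trans _ _ Y _ _ (uproj u)).
    by apply: pointed_iso_sub xy; rewrite /m; lia.
  apply: pointed_iso_sym; apply: (short_loops_pointed_iso fP) => w pw lw sw.
  apply: (lift_null fP fK _ pw); apply: (hN m) => //; by rewrite /m; lia.
exact: (covers_trans cU fP (@uproj_surj k Y y0)).
Qed.
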